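(* Let $(X,\|\cdot\|)$ be a complex Banach space, let $(M_p)_{p\ge0}$ be a sequence of positive real numbers with $M_0=1$ satisfying (M.1), (M.2) and (M.3'), and let $T\in\mathcal{D}'_{L^1}((M_p):X)$ (Beurling case, $*=(M_p)$), resp. $T\in\mathcal{D}'_{L^1}(\{M_p\}:X)$ (Roumieu case, $*=\{M_p\}$). Consider the following assertions: (i) There exist a number $l>0$, resp. a sequence $(r_p)\in\mathrm{R}$, and two functions $f,g\in AA(\mathbb{R}:X)$ such that $T=P_l(D)f+g$, resp. $T=P_{r_p}(D)f+g$. (ii) There exist an ultradifferential operator $P(D)=\sum_{p=0}^\infty a_pD^p$ of class $(M_p)$, resp. $\{M_p\}$, and two functions $f,g\in AA(\mathbb{R}:X)$ such that $T=P(D)f+g$. (iii) $T*\varphi\in AA(\mathbb{R}:X)$ for all $\varphi\in\mathcal{D}^{*}$. (iv) There exists $h>0$ such that for each compact set $K\subseteq\mathbb{R}$, resp. for each $h>0$ and for each compact set $K\subseteq\mathbb{R}$, we have $T*\varphi\in AA(\mathbb{R}:X)$ for all $\varphi\in\mathcal{D}^{M_p,h}_K$. Then (i) $\Rightarrow$ (ii) $\Rightarrow$ (iii) $\Leftrightarrow$ (iv). Furthermore, if $(M_p)$ additionally satisfies (M.3), then the assertions (i)-(iv) are equivalent for the Beurling class.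
   Context: Conditions on $(M_p)$: (M.1) $M_p^2\le M_{p+1}M_{p-1}$ for $p\in\mathbb{N}$; (M.2) there are $A,H>1$ with $M_p\le AH^p\sup_{0\le i\le p}M_iM_{p-i}$ for $p\in\mathbb{N}$; (M.3') $\sum_{p=1}^\infty M_{p-1}/M_p<\infty$; (M.3) $\sup_{p\in\mathbb{N}}\sum_{q=p+1}^\infty \frac{M_{q-1}M_{p+1}}{pM_pM_q}<\infty$. Put $m_p=M_p/M_{p-1}$, $p\in\mathbb{N}$. Almost automorphic functions: $AA(\mathbb{R}:X)$ is the space of continuous $f:\mathbb{R}\to X$ such that every real sequence $(b_n)$ has a subsequence $(a_n)$ for which there is a map $g:\mathbb{R}\to X$ with $\lim_n f(t+a_n)=g(t)$ and $\lim_n g(t-a_n)=f(t)$ pointwise for $t\in\mathbb{R}$. Test spaces: for compact $K\subseteq\mathbb{R}$ and $h>0$, $\mathcal{D}^{M_p,h}_K=\{\phi\in C^\infty(\mathbb{R}):\operatorname{supp}\phi\subseteq K,\ \|\phi\|_{M_p,h,K}:=\sup_{t\in K,\,p\in\mathbb{N}_0}h^p|\phi^{(p)}(t)|/M_p<\infty\}$. Put $\mathcal{D}^{(M_p)}_K=\operatorname{projlim}_{h\to\infty}\mathcal{D}^{M_p,h}_K$, $\mathcal{D}^{\{M_p\}}_K=\operatorname{indlim}_{h\to0}\mathcal{D}^{M_p,h}_K$ and $\mathcal{D}^{*}=\operatorname{indlim}_{K}\mathcal{D}^{*}_K$ over compact $K\subseteq\mathbb{R}$, where $*$ stands for $(M_p)$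 (Beurling) or $\{M_p\}$ (Roumieu). $\mathcal{D}'^{*}(X)$ is the space of continuous linear maps $\mathcal{D}^{*}\to X$. A locally integrable function $f:\mathbb{R}\to X$ is identified with $\varphi\mapsto\int f\varphi\,dt$. Bounded ultradistributions: for $h>0$, $\mathcal{D}_{L^1}((M_p),h)$ is the Banach space of $f\in C^\infty(\mathbb{R})$ (complex-valued) with all derivatives in $L^1(\mathbb{R})$ and $\|f\|_{1,h}:=\sup_{p\in\mathbb{N}_0}h^p\|f^{(p)}\|_{L^1}/M_p<\infty$. Put $\mathcal{D}_{L^1}((M_p))=\operatorname{projlim}_{h\to+\infty}\mathcal{D}_{L^1}((M_p),h)$ and $\mathcal{D}_{L^1}(\{M_p\})=\operatorname{indlim}_{h\to0+}\mathcal{D}_{L^1}((M_p),h)$. $\mathcal{D}'_{L^1}((M_p):X)$, resp. $\mathcal{D}'_{L^1}(\{M_p\}:X)$, is the space of continuous linear maps from $\mathcal{D}_{L^1}((M_p))$, resp. $\mathcal{D}_{L^1}(\{M_p\})$, to $X$; by restriction to $\mathcal{D}^{*}$ its elements are regarded as elements of $\mathcal{D}'^{*}(X)$. Convolution: for $T\in\mathcal{D}'^{*}(X)$ and $\varphi\in\mathcal{D}^{*}$, $T*\varphi$ is the smooth $X$-valued function $(T*\varphi)(x)=\langle T,\varphi(x-\cdot)\rangle$. For a general $\varphi\in\mathcal{D}^{M_p,h}_K$ (which need not lie in $\mathcal{D}^{*}$), $T*\varphi\in\mathcal{D}'^{*}(X)$ is the convolution of $T$ with the compactly supported function $\varphi$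 regarded as a scalar compactly supported ultradistribution, i.e. $\langle T*\varphi,\psi\rangle=\langle T,\int\varphi(s)\psi(\cdot+s)\,ds\rangle$ for $\psi\in\mathcal{D}^{*}$; ''$T*\varphi\in AA(\mathbb{R}:X)$'' means that this ultradistribution is (given by) an element of $AA(\mathbb{R}:X)$. Ultradifferential operators: $P(D)=\sum_{p\ge0}a_pD^p$ ($a_p\in\mathbb{C}$, $D=-i\,d/dx$) is of class $(M_p)$, resp. $\{M_p\}$, if there exist $l>0$ and $C>0$, resp. for every $l>0$ there exists $C>0$, such that $|a_p|\le Cl^p/M_p$ for all $p\in\mathbb{N}$. It acts on $\mathcal{D}'^{*}(X)$ by $\langle P(D)T,\varphi\rangle=\langle T,\sum_p(-1)^pa_pD^p\varphi\rangle$. $\mathrm{R}$ is the family of all sequences $(r_p)$ of positive real numbers tending to infinity. For $l>0$ and $(r_p)\in\mathrm{R}$, $P_l(x)=(1+x^2)\prod_{p\in\mathbb{N}}\bigl(1+\frac{x^2}{l^2m_p^2}\bigr)$ and $P_{r_p}(x)=(1+x^2)\prod_{p\in\mathbb{N}}\bigl(1+\frac{x^2}{r_p^2m_p^2}\bigr)$. In assertion (i), $P_l(D)$, resp. $P_{r_p}(D)$, denotes the corresponding ultradifferential operator of class $(M_p)$, resp. $\{M_p\}$; that is, (i) includes the requirement that $P_l$, resp. $P_{r_p}$, is of class $(M_p)$, resp. $\{M_p\}$ (under (M.1), (M.2), (M.3) $P_l$ is of class $(M_p)$ for every $l>0$). Equalities $T=P(D)f+g$ are in $\mathcal{D}'^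{*}(X)$.
   Formalization: In the final equivalence for the Beurling class, (M.2) is taken with the infimum over 0≤i≤p (Komatsu's condition) instead of the printed supremum, which is vacuous when M_0=1 and makes the claim false (M_p=2^{p²}, T=0: (ii)–(iv) hold, (i) fails). *)

(* Defs.v *)
From HB Require Import structures.
From mathcomp Require Import all_boot all_order all_algebra.
From mathcomp Require Import complex.
From mathcomp Require Import all_classical all_reals all_analysis.

Set Implicit Arguments.
Unset Strict Implicit.
Unset Printing Implicit Defensive.

Import Order.TTheory GRing.Theory Num.Theory.
Import numFieldNormedType.Exports.

Local Open Scope classical_set_scope.
Local Open Scope ring_scope.
Local Open Scope complex_scope.

(* [Beurling] stands for the class (M_p), [Roumieu] for the class {M_p}. *)
Inductive ultra_class := Beurling | Roumieu.

(* Indices p in N = {1, 2, ...} are rendered by the guard [(0 < p)%N]. *)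

Definition cond_M1 (R : realType) (M : nat -> R) : Prop :=
  forall p : nat, (0 < p)%N -> M p ^+ 2 <= M p.+1 * M p.-1.

(* For M_0 = 1 this form of (M.2), with a supremum, always holds (take i = 0).
   The supremum is over positive numbers, so 0 is harmless as a default. *)
Definition cond_M2 (R : realType) (M : nat -> R) : Prop :=
  exists A H : R, [/\ 1 < A, 1 < H & forall p : nat, (0 < p)%N ->
    M p <= A * H ^+ p * \big[Num.max/0]_(i < p.+1) (M i * M (p - i)%N)].

(* Komatsu's (M.2), stability under ultradifferential operators: the bound
   holds with the infimum over 0 <= i <= p.  This is what puts P_l in the
   class (M_p): comparing the coefficients of x^(2p) requires a bound of
   M_(2p) by a geometric sequence times M_p ^ 2, which (M.1) and (M.3) do not
   give (for instance M_p = 2 ^ (p ^ 2)). *)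
Definition cond_M2_inf (R : realType) (M : nat -> R) : Prop :=
  exists A H : R, [/\ 1 < A, 1 < H & forall p : nat, (0 < p)%N ->
    forall i : nat, (i <= p)%N -> M p <= A * H ^+ p * (M i * M (p - i)%N)].

Definition cond_M3' (R : realType) (M : nat -> R) : Prop :=
  (\sum_(1 <= p <oo) (M p.-1 / M p)%:E < +oo)%E.

Definition cond_M3 (R : realType) (M : nat -> R) : Prop :=
  (ereal_sup [set (\sum_(p.+1 <= q <oo)
      (M q.-1 * M p.+1 / (p%:R * M p * M q))%:E)%E
    | p in [set p : nat | (0 < p)%N]] < +oo)%E.

Notation modc z := (ComplexField.Normc.normc z).

Definition cderiv (R : realType) (p : nat) (f : R -> R[i]) (t : R) : R[i] :=
  derive1n p (fun s : R => complex.Re (f s)) t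
    +i* derive1n p (fun s : R => complex.Im (f s)) t.

Definition smooth (R : realType) (f : R -> R[i]) : Prop :=
  forall (p : nat) (t : R),
    derivable (derive1n p (fun s : R => complex.Re (f s))) t 1 /\
    derivable (derive1n p (fun s : R => complex.Im (f s))) t 1.

Definition supp (R : realType) (f : R -> R[i]) : set R :=
  closure [set t | f t != 0].

(* A vector space of functions with a translation-invariant topology, given by
   its carrier and the neighbourhoods of 0; [nbhs0 U] only depends on the
   trace of U on the carrier. *)
Record fspace (R : realType) := FSpace {
  carrier : set (R -> R[i]) ;
  nbhs0 : set (set (R -> R[i])) }.

Definition normed_fspace (R : realType) (S : set (R -> R[i]))
    (N : (R -> R[i]) -> \bar R) : fspace R :=
  let E := [set f | S f /\ (N f < +oo)%E] in
  FSpace E [set U | exists e : R, 0 < e /\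
                      forall f, E f -> (N f < e%:E)%E -> U f].

(* Projective limit: the intersection, with the initial topology for the
   inclusions into the E i. *)
Definition projlim (R : realType) (I : eqType) (D : set I) (E : I -> fspace R) :
    fspace R :=
  let F := [set f | forall i, D i -> carrier (E i) f] in
  FSpace F [set U | exists (s : seq I) (V : I -> set (R -> R[i])),
    (forall i, i \in s -> D i /\ nbhs0 (E i) (V i)) /\
    (forall f, F f -> (forall i, i \in s -> V i f) -> U f)].

Definition absolutely_convex (R : realType) (V : set (R -> R[i])) : Prop :=
  forall (a b : R[i]) (f g : R -> R[i]), V f -> V g -> modc a + modc b <= 1 ->
    V (fun t => a * f t + b * g t).

(* Inductive limit of a directed family of subspaces: the union, with the
   finest locally convex topology making the inclusions of the E i continuous. *)
Definition indlim (R : realType) (I : Type) (D : set I) (E : I -> fspace R) :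
    fspace R :=
  let F := [set f | exists i, D i /\ carrier (E i) f] in
  FSpace F [set U | exists V : set (R -> R[i]),
    [/\ absolutely_convex V, V `<=` F, V `<=` U &
        forall i, D i -> nbhs0 (E i) V]].

Definition continuous_linear (R : realType) (X : normedModType R[i])
    (E : fspace R) (T : (R -> R[i]) -> X) : Prop :=
  (forall (a : R[i]) (f g : R -> R[i]), carrier E f -> carrier E g ->
     T (fun t => a * f t + g t) = a *: T f + T g) /\
  (forall (f : R -> R[i]) (e : R), carrier E f -> 0 < e ->
     nbhs0 E [set u | `|T (fun t => f t + u t) - T f| < e%:C]).

Section test_spaces.
Variables (R : realType) (M : nat -> R).

(* For K empty the supremum is -oo; the space is then {0}. *)
Definition norm_sup (h : R) (K : set R) (f : R -> R[i]) : \bar R :=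
  ereal_sup [set (h ^+ p * modc (cderiv p f t) / M p)%:E
            | p in [set: nat] & t in K].

Definition DKh (K : set R) (h : R) : fspace R :=
  normed_fspace [set f | smooth f /\ supp f `<=` K] (norm_sup h K).

Definition DK (c : ultra_class) (K : set R) : fspace R :=
  match c with
  | Beurling => projlim [set h : R | 0 < h] (DKh K)
  | Roumieu => indlim [set h : R | 0 < h] (DKh K)
  end.

Definition Dtest (c : ultra_class) : fspace R :=
  indlim [set K : set R | compact K] (DK c).

Definition norm_L1 (h : R) (f : R -> R[i]) : \bar R :=
  ereal_sup [set ((h ^+ p / M p)%:E *
      \int[@lebesgue_measure R]_t (modc (cderiv p f t))%:E)%E
    | p in [set: nat]].

Definition DL1h (h : R) : fspace R :=
  normed_fspace
    [set f | smooth f /\ forall p : nat,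
       (@lebesgue_measure R).-integrable setT
         (fun t => (modc (cderiv p f t))%:E)]
    (norm_L1 h).

Definition DL1 (c : ultra_class) : fspace R :=
  match c with
  | Beurling => projlim [set h : R | 0 < h] DL1h
  | Roumieu => indlim [set h : R | 0 < h] DL1h
  end.

End test_spaces.

Section vector_valued.
Variables (R : realType) (X : completeNormedModType R[i]).

(* v is the Riemann integral of F over [a, b]: x lists the points and s the
   tags of a partition in n steps. *)
Definition is_riemann_integral (F : R -> X) (a b : R) (v : X) : Prop :=
  forall e : R, 0 < e -> exists d : R, 0 < d /\
    forall (n : nat) (x s : nat -> R), x 0%N = a -> x n = b ->
      (forall i : nat, (i < n)%N ->
         [/\ x i <= s i, s i <= x i.+1 & x i.+1 - x i < d]) ->
      `|\sum_(i < n) (x i.+1 - x i)%:C *: F (s i) - v| < e%:C.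

(* Integral over the line of a continuous compactly supported function (the
   only functions integrated below): the Riemann integral over any interval
   outside which F vanishes. *)
Definition vint (F : R -> X) : X :=
  xget 0 [set v | exists a b : R, [/\ a < b,
    (forall t : R, t < a \/ b < t -> F t = 0) & is_riemann_integral F a b v]].

Definition almost_automorphic (f : R -> X) : Prop :=
  continuous f /\
  forall b : nat -> R, exists k : nat -> nat,
    (forall n : nat, (k n < k n.+1)%N) /\
    exists g : R -> X, forall t : R,
      (fun n => f (t + b (k n))) @ \oo --> g t /\
      (fun n => g (t - b (k n))) @ \oo --> f t.

Definition regular (f : R -> X) (phi : R -> R[i]) : X :=
  vint (fun t => phi t *: f t).

Definition eq_ultradistr (c : ultra_class) (M : nat -> R)
    (S T : (R -> R[i]) -> X) : Prop :=
  forall phi, carrier (Dtest M c) phi -> S phi = T phi.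

(* T * phi for phi in the test space, as a function. *)
Definition conv (T : (R -> R[i]) -> X) (phi : R -> R[i]) (x : R) : X :=
  T (fun t => phi (x - t)).

Definition cint (f : R -> R[i]) : R[i] :=
  (\int[@lebesgue_measure R]_s complex.Re (f s)) +i*
  (\int[@lebesgue_measure R]_s complex.Im (f s)).

(* T * phi for a general compactly supported phi, as an ultradistribution. *)
Definition conv_distr (T : (R -> R[i]) -> X) (phi psi : R -> R[i]) : X :=
  T (fun t => cint (fun s => phi s * psi (t + s))).

Definition AA_distr (c : ultra_class) (M : nat -> R) (T : (R -> R[i]) -> X) :
    Prop :=
  exists2 F : R -> X, almost_automorphic F & eq_ultradistr c M T (regular F).

End vector_valued.

Section operators.
Variable R : realType.

Definition of_class (c : ultra_class) (M : nat -> R) (a : nat -> R[i]) : Prop :=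
  match c with
  | Beurling => exists l C : R, [/\ 0 < l, 0 < C & forall p : nat, (0 < p)%N ->
      modc (a p) <= C * l ^+ p / M p]
  | Roumieu => forall l : R, 0 < l -> exists C : R, 0 < C /\
      forall p : nat, (0 < p)%N -> modc (a p) <= C * l ^+ p / M p
  end.

(* sum_p (-1)^p a_p D^p phi, with D = - i d/dt. *)
Definition transpose_op (a : nat -> R[i]) (phi : R -> R[i]) (t : R) : R[i] :=
  limn (series (fun p : nat =>
    (-1) ^+ p * a p * ((- 'i) ^+ p * cderiv p phi t)) : nat -> R[i]^o).

Definition apply_op (X : completeNormedModType R[i]) (a : nat -> R[i])
    (T : (R -> R[i]) -> X) (phi : R -> R[i]) : X :=
  T (transpose_op a phi).

(* a is the coefficient sequence of the power series of
   (1 + x^2) prod_(p >= 1) (1 + x^2 / (r_p^2 m_p^2)), m_p = M_p / M_(p-1). *)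
Definition is_product_symbol (M r : nat -> R) (a : nat -> R[i]) : Prop :=
  forall x : R, exists v : R,
    (fun n : nat => (1 + x ^+ 2) * \prod_(1 <= p < n.+1)
       (1 + x ^+ 2 / (r p ^+ 2 * (M p / M p.-1) ^+ 2))) @ \oo --> v /\
    (series (fun p : nat => a p * x%:C ^+ p) : nat -> R[i]^o) @ \oo
      --> (v%:C : R[i]^o).

(* The sequences r defining the operators of assertion (i): constant for P_l,
   positive and tending to infinity for P_(r_p). *)
Definition symbol_seq (c : ultra_class) (r : nat -> R) : Prop :=
  match c with
  | Beurling => exists l : R, 0 < l /\ r = (fun _ => l)
  | Roumieu => (forall p, 0 < r p) /\ r @ \oo --> +oo
  end.

End operators.

Section assertions.
Variables (R : realType) (X : completeNormedModType R[i]).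
Variables (c : ultra_class) (M : nat -> R) (T : (R -> R[i]) -> X).

Definition representable (a : nat -> R[i]) : Prop :=
  exists f g : R -> X, [/\ almost_automorphic f, almost_automorphic g &
    eq_ultradistr c M T
      (fun phi => apply_op a (regular f) phi + regular g phi)].

Definition assertion_i : Prop :=
  exists (r : nat -> R) (a : nat -> R[i]),
    [/\ symbol_seq c r, is_product_symbol M r a, of_class c M a
      & representable a].

Definition assertion_ii : Prop :=
  exists a : nat -> R[i], of_class c M a /\ representable a.

Definition assertion_iii : Prop :=
  forall phi, carrier (Dtest M c) phi -> almost_automorphic (conv T phi).

Definition AA_conv_at (h : R) : Prop :=
  forall K : set R, compact K -> forall phi, carrier (DKh M K h) phi ->
    AA_distr c M (conv_distr T phi).

Definition assertion_iv : Prop :=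
  match c with
  | Beurling => exists h : R, 0 < h /\ AA_conv_at h
  | Roumieu => forall h : R, 0 < h -> AA_conv_at h
  end.

End assertions.

(* Main.v *)
(* A continuous T on D_{L^1} is bounded for one norm ||.||_{1,h0} (Beurling),
   resp. for all of them (Roumieu).  If ||phi||_{1,h} < oo for some h > h0 and
   psi is continuous with compact support, Riemann sums converge in
   ||.||_{1,h0}, so that T (int psi(x) phi(x - .) dx) = int psi(x) (T * phi)(x) dx.
   Moreover such a phi is a ||.||_{1,h0}-limit of test functions (mollify by a
   bump, truncate), and T * phi is then a uniform limit of almost automorphic
   functions under (iii); hence (iii) => (iv), and testing against bumps gives
   the converse.  (ii) => (iii): convolution with a continuous compactly
   supported kernel preserves almost automorphy.  For (iii) => (i), let G be the
   fundamental solution of P_l(D) with l = 1 / (4 h0), an infinite convolution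
   of exponential kernels.  Its p-th derivative has L^1 norm at most
   (2 l)^p M_p, so ||G||_{1, 2 h0} < oo and T = P_l(D) (T * G), with g = 0.

   The bumps are infinite convolutions of box kernels, so both constructions
   are limits of chains v_p = k_p * v_(p+1) of averages. *)

Require Import Defs.
From mathcomp Require Import all_boot all_order all_algebra.
From mathcomp Require Import complex.
From mathcomp Require Import all_classical all_reals all_analysis.
From mathcomp Require Import measurable_realfun ring lra.
Import Order.TTheory GRing.Theory Num.Theory.
Import numFieldNormedType.Exports.
Set Implicit Arguments.
Unset Strict Implicit.
Unset Printing Implicit Defensive.
Local Open Scope classical_set_scope.
Local Open Scope ring_scope.
Local Open Scope complex_scope.

(** [T] is a total function on [R -> R[i]], but it is linear and bounded only on D_{L^1}, so every
    argument handed to it must be shown to lie there. In the Beurling case this is the main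
    obstacle: neither a general phi in D^{M_p,h}_K nor the fundamental solution G is known to lie in
    that space, and [T] cannot be evaluated at their translates. What does lie there is the
    correlation t -> int psi(x) phi(x - t) dx for a suitable psi; hence T * phi is built as a limit
    F, and the identity proved is T (corr phi psi) = int psi F.

    The strict gap h0 < h drives every approximation: a bound in ||.||_{1,h} makes the derivatives
    of high order small in ||.||_{1,h0}, so translation and mollification reduce to L^1 estimates
    for finitely many derivatives.

    The operator is inverted in transposed form, corr G (P^t phi) = phi for test functions phi,
    whence T phi = int (P^t phi) F. Estimates are made for real functions, embedded by [rc]; complex
    ones are split into real and imaginary parts. *)

Local Notation "u ^[ p ]" := (derive1n p u) (at level 8, format "u ^[ p ]").

(** * L1 norms and correlations on the line *)

Section lebesgue_line.
Variable R : realType.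
Implicit Types (f g u v k : R -> R) (a b t x : R).
Notation mu := (@lebesgue_measure R).

Lemma lebesgue_measure_shift a (A : set R) : measurable A ->
  pushforward mu ((fun x => x + a) : measurableTypeR R -> measurableTypeR R) A = mu A.
Proof.
move=> mA; apply/esym.
have mf : measurable_fun [set: measurableTypeR R] ((fun x => x + a) : measurableTypeR R -> measurableTypeR R).
  exact: measurable_funD.
apply: (@lebesgue_measure_unique R (pushforward mu _)) => //= _ [[c d]] _ <-.
rewrite /pushforward.
have -> : (fun x => x + a) @^-1` `]c, d]%classic = `]c - a, d - a]%classic.
  by apply/seteqP; split => x /=; rewrite !in_itv /= ltrBlDr lerBrDr.
rewrite !lebesgue_measure_itv/= !lte_fin ltrD2r; case: ifP => // _.
by rewrite -!EFinD; congr EFin; ring.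
Qed.

Lemma ge0_integral_shift (f : R -> \bar R) a : measurable_fun setT f ->
  (forall x, 0 <= f x)%E ->
  (\int[mu]_x f (x + a)%R = \int[mu]_x f x)%E.
Proof.
move=> mf f0.
transitivity (\int[pushforward mu ((fun x => x + a)%R : measurableTypeR R -> measurableTypeR R)]_x f x)%E.
  rewrite ge0_integral_pushforward//; exact: measurable_funD.
apply: eq_measure_integral => //= [|_ A mA _]; first exact: measurable_funD.
exact: lebesgue_measure_shift.
Qed.

Lemma ge0_integral_opp (f : R -> \bar R) : measurable_fun setT f ->
  (forall x, 0 <= f x)%E ->
  (\int[mu]_x f (- x)%R = \int[mu]_x f x)%E.
Proof.
move=> mf f0.
transitivity (\int[pushforward mu (-%R : measurableTypeR R -> measurableTypeR R)]_x f x)%E.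
  by rewrite ge0_integral_pushforward.
by apply: eq_measure_integral => //= A mA _; exact: lebesgue_measureN.
Qed.

Lemma integral_shift (f : R -> \bar R) a : measurable_fun setT f ->
  (\int[mu]_x f (x + a)%R = \int[mu]_x f x)%E.
Proof.
move=> mf; rewrite integralE [RHS]integralE; congr (_ - _)%E.
  transitivity (\int[mu]_x (f^\+ (x + a)%R))%E; first by apply: eq_integral => x _; rewrite ?funeposE ?funenegE.
  by apply: ge0_integral_shift => //; exact: measurable_funepos.
transitivity (\int[mu]_x (f^\- (x + a)%R))%E; first by apply: eq_integral => x _; rewrite ?funeposE ?funenegE.
  by apply: ge0_integral_shift => //; exact: measurable_funeneg.
Qed.

Lemma Rintegral_shift f a : measurable_fun setT f ->
  \int[mu]_x f (x + a) = \int[mu]_x f x.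
Proof.
move=> mf; rewrite /Rintegral; congr fine.
by rewrite (@integral_shift (EFin \o f))//; exact/measurable_EFinP.
Qed.

(* Convolution of [u] with the reflection of [k]; its derivatives are
   those of [u], without signs. *)
Definition corr k u t : R := \int[mu]_s (k s * u (t + s)).

Lemma measurable_corr2 k u : measurable_fun setT k -> measurable_fun setT u ->
  measurable_fun setT (fun p : R * R => (k p.2 * u (p.1 + p.2))%:E).
Proof.
move=> mk mu_; apply/measurable_EFinP; apply: measurable_funM.
  by apply: (measurableT_comp mk); exact: measurable_snd.
apply: (measurableT_comp mu_); apply: measurable_funD.
  exact: measurable_fst.
exact: measurable_snd.
Qed.

Lemma corrE k u t : measurable_fun setT k -> measurable_fun setT u ->
  corr k u t = \int[mu]_x (k (x - t) * u x).
Proof.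
move=> mk mu_; rewrite -[RHS](@Rintegral_shift _ t).
  by apply: eq_Rintegral => s _; rewrite addrK (addrC s).
by apply: measurable_funM => //; apply: measurableT_comp => //; exact: measurable_funB.
Qed.

(** Tonelli makes the integrals of the positive and of the negative part measurable in t, finite or
    not; [fine] sends an infinite difference to 0. *)
Lemma measurable_corr k u : measurable_fun setT k -> measurable_fun setT u ->
  measurable_fun setT (corr k u).
Proof.
move=> mk mu_; have m2 := measurable_corr2 mk mu_.
rewrite /corr /Rintegral.
apply: (measurableT_comp (f := fine)); first exact: fine_measurable.
rewrite (_ : (fun _ => _) = (fun t => (\int[mu]_s (fun p : R * R => (k p.2 * u (p.1 + p.2))%:E)^\+%E (t, s)
   - \int[mu]_s (fun p : R * R => (k p.2 * u (p.1 + p.2))%:E)^\-%E (t, s))%E)).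
  apply: emeasurable_funB.
    apply: (@measurable_fun_fubini_tonelli_F _ _ _ _ _ mu (fun p : R * R => (k p.2 * u (p.1 + p.2))%:E)^\+%E) => //.
    exact: measurable_funepos.
  apply: (@measurable_fun_fubini_tonelli_F _ _ _ _ _ mu (fun p : R * R => (k p.2 * u (p.1 + p.2))%:E)^\-%E) => //.
  exact: measurable_funeneg.
apply/funext => t; rewrite integralE; congr (_ - _)%E; by apply: eq_integral => s _; rewrite ?funeposE ?funenegE.
Qed.

(** Extended-real, so that Young's inequality and Tonelli arguments can be stated before
    integrability is known. *)
Definition n1 u : \bar R := (\int[mu]_x (`|u x|)%:E)%E.

Lemma n1_ge0 u : (0 <= n1 u)%E.
Proof. by apply: integral_ge0 => x _; rewrite lee_fin. Qed.

Lemma measurable_norm u : measurable_fun setT u ->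
  measurable_fun setT (fun x => (`|u x|)%:E).
Proof. by move=> m; apply/measurable_EFinP; exact: measurableT_comp. Qed.

Lemma n1_shift u a : measurable_fun setT u -> n1 (fun x => u (x + a)) = n1 u.
Proof.
by move=> m; rewrite /n1 (@ge0_integral_shift (fun x => (`|u x|)%:E))//; exact: measurable_norm.
Qed.

Lemma n1_refl u a : measurable_fun setT u -> n1 (fun x => u (a - x)) = n1 u.
Proof.
move=> m; rewrite -(n1_shift a m) /n1.
rewrite -[RHS]ge0_integral_opp//.
  by apply: eq_integral => x _; rewrite addrC.
by apply: measurable_norm; apply: measurableT_comp => //; exact: measurable_funD.
Qed.

Lemma le_n1 u v : measurable_fun setT u -> measurable_fun setT v ->
  (forall x, `|u x| <= `|v x|) -> (n1 u <= n1 v)%E.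
Proof.
move=> m1 m2 uv; apply: ge0_le_integral => //; first exact: measurable_norm.
  exact: measurable_norm.
by move=> x _; rewrite lee_fin.
Qed.

Lemma n1D u v : measurable_fun setT u -> measurable_fun setT v ->
  (n1 (fun x => u x + v x)%R <= n1 u + n1 v)%E.
Proof.
move=> m1 m2; rewrite /n1 -ge0_integralD//; try exact: measurable_norm.
apply: ge0_le_integral => //.
- by apply: measurable_norm; exact: measurable_funD.
- by apply: emeasurable_funD; exact: measurable_norm.
- by move=> x _; rewrite -EFinD lee_fin ler_normD.
Qed.

Lemma n1Z u c : measurable_fun setT u -> n1 (fun x => c * u x) = (`|c|%:E * n1 u)%E.
Proof.
move=> m1; rewrite /n1 -ge0_integralZl//; last exact: measurable_norm.
by apply: eq_integral => x _; rewrite normrM EFinM.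
Qed.

Lemma integrable_n1 u : measurable_fun setT u -> (n1 u < +oo)%E ->
  mu.-integrable setT (EFin \o u).
Proof. by move=> m h; apply/integrableP; split => //; exact/measurable_EFinP. Qed.

Lemma n1_integrable u : mu.-integrable setT (EFin \o u) ->
  measurable_fun setT u /\ (n1 u < +oo)%E.
Proof. by move/integrableP => [/measurable_EFinP ? ?]. Qed.

(** Young's inequality for L^1: exchange the integrals by Tonelli, then the inner one is translation
    invariant. Where the integral defining [corr] is infinite its value is 0, which keeps the
    pointwise bound true. *)
Lemma corr_n1 k u : measurable_fun setT k -> measurable_fun setT u ->
  (n1 (corr k u) <= n1 k * n1 u)%E.
Proof.
move=> mk mu_; have m2 := measurable_corr2 mk mu_.
have ma : measurable_fun setT (fun p : R * R => (`|k p.2 * u (p.1 + p.2)|)%:E).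
  by apply/measurable_EFinP; apply: measurableT_comp => //; exact/measurable_EFinP.
apply: (@le_trans _ _ (\int[mu]_t \int[mu]_s (`|k s * u (t + s)|)%:E)%E).
  apply: ge0_le_integral => //.
  - by apply: measurable_norm; exact: measurable_corr.
  - exact: (@measurable_fun_fubini_tonelli_F _ _ _ _ _ mu (fun p : R * R => (`|k p.2 * u (p.1 + p.2)|)%:E)).
  - move=> t _; rewrite /corr /Rintegral.
    have mt : measurable_fun setT (fun s => (k s * u (t + s))%:E).
      by apply/measurable_EFinP; apply: measurable_funM => //; apply: measurableT_comp => //; exact: measurable_funD.
    apply: le_trans (le_abse_integral mu measurableT mt).
    by case: (integral _ _ _) => [r| |] //=; rewrite normr0 leey.
rewrite (@fubini_tonelli _ _ _ _ _ mu mu (fun p : R * R => (`|k p.2 * u (p.1 + p.2)|)%:E))//=.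
rewrite (_ : (n1 k * n1 u = \int[mu]_s ((`|k s|)%:E * n1 u))%E); last first.
  rewrite ge0_integralZr//; [exact: measurable_norm|exact: n1_ge0].
rewrite le_eqVlt; apply/orP; left; apply/eqP; apply: eq_integral => s _.
rewrite -(n1_shift s mu_) /n1 -ge0_integralZl//; last first.
  by apply: measurable_norm; apply: measurableT_comp => //; exact: measurable_funD.
by apply: eq_integral => t _; rewrite normrM EFinM.
Qed.
Lemma integrable_scale c k : mu.-integrable setT (EFin \o k) ->
  mu.-integrable setT (EFin \o (fun x : R => c * k x)).
Proof.
move=> ik; rewrite (_ : _ \o _ = (cst c%:E \* (EFin \o k))%E); last first.
  by apply/funext => x /=; rewrite EFinM.
exact: integrableZl.
Qed.

Lemma integrable_abs k : mu.-integrable setT (EFin \o k) ->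
  mu.-integrable setT (EFin \o (fun x : R => `|k x|)).
Proof. exact: integrable_norm. Qed.

Lemma integrable_bmul k u (B : R) : mu.-integrable setT (EFin \o k) ->
  measurable_fun setT u -> (forall x, `|u x| <= B) ->
  mu.-integrable setT (EFin \o (fun x => k x * u x)).
Proof.
move=> ik mu_ uB; have [mk _] := n1_integrable ik.
apply: (@le_integrable _ _ _ mu _ measurableT _ (EFin \o (fun x => B * k x))).
- by apply/measurable_EFinP; exact: measurable_funM.
- move=> x _ /=; rewrite lee_fin !normrM mulrC ler_wpM2r//.
  by rewrite (le_trans (uB x))// ler_norm.
- exact: integrable_scale.
Qed.

Lemma measurable_shift u t : measurable_fun setT u -> measurable_fun setT (fun s : R => u (t + s)).
Proof. by move=> m; apply: measurableT_comp => //; exact: measurable_funD. Qed.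

Lemma measurable_refl u t : measurable_fun setT u -> measurable_fun setT (fun s : R => u (s - t)).
Proof. by move=> m; apply: measurableT_comp => //; exact: measurable_funB. Qed.

Lemma corr_int k u (B : R) t : mu.-integrable setT (EFin \o k) ->
  measurable_fun setT u -> (forall x, `|u x| <= B) ->
  mu.-integrable setT (EFin \o (fun s => k s * u (t + s))).
Proof.
by move=> ik mu_ uB; apply: (@integrable_bmul _ _ B) => //; exact: measurable_shift.
Qed.

Lemma Rint_le k u (B : R) : mu.-integrable setT (EFin \o k) ->
  measurable_fun setT u -> (forall x, `|u x| <= B) ->
  `|\int[mu]_x (k x * u x)| <= B * fine (n1 k).
Proof.
move=> ik mu_ uB; have [mk fk] := n1_integrable ik.
apply: (le_trans (le_normr_Rintegral _ _)) => //; first exact: (@integrable_bmul _ _ B).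
rewrite (_ : fine (n1 k) = \int[mu]_x `|k x|)//.
have ink := integrable_abs ik.
rewrite -RintegralZl//; apply: le_Rintegral => //.
- exact/integrable_abs/(integrable_bmul ik mu_ uB).
- exact: integrable_scale.
- by move=> x _; rewrite normrM mulrC ler_wpM2r.
Qed.

Lemma corr_le k u (B : R) t : mu.-integrable setT (EFin \o k) ->
  measurable_fun setT u -> (forall x, `|u x| <= B) ->
  `|corr k u t| <= B * fine (n1 k).
Proof. by move=> ik mu_ uB; apply: Rint_le => //; exact: measurable_shift. Qed.

(** Differentiation under the integral sign, dominated by [B * |w|]. The weight w is free of the
    parameter, so that the derivative can be put on either factor of a correlation. *)
Lemma is_derive_int (w : R -> R) (f f' : R -> R -> R) (B t : R) :
  mu.-integrable setT (EFin \o w) ->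
  (forall t s, is_derive t 1 (f^~ s) (f' t s)) ->
  (forall t s, `|f' t s| <= B) ->
  (forall t, mu.-integrable setT (EFin \o (fun s => w s * f t s))) ->
  is_derive t 1 (fun t => \int[mu]_s (w s * f t s)) (\int[mu]_s (w s * f' t s)).
Proof.
move=> iw df fB iwf; have [mw _] := n1_integrable iw.
have dg t' s : is_derive t' 1 (fun t => w s * f t s) (w s * f' t' s).
  have d := df t' s.
  by apply: is_deriveZ.
have Pg : partial1of2 (fun t s => w s * f t s) t = (fun s => w s * f' t s).
  by apply/funext => s; rewrite partial1of2E; exact: derive_val.
have := @cvg_differentiation_under_integral R _ _ mu (fun t s => w s * f t s) setT measurableT t (t - 1) (t + 1).
rewrite Pg => H.
have {}H := H _ _ _ (fun s => B * `|w s|).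
have : h^-1 *: (\int[mu]_(y in setT) (w y * f (h + t) y) - \int[mu]_(y in setT) (w y * f t y)) @[h --> 0^'] -->
    \int[mu]_(y in setT) (w y * f' t y).
  apply: H => //.
  - by rewrite /= in_itv/=; apply/andP; split; lra.
  - by move=> s; rewrite mulr_ge0// (le_trans _ (fB t s)).
  - by apply: integrable_scale; exact: integrable_abs.
  - move=> x y _ _; rewrite partial1of2E (derive_val (is_derive := dg x y)) normrM mulrC.
    by rewrite ler_wpM2r.
set F := fun t => _; move=> cF.
have cF' : h^-1 *: ((F \o shift t) (h *: 1) - F t) @[h --> 0^'] --> \int[mu]_(y in setT) (w y * f' t y).
  by under eq_fun do rewrite /= /GRing.scale /= mulr1.
apply: DeriveDef; first by apply/cvg_ex; eexists; exact: cF'.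
by rewrite /derive; apply/cvg_lim.
Qed.
End lebesgue_line.

(** * Derivatives of correlations and L^1 control of increments *)

Section smooth_line.
Variable R : realType.
Implicit Types (f g u v k : R -> R) (a b t x : R).
Notation mu := (@lebesgue_measure R).

Lemma is_derive_corr k u u' (B B' t : R) : mu.-integrable setT (EFin \o k) ->
  (forall x, is_derive x 1 u (u' x)) -> measurable_fun setT u ->
  (forall x, `|u x| <= B) -> (forall x, `|u' x| <= B') ->
  is_derive t 1 (corr k u) (corr k u' t).
Proof.
move=> ik du mu_ uB uB'.
apply: (@is_derive_int _ _ (fun t s => u (t + s)) (fun t s => u' (t + s)) B') => //.
  move=> t0 s; have d := du (t0 + s).
  by apply: is_derive_eq; rewrite addr0 mulr1.
by move=> t0; apply: corr_int uB.
Qed.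

(** The change of variable [corrE] moves the parameter into k (x - t), which is where the minus sign
    comes from. *)
Lemma is_derive_corr2 k k' u (B B' t : R) : mu.-integrable setT (EFin \o u) ->
  (forall x, is_derive x 1 k (k' x)) -> measurable_fun setT k -> measurable_fun setT k' ->
  (forall x, `|k x| <= B) -> (forall x, `|k' x| <= B') ->
  is_derive t 1 (corr k u) (- corr k' u t).
Proof.
move=> iu dk mk mk' kB kB'; have [mu_ _] := n1_integrable iu.
have -> : corr k u = (fun t => \int[mu]_x (u x * k (x - t))).
  by apply/funext => t0; rewrite corrE//; apply: eq_Rintegral => x _; rewrite mulrC.
have -> : - corr k' u t = \int[mu]_x (u x * - k' (x - t)).
  rewrite corrE// -[LHS]mulN1r -RintegralZl//.
    by apply: eq_Rintegral => x _; ring.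
  rewrite (_ : (fun _ => _) = (fun x => u x * k' (x - t))); last by apply/funext => x; rewrite mulrC.
  by apply: (@integrable_bmul _ _ _ B') => //; exact: measurable_refl.
apply: (@is_derive_int _ _ (fun t s => k (s - t)) (fun t s => - k' (s - t)) B') => //.
- move=> t0 s; have d := dk (s - t0).
  by apply: is_derive_eq; rewrite /GRing.scale/=; ring.
- by move=> t0 s; rewrite normrN.
- by move=> t0; apply: (@integrable_bmul _ _ _ B) => //; exact: measurable_refl.
Qed.

Definition rsmooth u := forall (p : nat) x, derivable u^[p] x 1.

(** Smoothness is always proved by guessing all derivatives at once and checking a single
    differentiation step; this yields the formulas for the iterated derivatives as well. *)
Lemma derive_seq (w : nat -> R -> R) :
  (forall p x, is_derive x 1 (w p) (w p.+1 x)) ->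
  rsmooth (w 0%N) /\ forall p, (w 0%N)^[p] = w p.
Proof.
move=> dw; have E p : (w 0%N)^[p] = w p.
  elim: p => [//|p IH]; rewrite derive1nS IH; apply/funext => x.
  by rewrite derive1E; have d := dw p x; exact: derive_val.
by split => // p x; rewrite E; have d := dw p x; exact: ex_derive.
Qed.

Lemma rsmooth_is_derive u p x : rsmooth u -> is_derive x 1 u^[p] (u^[p.+1] x).
Proof.
by move=> su; rewrite derive1nS derive1E; apply/derivableP; exact: su.
Qed.

Lemma rsmooth_cont u p : rsmooth u -> continuous u^[p].
Proof. by move=> su x; apply/differentiable_continuous/derivable1_diffP/su. Qed.

Lemma rsmooth_meas u p : rsmooth u -> measurable_fun setT u^[p].
Proof. by move=> su; apply: continuous_measurable_fun; exact: rsmooth_cont. Qed.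

Lemma rsmooth_lin c u v : rsmooth u -> rsmooth v ->
  rsmooth (fun x => c * u x + v x) /\
  forall p, (fun x => c * u x + v x)^[p] = (fun x => c * u^[p] x + v^[p] x).
Proof.
move=> su sv; apply: (@derive_seq (fun p x => c * u^[p] x + v^[p] x)) => p x.
have d1 := rsmooth_is_derive p x su; have d2 := rsmooth_is_derive p x sv.
by apply: is_deriveD.
Qed.

Lemma rsmooth_refl u a : rsmooth u ->
  rsmooth (fun t => u (a - t)) /\
  forall p, (fun t => u (a - t))^[p] = (fun t => (-1) ^+ p * u^[p] (a - t)).
Proof.
move=> su.
have -> : (fun t => u (a - t)) = (fun p t => (-1) ^+ p * u^[p] (a - t)) 0%N.
  by apply/funext => t; rewrite expr0 mul1r.
apply: (@derive_seq (fun p t => (-1) ^+ p * u^[p] (a - t))) => p x.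
have d := rsmooth_is_derive p (a - x) su.
have d1 : is_derive x 1 (fun t => u^[p] (a - t)) (- u^[p.+1] (a - x)).
  by apply: is_derive_eq; rewrite /GRing.scale/=; ring.
apply: is_derive_eq.
by rewrite /GRing.scale/= exprS; ring.
Qed.

Lemma rsmooth_corr k u : mu.-integrable setT (EFin \o k) -> rsmooth u ->
  (forall p, exists B : R, forall x, `|u^[p] x| <= B) ->
  rsmooth (corr k u) /\ forall p, (corr k u)^[p] = corr k u^[p].
Proof.
move=> ik su bu; apply: (@derive_seq (fun p => corr k u^[p])) => p x.
have [B uB] := bu p; have [B' uB'] := bu p.+1.
apply: (is_derive_corr x ik _ _ uB uB'); last exact: rsmooth_meas.
by move=> y; exact: rsmooth_is_derive.
Qed.

(** The derivatives fall on the kernel, at the price of one sign each; this version serves second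
    factors that are only integrable, such as a truncated function. *)
Lemma rsmooth_corr2 k u : mu.-integrable setT (EFin \o u) -> rsmooth k ->
  (forall p, exists B : R, forall x, `|k^[p] x| <= B) ->
  rsmooth (corr k u) /\ forall p, (corr k u)^[p] = (fun t => (-1) ^+ p * corr k^[p] u t).
Proof.
move=> iu sk bk.
rewrite {1}(_ : corr k u = (fun p t => (-1) ^+ p * corr k^[p] u t) 0%N); last first.
  by apply/funext => t; rewrite expr0 mul1r.
rewrite [X in forall p, X^[p] = _](_ : corr k u = (fun p t => (-1) ^+ p * corr k^[p] u t) 0%N); last first.
  by apply/funext => t; rewrite expr0 mul1r.
apply: (@derive_seq (fun p t => (-1) ^+ p * corr k^[p] u t)) => p x.
have [B kB] := bk p; have [B' kB'] := bk p.+1.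
have d : is_derive x 1 (corr k^[p] u) (- corr k^[p.+1] u x).
  apply: (is_derive_corr2 x iu _ _ _ kB kB'); [|exact: rsmooth_meas|exact: rsmooth_meas].
  by move=> y; exact: rsmooth_is_derive.
apply: is_derive_eq.
by rewrite /GRing.scale/= exprS; ring.
Qed.

Lemma ftc u u' a b : a <= b -> (forall x, is_derive x 1 u (u' x)) -> continuous u' ->
  \int[mu]_(x in `[a, b]) u' x = u b - u a.
Proof.
rewrite le_eqVlt => /predU1P[<-|ab] du cu'.
  by rewrite set_itv1 Rintegral_set1 subrr.
have cu : continuous u.
  by move=> x; apply/differentiable_continuous/derivable1_diffP; have d := du x; exact: ex_derive.
rewrite /Rintegral (@continuous_FTC2 _ u' u)//.
- exact/continuous_subspaceT.
- split => //.
  + exact/cvg_at_right_filter/cu.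
  + exact/cvg_at_left_filter/cu.
- by move=> x _; rewrite derive1E; have d := du x; exact: derive_val.
Qed.
Lemma corr_indic (A : set R) u t :
  corr \1_A u t = \int[mu]_(s in A) u (t + s).
Proof.
rewrite [RHS]Rintegral_mkcond; apply: eq_Rintegral => s _.
by rewrite patchE indicE; case: ifP => _; rewrite ?mul1r ?mul0r.
Qed.

Lemma n1_indic a b : a <= b -> n1 (\1_(`[a, b]) : R -> R) = (b - a)%:E.
Proof.
move=> ab; rewrite /n1 (_ : (fun _ => _) = (fun x => (\1_(`[a, b] : set R) x)%:E)); last first.
  by apply/funext => x; rewrite ger0_norm// indicE ler0n.
rewrite integral_indic// setIT.
have := @lebesgue_measure_itv R `[a, b]; rewrite /= => ->.
rewrite lte_fin; case: ltP => [_|ba]; first by rewrite -EFinB.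
by rewrite (le_anti (introT andP (conj ab ba))) subrr.
Qed.

Lemma integrable_indic_itv a b : a <= b -> mu.-integrable setT (EFin \o (\1_(`[a, b]) : R -> R)).
Proof.
move=> ab; apply: integrable_n1; first exact: measurable_indic.
by rewrite n1_indic// ltry.
Qed.

Lemma is_derive_cont u u' : (forall x, is_derive x 1 u (u' x)) -> continuous u.
Proof.
by move=> du x; apply/differentiable_continuous/derivable1_diffP; have d := du x; exact: ex_derive.
Qed.

(** An increment becomes a correlation of the derivative with an indicator, so that [corr_n1]
    controls it in L^1. *)
Lemma ftc_indic u u' (d t : R) : 0 <= d -> (forall x, is_derive x 1 u (u' x)) ->
  continuous u' -> u (t + d) - u t = corr \1_(`[0, d]) u' t.
Proof.
move=> d0 du cu'; rewrite corr_indic.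
have D (s : R) : is_derive s 1 (fun s : R => u (t + s)) (u' (t + s)).
  by have D := du (t + s); apply: is_derive_eq; rewrite add0r mulr1.
rewrite (ftc d0 D) ?addr0// => s; apply: continuous_comp; last exact: cu'.
by apply: cvgD; [exact: cvg_cst|exact: cvg_id].
Qed.

(** For d >= 0 this is Young's inequality with the indicator of [0, d], of L^1 norm d; a negative d
    is reduced to -d by a translation. *)
Lemma n1_translate u u' (d : R) : (forall x, is_derive x 1 u (u' x)) -> continuous u' ->
  (n1 (fun x => u (x + d) - u x)%R <= (`|d|)%:E * n1 u')%E.
Proof.
move=> du cu'; have cu := is_derive_cont du.
have mu_ := continuous_measurable_fun cu; have mu' := continuous_measurable_fun cu'.
have pos (e : R) : 0 <= e -> (n1 (fun x => u (x + e) - u x)%R <= e%:E * n1 u')%E.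
  move=> e0; rewrite (_ : (fun x => u (x + e) - u x) = corr \1_(`[0, e]) u'); last first.
    by apply/funext => x; rewrite -ftc_indic.
  have mI : measurable_fun setT (\1_(`[0, e]) : R -> R) by exact: measurable_indic.
  apply: (le_trans (corr_n1 mI mu')).
  by rewrite n1_indic// subr0.
have [d0|d0] := leP 0 d; first by rewrite ger0_norm//; exact: pos.
rewrite ltr0_norm//; have /pos : 0 <= - d by lra.
apply: le_trans.
rewrite -(@n1_shift _ (fun x => u (x + - d) - u x) d); last first.
  apply: measurable_funB => //; apply: measurableT_comp => //; exact: measurable_funD.
apply: le_n1.
- apply: measurable_funB => //; apply: measurableT_comp => //; exact: measurable_funD.
- apply: measurable_funB => //; apply: measurableT_comp => //; last exact: measurable_funD.
  by apply: measurable_funD => //; exact: measurable_funD.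
- by move=> x; rewrite addrK distrC.
Qed.

(** If |u x| exceeded the bound, then by the fundamental theorem of calculus |u| would stay above c
    = |u x| - ||u'||_1 > ||u||_1 on [x, x + 1], contradicting the value of ||u||_1. *)
Lemma n1_bounded u u' : (forall x, is_derive x 1 u (u' x)) -> continuous u' ->
  (n1 u < +oo)%E -> (n1 u' < +oo)%E ->
  forall x, `|u x| <= fine (n1 u) + fine (n1 u').
Proof.
move=> du cu' fu fu' x; have cu := is_derive_cont du.
have mu_ := continuous_measurable_fun cu; have mu' := continuous_measurable_fun cu'.
have iu := integrable_n1 mu_ fu; have iu' := integrable_n1 mu' fu'.
have step (s : R) : 0 <= s -> `|u x| <= `|u (x + s)| + fine (n1 u').
  move=> s0; have -> : u x = u (x + s) - corr \1_(`[0, s]) u' x.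
    by rewrite -ftc_indic//; ring.
  apply: le_trans (ler_normB _ _) _; rewrite lerD2l.
  have mI : measurable_fun setT (\1_(`[0, s]) : R -> R) by exact: measurable_indic.
  rewrite (corrE x mI mu').
  under eq_Rintegral do rewrite mulrC.
  rewrite -[leRHS]mul1r; apply: Rint_le => //.
    exact: measurable_refl.
  by move=> y; rewrite ger0_norm indicE ?ler0n// lern1 leq_b1.
rewrite leNgt; apply/negP => h.
pose c := `|u x| - fine (n1 u').
have c0 : 0 < c by rewrite /c subr_gt0 (le_lt_trans _ h)// lerDr fine_ge0// n1_ge0.
have mI : measurable_fun setT (\1_(`[0, 1]) : R -> R) by exact: measurable_indic.
have : (n1 (fun s => c * (\1_(`[0%R, 1%R]) s : R))%R <= n1 (fun s => u (s + x))%R)%E.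
  apply: le_n1.
  - exact: measurable_funM.
  - by apply: measurableT_comp => //; exact: measurable_funD.
  - move=> s; rewrite indicE mem_setE in_itv/=; case: andP => [[s0 _]|_].
      rewrite mulr1 gtr0_norm// lerBlDr addrC.
      by have := step s s0; rewrite (addrC x) (addrC (fine _)).
    by rewrite mulr0 normr0.
rewrite n1Z// n1_indic// n1_shift// gtr0_norm// subr0 mule1.
rewrite -[n1 u]fineK; last by rewrite ge0_fin_numE// n1_ge0.
by rewrite lee_fin /c lerBlDr leNgt h.
Qed.
End smooth_line.

(** * Vector-valued Riemann integrals *)

Section vector_norm.
Variables (R : realType) (X : completeNormedModType R[i]).
Implicit Types (x y : X) (e : R).

(* The norm of X takes its values in R[i]. *)
Definition nX x : R := complex.Re `|x|.

Lemma nXE x : `|x| = (nX x)%:C.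
Proof.
have := ger0_Im (normr_ge0 x); rewrite /nX.
by case: (`|x|) => a b /= ->.
Qed.

Lemma nX_ge0 x : 0 <= nX x.
Proof. by rewrite -lecR -nXE normr_ge0. Qed.

Lemma nX_le x e : (nX x <= e) = (`|x| <= e%:C).
Proof. by rewrite nXE lecR. Qed.

Lemma nX_lt x e : (nX x < e) = (`|x| < e%:C).
Proof. by rewrite nXE ltcR. Qed.

Lemma nXD x y : nX (x + y) <= nX x + nX y.
Proof. by rewrite nX_le rmorphD/= -!nXE ler_normD. Qed.

Lemma nXN x : nX (- x) = nX x.
Proof. by rewrite /nX normrN. Qed.

Lemma nXB x y : nX (x - y) <= nX x + nX y.
Proof. by rewrite -(nXN y) nXD. Qed.

Lemma nX_dist x y : nX (x - y) = nX (y - x).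
Proof. by rewrite -nXN opprB. Qed.

Lemma nX0 : nX 0 = 0.
Proof. by rewrite /nX normr0. Qed.

Lemma nX_eq0 x : nX x = 0 -> x = 0.
Proof. by move=> h; apply/normr0_eq0; rewrite nXE h. Qed.

Lemma nXZ (a : R[i]) x : nX (a *: x) = modc a * nX x.
Proof.
rewrite /nX normrZ [in RHS]/= -/(nX x) (nXE x).
by rewrite (_ : `|a| = (modc a)%:C)//= mulr0 subr0.
Qed.

Lemma modcR (a : R) : modc (a%:C) = `|a|.
Proof. by rewrite /ComplexField.Normc.normc /= expr0n/= addr0 sqrtr_sqr. Qed.

Lemma modcM (a b : R[i]) : modc (a * b) = modc a * modc b.
Proof. exact: ComplexField.Normc.normcM. Qed.

Lemma modcD (a b : R[i]) : modc (a + b) <= modc a + modc b.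
Proof. exact: le_normcD. Qed.

Lemma modc_ge0 (a : R[i]) : 0 <= modc a.
Proof. by case: a => a b; rewrite sqrtr_ge0. Qed.

Lemma nXZr (a : R) x : nX (a%:C *: x) = `|a| * nX x.
Proof. by rewrite nXZ modcR. Qed.

Lemma nX_sum (n : nat) (F : nat -> X) : nX (\sum_(i < n) F i) <= \sum_(i < n) nX (F i).
Proof.
elim: n => [|n IH]; first by rewrite !big_ord0 nX0.
by rewrite !big_ord_recr/= (le_trans (nXD _ _))// lerD2r.
Qed.

Lemma posC (e : R[i]) : 0 < e -> exists2 r : R, 0 < r & e = r%:C.
Proof.
case: e => a b; rewrite ltcE/= => /andP[/eqP -> a0]; by exists a.
Qed.

Lemma cvgX {T : Type} {F : set_system T} {FF : Filter F} (u : T -> X) (l : X) :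
  u @ F --> l <-> forall e, 0 < e -> \forall t \near F, nX (u t - l) < e.
Proof.
split=> [/cvgrPdist_lt h e e0|h].
  have {}h := h e%:C; rewrite ltcR in h; have {}h := h e0.
  by near do rewrite nX_dist nX_lt.
apply/cvgrPdist_lt => e /posC[r r0 ->].
by have := h r r0; apply: filterS => t; rewrite nX_dist nX_lt.
Unshelve. all: by end_near. Qed.

Lemma cvgX_seq (u : nat -> X) (l : X) :
  u @ \oo --> l <-> forall e, 0 < e -> exists N, forall n, (N <= n)%N -> nX (u n - l) < e.
Proof.
split=> [/cvgX h e e0|h].
  by have [N _ hN] := h e e0; exists N => n Nn; exact: hN.
by apply/cvgX => e e0; have [N hN] := h e e0; exists N.
Qed.

Lemma contX (f : R -> X) : continuous f <->
  forall t e, 0 < e -> exists2 d : R, 0 < d & forall s, `|t - s| < d -> nX (f s - f t) < e.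
Proof.
split=> [h x e e0|h x].
  have := h x; move/cvgX => /(_ e e0) /nbhs_ballP[d /= d0 hd].
  by exists d => // y xy; exact: hd.
apply/cvgX => e e0; have [d d0 hd] := h x e e0.
by apply/nbhs_ballP; exists d => //= y; exact: hd.
Qed.

Lemma cauchyX (u : nat -> X) :
  (forall e, 0 < e -> exists N, forall n m, (N <= n)%N -> (N <= m)%N -> nX (u n - u m) < e) ->
  exists l : X, u @ \oo --> l.
Proof.
move=> h; apply/cvg_ex; apply/cauchy_cvgP; apply: cauchy_exP => e /posC[r r0 ->].
have [N hN] := h r r0; exists (u N); exists N => // n Nn.
by rewrite -ball_normE/= -nX_lt; exact: hN.
Qed.

Lemma nX_cvg_le (u : nat -> X) (l : X) (B : R) : u @ \oo --> l ->
  (exists N, forall n, (N <= n)%N -> nX (u n) <= B) -> nX l <= B.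
Proof.
move=> /cvgX_seq h [N hN]; apply/ler_addgt0Pr => e e0.
have [N' hN'] := h e e0.
have -> : l = u (maxn N N') - (u (maxn N N') - l) by rewrite subKr.
apply: le_trans (nXB _ _) _; apply: lerD; first by apply: hN; exact: leq_maxl.
by apply/ltW/hN'; exact: leq_maxr.
Qed.

End vector_norm.

(** * Overlaps of intervals and tagged partitions *)

Section clamp.
Variable R : realType.
Implicit Types x y lo hi : R.

Definition clamp lo hi y := Num.max lo (Num.min y hi).

(** Length of the intersection of [x0, x1] and [y0, y1]. As an increment of [clamp] it telescopes
    when summed over a partition, which the closed form in [overlapE] would hide. *)
Definition overlap x0 x1 y0 y1 := clamp x0 x1 y1 - clamp x0 x1 y0.

Lemma clampL lo hi y : y <= lo -> clamp lo hi y = lo.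
Proof. by move=> h; rewrite /clamp max_l// ge_min h. Qed.

Lemma clampM lo hi y : lo <= y -> y <= hi -> clamp lo hi y = y.
Proof. by move=> h k; rewrite /clamp min_l// max_r. Qed.

Lemma clampR lo hi y : lo <= hi -> hi <= y -> clamp lo hi y = hi.
Proof. by move=> h k; rewrite /clamp min_r// max_r. Qed.

Lemma overlapE x0 x1 y0 y1 : x0 <= x1 -> y0 <= y1 ->
  overlap x0 x1 y0 y1 = Num.max 0 (Num.min x1 y1 - Num.max x0 y0).
Proof.
move=> h k; rewrite /overlap.
have [a|/ltW a] := leP y1 x0.
  rewrite !clampL//; last exact: le_trans a.
  by rewrite subrr max_l// subr_le0 ge_min !le_max a !orbT.
have [b|/ltW b] := leP x1 y0.
  rewrite !clampR//; last exact: le_trans k.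
  by rewrite subrr max_l// subr_le0 ge_min !le_max b !orbT.
have -> : clamp x0 x1 y1 = Num.min x1 y1.
  by case: (leP x1 y1) => [c|/ltW c]; [rewrite clampR|rewrite clampM].
have -> : clamp x0 x1 y0 = Num.max x0 y0.
  by case: (leP x0 y0) => [c|/ltW c]; [rewrite clampM|rewrite clampL].
by rewrite [RHS]max_r// subr_ge0 ge_max !le_min h a b k.
Qed.

Lemma overlapC x0 x1 y0 y1 : x0 <= x1 -> y0 <= y1 ->
  overlap x0 x1 y0 y1 = overlap y0 y1 x0 x1.
Proof. by move=> h k; rewrite !overlapE// (minC x1) (maxC x0). Qed.

Lemma overlap_ge0 x0 x1 y0 y1 : x0 <= x1 -> y0 <= y1 -> 0 <= overlap x0 x1 y0 y1.
Proof. by move=> h k; rewrite overlapE// le_max lexx. Qed.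

Lemma overlap_gt0 x0 x1 y0 y1 : x0 <= x1 -> y0 <= y1 -> 0 < overlap x0 x1 y0 y1 ->
  x0 < y1 /\ y0 < x1.
Proof.
move=> h k; rewrite overlapE// lt_max ltxx/= subr_gt0 lt_min !gt_max.
by case/andP => /andP[? ?] /andP[? ?].
Qed.

Lemma overlap_le x0 x1 y0 y1 : x0 <= x1 -> y0 <= y1 -> overlap x0 x1 y0 y1 <= x1 - x0.
Proof.
move=> h k; rewrite overlapE// ge_max subr_ge0 h/= lerB//.
  by rewrite ge_min lexx.
by rewrite le_max lexx.
Qed.

Lemma overlap_full x0 x1 y0 y1 : x0 <= x1 -> y0 <= x0 -> x1 <= y1 ->
  overlap x0 x1 y0 y1 = x1 - x0.
Proof.
move=> h k l; rewrite overlapE//; last by lra.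
by rewrite (min_l l) (max_l k) max_r// subr_ge0.
Qed.

Lemma sum_telescope {V : zmodType} (n : nat) (f : nat -> V) :
  \sum_(i < n) (f i.+1 - f i) = f n - f 0%N.
Proof.
elim: n => [|n IH]; first by rewrite big_ord0 subrr.
by rewrite big_ord_recr /= IH addrC addrA subrK.
Qed.

Lemma subrBB {V : zmodType} (a b c : V) : a - b - (a - c) = c - b.
Proof. by rewrite opprB addrC addrA subrK. Qed.

Definition tagged_partition (a b d : R) (n : nat) (x s : nat -> R) :=
  [/\ x 0%N = a, x n = b & forall i : nat, (i < n)%N ->
         [/\ x i <= s i, s i <= x i.+1 & x i.+1 - x i < d]].

Lemma tagged_mono a b d n (x s : nat -> R) : tagged_partition a b d n x s ->
  forall i j, (i <= j)%N -> (j <= n)%N -> x i <= x j.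
Proof.
move=> [_ _ h] i j; elim: j => [|j IH]; first by rewrite leqn0 => /eqP ->.
rewrite leq_eqVlt => /predU1P[->//|]; rewrite ltnS => ij jn.
have [h1 h2 _] := h j jn; apply: le_trans (IH ij (ltnW jn)) _; exact: le_trans h2.
Qed.

End clamp.

(** * Riemann integrals of compactly supported X-valued functions *)

Section riemann.
Variables (R : realType) (X : completeNormedModType R[i]).
Implicit Types (F : R -> X) (a b d e : R).

Definition riemann_sum F (n : nat) (x s : nat -> R) : X :=
  \sum_(i < n) (x i.+1 - x i)%:C *: F (s i).

Definition vanish F a b := forall t, t < a \/ b < t -> F t = 0.

(** Both sums are spread over the common refinement, whose cells have length [ov i j]; on a cell of
    positive length the two tags are less than 2 * d apart. What sticks out of [a, b] is collected
    in [r j], where F is small because it vanishes nearby. *)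
Lemma riemann_sum_compare F a b A B d e n x s m y t : 0 <= e ->
  vanish F a b -> A <= a -> b <= B ->
  (forall p q, `|p - q| < 2 * d -> nX (F p - F q) <= e) ->
  tagged_partition a b d n x s -> tagged_partition A B d m y t ->
  nX (riemann_sum F m y t - riemann_sum F n x s) <= e * (B - A).
Proof.
move=> e0 Fab Aa bB Fe tP tQ.
have [x0 xn hx] := tP; have [y0 ym hy] := tQ.
pose ov i j := overlap (x i) (x i.+1) (y j) (y j.+1).
pose r j := (y j.+1 - y j) - \sum_(i < n) ov i j.
have xle i : (i < n)%N -> x i <= x i.+1 by move=> /hx[? ? _]; lra.
have yle j : (j < m)%N -> y j <= y j.+1 by move=> /hy[? ? _]; lra.
have Ex : riemann_sum F n x s = \sum_(i < n) \sum_(j < m) (ov i j)%:C *: F (s i).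
  apply: eq_bigr => i _; rewrite -scaler_suml -rmorph_sum/=; congr (_%:C *: _).
  rewrite /ov /overlap (@sum_telescope _ m (fun j => clamp (x i) (x i.+1) (y j))) y0 ym.
  rewrite -/(overlap _ _ _ _) overlap_full//; first exact: xle.
    by apply: (le_trans Aa); rewrite -x0; apply: (tagged_mono tP) => //; exact: ltnW.
  by apply: le_trans bB; rewrite -xn; exact: (tagged_mono tP).
have Ey : riemann_sum F m y t = \sum_(j < m) (\sum_(i < n) (ov i j)%:C *: F (t j) + (r j)%:C *: F (t j)).
  apply: eq_bigr => j _; rewrite -scaler_suml -scalerDl -rmorph_sum/= -rmorphD/=; congr (_%:C *: _).
  by rewrite /r [RHS]addrC subrK.
have -> : riemann_sum F m y t - riemann_sum F n x s =
   \sum_(j < m) (\sum_(i < n) (ov i j)%:C *: (F (t j) - F (s i)) + (r j)%:C *: F (t j)).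
  rewrite Ex exchange_big/= Ey -sumrB; apply: eq_bigr => j _.
  rewrite addrAC; congr (_ + _); rewrite -sumrB; apply: eq_bigr => i _.
  by rewrite scalerBr.
apply: le_trans (nX_sum _ (fun j => \sum_(i < n) (ov i j)%:C *: (F (t j) - F (s i)) + (r j)%:C *: F (t j))) _.
have -> : e * (B - A) = \sum_(j < m) e * (y j.+1 - y j).
  by rewrite -mulr_sumr sum_telescope y0 ym.
apply: ler_sum => j _; have jm := ltn_ord j.
have [ty1 ty2 yd] := hy j jm; have yj := yle j jm.
have -> : y j.+1 - y j = \sum_(i < n) ov i j + r j by rewrite /r [RHS]addrC subrK.
rewrite mulrDr; apply: le_trans (nXD _ _) _; apply: lerD.
  apply: le_trans (nX_sum _ (fun i => (ov i j)%:C *: (F (t j) - F (s i)))) _.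
  rewrite mulr_sumr; apply: ler_sum => i _; have ilt := ltn_ord i.
  have [sx1 sx2 xd] := hx i ilt; have xi := xle i ilt.
  have ov0 : 0 <= ov i j by exact: overlap_ge0.
  rewrite nXZr ger0_norm// mulrC; move: ov0; rewrite le_eqVlt => /predU1P[<-|ovp].
    by rewrite !mulr0.
  rewrite ler_pM2r//; apply: Fe.
  have [] := overlap_gt0 xi yj ovp; rewrite ltr_norml => ? ?; apply/andP; split; lra.
have rE : r j = (y j.+1 - y j) - overlap (y j) (y j.+1) a b.
  rewrite /r; congr (_ - _).
  rewrite -xn -x0 /overlap -(sum_telescope n (fun i => clamp (y j) (y j.+1) (x i))).
  by apply: eq_bigr => i _; rewrite -/(overlap _ _ _ _) /ov overlapC// xle.
have ab : a <= b by rewrite -x0 -xn; exact: (tagged_mono tP).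
have r0 : 0 <= r j by rewrite rE subr_ge0 overlap_le.
rewrite nXZr ger0_norm// mulrC; have [rj0|rj0] := eqVneq (r j) 0; first by rewrite rj0 !mulr0.
rewrite ler_wpM2r//.
(* As [r j] is nonzero, an endpoint of the cell lies outside [a, b], where F vanishes; F at the tag
   is then within e of 0. *)
have [ya|ya] := ltP (y j) a.
  have := Fe (t j) (y j); rewrite (Fab (y j)) ?subr0; last by left.
  by apply; rewrite ger0_norm ?subr_ge0//; lra.
have [yb|yb] := ltP b (y j.+1).
  have := Fe (t j) (y j.+1); rewrite (Fab (y j.+1)) ?subr0; last by right.
  by apply; rewrite ler0_norm ?subr_le0//; lra.
by move: rj0; rewrite rE overlap_full// subrr eqxx.
Qed.

Definition unif_cont F := forall e, 0 < e -> exists2 d : R, 0 < d &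
  forall p q, `|p - q| < d -> nX (F p - F q) <= e.

Definition upart a b (n : nat) (i : nat) : R := a + i%:R * ((b - a) / n%:R).

Lemma upart_tagged a b d n : a <= b -> (0 < n)%N -> (b - a) / n%:R < d ->
  tagged_partition a b d n (upart a b n) (upart a b n).
Proof.
move=> ab n0 h; have n0' : (n%:R : R) != 0 by rewrite pnatr_eq0 -lt0n.
split.
- by rewrite /upart mul0r addr0.
- by rewrite /upart mulrCA divff// mulr1 addrC subrK.
- move=> i _; rewrite /upart -natr1; have : 0 <= (b - a) / n%:R by rewrite divr_ge0// subr_ge0.
  by move: h; move: (_ / _) => w h w0; split; lra.
Qed.

Lemma upart_small a b d : 0 < d -> exists N : nat, forall n, (N <= n)%N -> (0 < n)%N /\ (b - a) / n%:R < d.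
Proof.
move=> d0; exists (Num.truncn (`|b - a| / d)).+1 => n Nn; have n0 : (0 < n)%N by exact: leq_trans Nn.
split => //; rewrite ltr_pdivrMr ?ltr0n//.
apply: le_lt_trans (ler_norm _) _; rewrite -ltr_pdivrMl// mulrC.
apply: lt_le_trans (truncnS_gt _) _; by rewrite ler_nat.
Qed.

Lemma riemann_exists F a b : a <= b -> vanish F a b -> unif_cont F ->
  exists v, is_riemann_integral F a b v.
Proof.
move=> ab Fab uF.
have key e : 0 < e -> exists2 d : R, 0 < d & forall n x s m y t,
    tagged_partition a b d n x s -> tagged_partition a b d m y t ->
    nX (riemann_sum F m y t - riemann_sum F n x s) < e.
  move=> e0; have [|d d0 hd] := uF (e / (2 * (b - a + 1))).
    by rewrite divr_gt0//; lra.
  exists (d / 2); first by lra.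
  move=> n x s m y t tP tQ.
  have h := fun h1 h2 => @riemann_sum_compare F a b a b (d / 2) (e / (2 * (b - a + 1))) _ _ _ _ _ _ h1 Fab (lexx a) (lexx b) h2 tP tQ.
  apply: le_lt_trans (h _ _) _.
  - by rewrite divr_ge0//; lra.
  - by move=> p q pq; apply: hd; apply: lt_le_trans pq _; lra.
  - rewrite mulrAC ltr_pdivrMr; last by lra.
    rewrite ltr_pM2l//; lra.
pose u n := riemann_sum F n (upart a b n) (upart a b n).
have [v hv] : exists v : X, u @ \oo --> v.
  apply: cauchyX => e e0; have [d d0 hd] := key e e0; have [N hN] := upart_small a b d0.
  exists N => n m /hN[n0 hn] /hN[m0 hm]; apply: hd; exact: upart_tagged.
exists v => e e0; have e2 : 0 < e / 2 by lra.
have [d d0 hd] := key _ e2.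
exists d; split => // n x s x0 xn h.
have [N hN] := upart_small a b d0; have [N' hN'] := (cvgX_seq _ _).1 hv _ e2.
pose m := maxn N N'; have [m0 hm] := hN m (leq_maxl _ _); have hm' := hN' m (leq_maxr _ _).
have tP : tagged_partition a b d n x s by split.
have := hd _ _ _ _ _ _ (upart_tagged ab m0 hm) tP.
rewrite -nX_lt -/(riemann_sum F n x s) => h1.
have -> : riemann_sum F n x s - v = (riemann_sum F n x s - u m) + (u m - v) by rewrite addrA subrK.
by apply: le_lt_trans (nXD _ _) _; rewrite /u in hm' *; lra.
Qed.

(** Makes [vint] independent of the interval: one fine sum over each interval is taken, and
    [riemann_sum_compare] compares the two. *)
Lemma riemann_unique F a b A B v w : a <= b -> A <= a -> b <= B ->
  vanish F a b -> unif_cont F ->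
  is_riemann_integral F a b v -> is_riemann_integral F A B w -> v = w.
Proof.
move=> ab Aa bB Fab uF hv hw; apply/subr0_eq/nX_eq0/le_anti; rewrite nX_ge0 andbT.
apply/ler_addgt0Pr => e e0; rewrite add0r.
have e3 : 0 < e / 3 by lra.
have [|d d0 hd] := uF (e / (3 * (B - A + 1))).
  by rewrite divr_gt0//; lra.
have [d1 [d10 h1]] := hv _ e3; have [d2 [d20 h2]] := hw _ e3.
pose d' := Num.min (d / 2) (Num.min d1 d2).
have d'0 : 0 < d' by rewrite !lt_min d10 d20 !andbT; lra.
have d'd : 2 * d' <= d.
  have : d' <= d / 2 by rewrite /d' ge_min lexx. by lra.
have d'1 : d' <= d1 by rewrite /d' !ge_min lexx orbT.
have d'2 : d' <= d2 by rewrite /d' !ge_min lexx !orbT.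
have [N hN] := upart_small a b d'0; have [N' hN'] := upart_small A B d'0.
pose m := maxn N N'; have [m0 hm] := hN m (leq_maxl _ _); have [_ hm'] := hN' m (leq_maxr _ _).
have AB : A <= B by lra.
have tP := upart_tagged ab m0 hm; have tQ := upart_tagged AB m0 hm'.
have := fun h1 h2 => @riemann_sum_compare F a b A B d' (e / (3 * (B - A + 1))) _ _ _ _ _ _ h1 Fab Aa bB h2 tP tQ.
set S := riemann_sum _ _ _ _; set S' := riemann_sum _ _ _ _ => H.
have {H}H1 : nX (S - S') <= e / 3.
  apply: le_trans (H _ _) _.
  - by rewrite divr_ge0//; lra.
  - by move=> p q pq; apply: hd; apply: lt_le_trans pq _.
  - rewrite mulrAC ler_pdivrMr; last by lra.
    have -> : e / 3 * (3 * (B - A + 1)) = e * (B - A + 1) by field.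
    by rewrite ler_pM2l//; lra.
have H2 : nX (S' - v) < e / 3.
  rewrite nX_lt; have [x0 xn hx] := tP; apply: h1 => // i /hx[? ? ?]; split => //; exact: lt_le_trans d'1.
have H3 : nX (S - w) < e / 3.
  rewrite nX_lt; have [x0 xn hx] := tQ; apply: h2 => // i /hx[? ? ?]; split => //; exact: lt_le_trans d'2.
have -> : v - w = ((S - w) - (S - S')) - (S' - v).
  by rewrite !subrBB.
by have := nXB ((S - w) - (S - S')) (S' - v); have := nXB (S - w) (S - S'); lra.
Qed.
End riemann.

(* Uniform continuity, in a form covering real, complex and X-valued functions:
   D x y is the distance of the values at x and y. *)
Lemma heine (R : realType) (D : R -> R -> R) (a b e : R) :
  (forall p q, D p q = D q p) -> (forall p q r, D p r <= D p q + D q r) ->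
  (forall t e, 0 < e -> exists2 d : R, 0 < d & forall s, `|t - s| < d -> D s t < e) ->
  (forall p q, (p < a \/ b < p) -> (q < a \/ b < q) -> D p q = 0) ->
  0 < e -> exists2 d : R, 0 < d & forall p q, `|p - q| < d -> D p q <= e.
Proof.
move=> Ds Dt Dc D0 e0.
(* The segment is widened by 1 on both sides and the distance kept below 1: if p lies outside the
   widened segment, then p and q are both outside [a, b], where D is 0. *)
have /compact_near_coveringP := @segment_compact R (a - 1) (b + 1).
pose P (d x : R) := forall q, `|x - q| < d -> D x q <= e.
move=> /(_ R (0 : R)^'+ P _) H.
have : \forall d \near (0 : R)^'+, (`[a - 1, b + 1]%classic `<=` P d).
  apply: H => x _.
  have [|d d0 hd] := Dc x (e / 2); first by lra.
  exists (ball x (d / 2), [set r | r < d / 2]) => /=.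
    split; first by apply: nbhsx_ballx; lra.
    by apply: nbhs_right_lt; lra.
  move=> [y r] /= [xy rd] q yq.
  have h1 : D y x < e / 2 by apply: hd; move: xy; rewrite /ball/=; lra.
  have h2 : D q x < e / 2.
    apply: hd; move: xy; rewrite /ball/= => xy.
    have -> : x - q = (x - y) + (y - q) by ring.
    by apply: le_lt_trans (ler_normD _ _) _; lra.
  by have := Dt y x q; rewrite (Ds x q); lra.
move=> hn; near (0 : R)^'+ => d.
have Pd : `[a - 1, b + 1]%classic `<=` P d by near: d; exact: hn.
have dp : 0 < d by near: d; exact: nbhs_right_gt.
exists (Num.min d 1); first by rewrite lt_min dp ltr01.
move=> p q; rewrite lt_min => /andP[pq pq1].
have [pin|pout] := boolP (p \in `[a - 1, b + 1]); first exact: (Pd p).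
move: pq1; rewrite ltr_norml => /andP[? ?].
move: pout; rewrite in_itv/= negb_and -!ltNge => /orP[?|?].
  by rewrite D0 ?ltW//; left; lra.
by rewrite D0 ?ltW//; right; lra.
Unshelve. all: by end_near. Qed.

(** * The integral [vint] and its comparison with the Lebesgue integral of the norm *)

Section vint_theory.
Variables (R : realType) (X : completeNormedModType R[i]).
Implicit Types (F G : R -> X) (a b d e : R).

Lemma vanish_unif F a b : continuous F -> vanish F a b -> unif_cont F.
Proof.
move=> /contX cF Fab e e0.
apply: (@heine R (fun p q => nX (F p - F q)) a b) => //.
- by move=> p q; rewrite nX_dist.
- by move=> p q r; rewrite (le_trans _ (nXD _ _))// addrA subrK.
- by move=> p q hp hq; rewrite (Fab _ hp) (Fab _ hq) subrr nX0.
Qed.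

Lemma vanishW F a b A B : vanish F a b -> A <= a -> b <= B -> vanish F A B.
Proof. by move=> h Aa bB t [?|?]; apply: h; [left|right]; lra. Qed.

(** [vint] selects an unknown interval [A, B]; it is compared with [a, b] through an interval
    containing both, on which an integral exists. *)
Lemma vint_eq F a b v : continuous F -> a <= b -> vanish F a b ->
  is_riemann_integral F a b v -> vint F = v.
Proof.
move=> cF ab Fab hv; have uF := vanish_unif cF Fab.
have ex : exists w, [set v | exists a b : R, [/\ a < b,
    (forall t : R, t < a \/ b < t -> F t = 0) & is_riemann_integral F a b v]] w.
  (* The interval is widened because [vint] asks for a < b, whereas a = b is allowed here. *)
  have ab1 : a - 1 <= b + 1 by lra.
  have F1 : vanish F (a - 1) (b + 1) by apply: (vanishW Fab); lra.
  have [w hw] := riemann_exists ab1 F1 uF.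
  by exists w, (a - 1), (b + 1); split => //; lra.
have [A [B [AB FAB hw]]] := xgetPex 0 ex.
rewrite /vint; move: hw; set w := xget _ _ => hw.
have h1 : Num.min a A <= a by rewrite ge_min lexx.
have h2 : Num.min a A <= A by rewrite ge_min lexx orbT.
have h3 : b <= Num.max b B by rewrite le_max lexx.
have h4 : B <= Num.max b B by rewrite le_max lexx orbT.
have [|u hu] := @riemann_exists _ _ F (Num.min a A) (Num.max b B) _ (vanishW Fab h1 h3) uF.
  by rewrite (le_trans h1)// (le_trans ab).
by rewrite (riemann_unique ab h1 h3 Fab uF hv hu) (riemann_unique (ltW AB) h2 h4 FAB uF hw hu).
Qed.

Lemma vint_spec F a b : continuous F -> a <= b -> vanish F a b ->
  is_riemann_integral F a b (vint F).
Proof.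
move=> cF ab Fab; have [v hv] := riemann_exists ab Fab (vanish_unif cF Fab).
by rewrite (vint_eq cF ab Fab hv).
Qed.

Lemma continuous_lin (c : R[i]) F G : continuous F -> continuous G ->
  continuous (fun t => c *: F t + G t).
Proof. by move=> cF cG t; apply: cvgD; [apply: cvgZr; exact: cF|exact: cG]. Qed.

Lemma vint_lin (c : R[i]) F G a b : a <= b -> continuous F -> continuous G ->
  vanish F a b -> vanish G a b ->
  vint (fun t => c *: F t + G t) = c *: vint F + vint G.
Proof.
move=> ab cF cG Fab Gab; apply: (@vint_eq _ a b); [exact: continuous_lin|exact: ab| |].
  by move=> t h; rewrite Fab// Gab// scaler0 addr0.
move=> e e0; have c0 := modc_ge0 c.
have [|d1 [d10 h1]] := vint_spec cF ab Fab (e := e / (2 * (modc c + 1))).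
  by rewrite divr_gt0//; lra.
have [|d2 [d20 h2]] := vint_spec cG ab Gab (e := e / 2); first by lra.
exists (Num.min d1 d2); split; first by rewrite lt_min d10.
move=> n x s x0 xn h.
have := h1 n x s x0 xn; have := h2 n x s x0 xn; rewrite -!nX_lt.
set S := \sum_(i < n) _; set S' := \sum_(i < n) _.
have -> : \sum_(i < n) (x i.+1 - x i)%:C *: (c *: F (s i) + G (s i)) = c *: S' + S.
  rewrite scaler_sumr -big_split/=; apply: eq_bigr => i _.
  by rewrite scalerDr !scalerA mulrC.
move=> hS hS'; have {}hS : nX (S - vint G) < e / 2.
  by apply: hS => i /h[? ?]; rewrite lt_min => /andP[].
have {}hS' : nX (S' - vint F) < e / (2 * (modc c + 1)).
  by apply: hS' => i /h[? ?]; rewrite lt_min => /andP[].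
rewrite opprD addrACA -scalerBr; apply: le_lt_trans (nXD _ _) _; rewrite nXZ.
have : modc c * nX (S' - vint F) <= e / 2.
  apply: (@le_trans _ _ ((modc c + 1) * (e / (2 * (modc c + 1))))).
    by apply: ler_pM => //; [exact: nX_ge0|rewrite lerDl|exact: ltW].
  by rewrite le_eqVlt; apply/orP; left; apply/eqP; field; lra.
lra.
Qed.

Lemma vint_shift F a b (c : R) : a <= b -> continuous F -> vanish F a b ->
  vint (fun t => F (t + c)) = vint F.
Proof.
move=> ab cF Fab; apply: (@vint_eq _ (a - c) (b - c)); last first.
- move=> e e0; have [d [d0 h]] := vint_spec cF ab Fab e0.
  exists d; split => // n x s x0 xn hx.
  have := h n (fun i => x i + c) (fun i => s i + c); rewrite x0 xn !subrK.
  have E i : x i.+1 + c - (x i + c) = x i.+1 - x i by ring.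
  under eq_bigr do rewrite E.
  by apply => // i /hx[? ? ?]; split; lra.
- by move=> t ht; apply: Fab; case: ht => ?; [left|right]; lra.
- lra.
- move=> t; apply: (@continuous_comp _ _ _ (fun t => t + c) F); last exact: cF.
  by apply: cvgD; [exact: cvg_id|exact: cvg_cst].
Qed.

Lemma continuous_nX F : continuous F -> continuous (fun t => nX (F t)).
Proof.
move=> /contX cF t; apply/cvgrPdist_lt => e e0; have [d d0 hd] := cF t e e0.
apply/nbhs_ballP; exists d => //= s /hd h; apply: le_lt_trans h.
have h1 := nXD (F t - F s) (F s); have h2 := nXD (F s - F t) (F t).
rewrite subrK in h1; rewrite subrK in h2; rewrite nX_dist in h1.
by rewrite ler_norml; apply/andP; split; lra.
Qed.

Notation mu := (@lebesgue_measure R).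

Lemma continuous_integrable_itv (g : R -> R) a b : continuous g ->
  mu.-integrable `[a, b] (EFin \o g).
Proof.
move=> cg; apply: continuous_compact_integrable; first exact: segment_compact.
exact: continuous_subspaceT.
Qed.

Lemma lower_sum_le (g : R -> R) (n : nat) (x s : nat -> R) : continuous g ->
  (forall i, (i < n)%N -> x i <= x i.+1) ->
  (forall i t, (i < n)%N -> x i <= t -> t <= x i.+1 -> s i <= g t) ->
  \sum_(i < n) (x i.+1 - x i) * s i <= \int[mu]_(t in `[x 0%N, x n]) g t.
Proof.
move=> cg; elim: n => [|n IH] hx hs; first by rewrite big_ord0 set_itv1 Rintegral_set1.
rewrite big_ord_recr/=.
have x0n : x 0%N <= x n.
  have : forall k, (k <= n)%N -> x 0%N <= x k.
    by elim => // k IHk kn; apply: (le_trans (IHk (ltnW kn))); apply: hx; exact: ltnW.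
  exact.
have xn1 : x n <= x n.+1 by exact: hx.
have ig : mu.-integrable `[x 0%N, x n.+1] (EFin \o g) by exact: continuous_integrable_itv.
have := IH (fun i h => hx i (ltnW h)) (fun i t h => hs i t (ltnW h)).
move=> {}IH.
have -> : \int[mu]_(t in `[x 0%N, x n.+1]) g t = \int[mu]_(t in `[x 0%N, x n]) g t + \int[mu]_(t in `]x n, x n.+1]) g t.
  by rewrite -(Rintegral_itvB ig)// ?bnd_simp// addrC subrK.
apply: lerD => //.
have sub : `]x n, x n.+1]%classic `<=` `[x 0%N, x n.+1]%classic.
  by apply: subset_itvr; rewrite bnd_simp.
have -> : (x n.+1 - x n) * s n = \int[mu]_(t in `]x n, x n.+1]) s n.
  rewrite Rintegral_cst// mulrC; congr (_ * _).
  have := @lebesgue_measure_itv R `]x n, x n.+1]; rewrite /= => ->.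
  rewrite lte_fin; case: ltP => [_//|h].
  by rewrite /= (le_anti (introT andP (conj xn1 h))) subrr.
apply: le_Rintegral => //.
- apply: (@integrableS _ _ _ mu `[x 0%N, x n.+1]) => //.
  by apply: continuous_integrable_itv => t; exact: cvg_cst.
- exact: integrableS ig.
- by move=> t /=; rewrite in_itv/= => /andP[? ?]; apply: hs => //; exact: ltW.
Qed.

(** Each nX (F (x i)), lowered by the oscillation of F, is a lower bound of the norm on its cell; so
    the sum of the norms is at most the Lebesgue integral, up to a total loss of e / 2. *)
Lemma nX_vint F a b : a <= b -> continuous F -> vanish F a b ->
  nX (vint F) <= \int[mu]_(t in `[a, b]) nX (F t).
Proof.
move=> ab cF Fab; apply/ler_addgt0Pr => e e0.
have ba : 0 < 2 * (b - a + 1) by lra.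
have [|d1 d10 h1] := vanish_unif cF Fab (e := e / (2 * (b - a + 1))).
  by rewrite divr_gt0.
have [|d2 [d20 h2]] := vint_spec cF ab Fab (e := e / 2); first by lra.
have dm : 0 < Num.min d1 d2 by rewrite lt_min d10.
have [N /(_ _ (leqnn _)) [N0 hN]] := upart_small a b dm.
have [x0 xn hx] := upart_tagged ab N0 hN.
move: x0 xn hx; set x := upart a b N => x0 xn hx.
have := h2 N x x x0 xn; rewrite -nX_lt; set S := \sum_(i < N) _ => {}h2.
have {}h2 : nX (S - vint F) < e / 2.
  by apply: h2 => i /hx[? ?]; rewrite lt_min => /andP[].
have cg := continuous_nX cF.
have := @lower_sum_le (fun t => nX (F t)) N x (fun i => nX (F (x i)) - e / (2 * (b - a + 1))) cg.
rewrite x0 xn => h3.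
have {}h3 : \sum_(i < N) (x i.+1 - x i) * (nX (F (x i)) - e / (2 * (b - a + 1))) <= \int[mu]_(t in `[a, b]) nX (F t).
  apply: h3 => [i /hx[? ? _]|i t iN xt tx]; first by lra.
  have [_ _] := hx i iN; rewrite lt_min => /andP[hd1 _].
  have := h1 (x i) t; have := nXD (F (x i) - F t) (F t); rewrite subrK => h4 h5.
  have /h5 : `|x i - t| < d1 by rewrite ler0_norm; lra.
  lra.
have hS : nX S <= \sum_(i < N) (x i.+1 - x i) * nX (F (x i)).
  apply: (le_trans (nX_sum N (fun i => (x i.+1 - x i)%:C *: F (x i)))).
  apply: ler_sum => i _; rewrite nXZr ger0_norm//.
  by have [? ? _] := hx i (ltn_ord i); lra.
have : \sum_(i < N) (x i.+1 - x i) * (nX (F (x i)) - e / (2 * (b - a + 1))) =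
   \sum_(i < N) (x i.+1 - x i) * nX (F (x i)) - (b - a) * (e / (2 * (b - a + 1))).
  under eq_bigr do rewrite mulrBr.
  by rewrite sumrB -mulr_suml (sum_telescope N x) x0 xn.
have hb : (b - a) * (e / (2 * (b - a + 1))) <= e / 2.
  rewrite mulrA ler_pdivrMr//.
  have -> : e / 2 * (2 * (b - a + 1)) = e * (b - a + 1) by field.
  by rewrite mulrC ler_pM2l//; lra.
have := nXD (vint F - S) S; rewrite subrK nX_dist.
lra.
Qed.
End vint_theory.

Lemma subrBB' {V : zmodType} (a b c : V) : a - b - (c - b) = a - c.
Proof. by rewrite opprB addrA subrK. Qed.

(** * Almost automorphic functions *)

Section aa_theory.
Variables (R : realType) (X : completeNormedModType R[i]).
Implicit Types (f g : R -> X) (a b : nat -> R).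

Definition increasing_index (k : nat -> nat) := forall n, (k n < k n.+1)%N.

Lemma index_mono k : increasing_index k -> forall m n, (m < n)%N -> (k m < k n)%N.
Proof.
move=> ik m n; elim: n => // n IH; rewrite ltnS leq_eqVlt => /predU1P[->|/IH h]; first exact: ik.
exact: ltn_trans (ik n).
Qed.

Lemma index_ge k : increasing_index k -> forall n, (n <= k n)%N.
Proof. by move=> ik; elim=> // n IH; apply: leq_ltn_trans (ik n). Qed.

Lemma index_comp k k' : increasing_index k -> increasing_index k' -> increasing_index (k \o k').
Proof. by move=> ik ik' n; apply: (index_mono ik); exact: ik'. Qed.

Lemma cvgX_subseq (u : nat -> X) (l : X) k : (forall n, (n <= k n)%N) -> u @ \oo --> l ->
  (fun n => u (k n)) @ \oo --> l.
Proof.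
move=> ik /cvgX_seq h; apply/cvgX_seq => e e0; have [N hN] := h e e0.
by exists N => n Nn; apply: hN; exact: leq_trans (ik n).
Qed.

(** Otherwise the norm of f (b n) exceeds n + 1 along some sequence b, while a subsequence of f (0 +
    b n) has to converge. *)
Lemma AA_bounded f : almost_automorphic f -> exists2 B : R, 0 < B & forall t, nX (f t) <= B.
Proof.
move=> [_ hf]; apply: contrapT => nb.
have /choice[b hb] : forall n : nat, exists t, n%:R + 1 < nX (f t).
  move=> n; apply: contrapT => h; apply: nb; exists (n%:R + 1).
    by rewrite ltr_wpDl.
  by move=> t; rewrite leNgt; apply/negP => h'; apply: h; exists t.
have [k [ik [g hg]]] := hf b; have [/cvgX_seq /(_ 1 ltr01)[N hN] _] := hg 0.
pose n := maxn N (Num.truncn (nX (g 0) + 1)).+1.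
have h1 := hN n (leq_maxl _ _); rewrite add0r in h1.
have h2 := hb (k n).
have h3 : nX (g 0) + 1 < (k n)%:R.
  apply: lt_le_trans (truncnS_gt _) _; rewrite ler_nat.
  by apply: leq_trans (index_ge ik n); exact: leq_maxr.
have := nXD (f (b (k n)) - g 0) (g 0); rewrite subrK; lra.
Qed.

Lemma AA_lin (c : R[i]) f g : almost_automorphic f -> almost_automorphic g ->
  almost_automorphic (fun t => c *: f t + g t).
Proof.
move=> [cf hf] [cg hg]; split; first exact: continuous_lin.
move=> b; have [k1 [ik1 [f' hf']]] := hf b.
have [k2 [ik2 [g' hg']]] := hg (b \o k1).
exists (k1 \o k2); split; first exact: index_comp.
exists (fun t => c *: f' t + g' t) => t.
have [f1 f2] := hf' t; have [g1 g2] := hg' t.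
split; apply: cvgD => //; apply: cvgZr.
  exact: (cvgX_subseq (index_ge ik2) f1).
exact: (cvgX_subseq (index_ge ik2) f2).
Qed.

Lemma AA_cst0 : almost_automorphic (fun _ : R => 0 : X).
Proof.
split; first by move=> t; exact: cvg_cst.
by move=> b; exists id; split => //; exists (fun=> 0) => t; split; exact: cvg_cst.
Qed.

(** Diagonal argument over approximants [F j]. Their limit functions [G j] inherit the uniform
    bounds between the [F j], hence converge uniformly to the function g wanted for f. *)
Lemma AA_uniform f :
  (forall e : R, 0 < e -> exists2 f', almost_automorphic f' & forall t, nX (f t - f' t) <= e) ->
  almost_automorphic f.
Proof.
move=> h.
have [eps [eps0 small]] : exists eps : nat -> R, (forall j, 0 < eps j) /\
    forall e, 0 < e -> exists j, forall i, (j <= i)%N -> eps i < e.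
  exists (fun j => (j.+1%:R)^-1); split => [j|e e0]; first by rewrite invr_gt0 ltr0n.
  exists (Num.truncn e^-1) => i hi; rewrite invf_plt ?posrE ?ltr0n//.
  by apply: lt_le_trans (truncnS_gt _) _; rewrite ler_nat ltnS.
have /choice[F hF] : forall j : nat, exists f', almost_automorphic f' /\ forall t, nX (f t - f' t) <= eps j.
  by move=> j; have [f' ? ?] := h _ (eps0 j); exists f'.
split.
  apply/contX => t e e0; have [j hj] : exists j, forall i, (j <= i)%N -> eps i < e / 3 by apply: small; lra.
  have {}hj := hj j (leqnn j).
  have [[/contX cFj _] hFj] := hF j; have [|d d0 hd] := cFj t (e / 3); first by lra.
  exists d => // s /hd h1; have h2 := hFj t; have h3 := hFj s.
  have -> : f s - f t = (f s - F j s) + (F j s - F j t) - (f t - F j t).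
    by rewrite addrA subrK opprB addrA subrK.
  have := nXB ((f s - F j s) + (F j s - F j t)) (f t - F j t).
  have := nXD (f s - F j s) (F j s - F j t); lra.
move=> b.
(* Choosing a subsequence for every pair (approximant, sequence) at once turns the successive
   extraction [kk] into a plain recursion. *)
have /choice[K hK] : forall p : nat * (nat -> R), exists q : (nat -> nat) * (R -> X),
    increasing_index q.1 /\ forall t,
      (fun n => F p.1 (t + p.2 (q.1 n))) @ \oo --> q.2 t /\
      (fun n => q.2 (t - p.2 (q.1 n))) @ \oo --> F p.1 t.
  move=> [j c]; have [[_ /(_ c)[k [ik [g hg]]]] _] := hF j.
  by exists (k, g).
pose kk := fix kk j := if j is j'.+1 then kk j' \o (K (j, b \o kk j')).1 else (K (0%N, b)).1.
pose sig j := (K (j.+1, b \o kk j)).1.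
pose G j := if j is j'.+1 then (K (j, b \o kk j')).2 else (K (0%N, b)).2.
have kkS j : kk j.+1 = kk j \o sig j by [].
have ikk j : increasing_index (kk j).
  elim: j => [|j IH]; first by have [] := hK (0%N, b).
  by rewrite kkS; apply: index_comp => //; have [] := hK (j.+1, b \o kk j).
have hG j t : (fun n => F j (t + b (kk j n))) @ \oo --> G j t /\
      (fun n => G j (t - b (kk j n))) @ \oo --> F j t.
  by case: j => [|j]; [have [_ /(_ t)] := hK (0%N, b)|have [_ /(_ t)] := hK (j.+1, b \o kk j)].
pose dg n := kk n n.
(* From rank j on, the diagonal runs inside the j-th extraction; the reindexing only has to satisfy
   n <= rho n for limits to carry over. *)
have tail j : exists rho : nat -> nat, (forall n, (n <= rho n)%N) /\ forall n, dg (j + n)%N = kk j (rho n).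
  have /choice[rho hrho] : forall i, exists r, increasing_index r /\ kk (j + i)%N = kk j \o r.
    elim=> [|i [r [IH1 IH2]]]; first by exists id; rewrite addn0; split => // i; exact: ltnSn.
    exists (r \o sig (j + i)%N); split; last by rewrite addnS kkS IH2.
    by apply: index_comp => //; have [] := hK ((j + i).+1, b \o kk (j + i)%N).
  exists (fun n => rho n (j + n)%N); split => n.
    by have [h1 _] := hrho n; apply: leq_trans (index_ge h1 _); exact: leq_addl.
  by have [_ h2] := hrho n; rewrite /dg h2.
have idg : increasing_index dg.
  move=> n; rewrite /dg kkS/=; apply: (index_mono (ikk n)).
  apply: leq_trans (index_ge _ _); first exact: leqnn.
  by have [] := hK (n.+1, b \o kk n).
have shiftX (u : nat -> X) j (l : X) : (fun n => u (j + n)%N) @ \oo --> l -> u @ \oo --> l.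
  move=> /cvgX_seq hu; apply/cvgX_seq => e e0; have [N hN] := hu e e0.
  exists (j + N)%N => n jn; have := hN (n - j)%N; rewrite subnKC; last by apply: leq_trans jn; exact: leq_addr.
  by apply; rewrite leq_subRL; [|apply: leq_trans jn; exact: leq_addr].
have hD j t : (fun n => F j (t + b (dg n))) @ \oo --> G j t /\
      (fun n => G j (t - b (dg n))) @ \oo --> F j t.
  have [rho [r1 r2]] := tail j; have [h1 h2] := hG j t.
  split; apply: (shiftX _ j).
    rewrite (_ : (fun n => _) = (fun n => F j (t + b (kk j (rho n))))); last by apply/funext => n; rewrite r2.
    exact: (cvgX_subseq r1 h1).
  rewrite (_ : (fun n => _) = (fun n => G j (t - b (kk j (rho n))))); last by apply/funext => n; rewrite r2.
  exact: (cvgX_subseq r1 h2).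
have FF i j t : nX (F i t - F j t) <= eps i + eps j.
  have := nXB (f t - F j t) (f t - F i t); rewrite subrBB => /le_trans; apply.
  by rewrite addrC lerD//; have [_] := hF i; have [_] := hF j.
have GG i j t : nX (G i t - G j t) <= eps i + eps j.
  have [h1 _] := hD i t; have [h2 _] := hD j t.
  apply: (nX_cvg_le (cvgB h1 h2)); exists 0%N => n _ /=; exact: FF.
have /choice[g hg] : forall t, exists l : X, (fun j => G j t) @ \oo --> l.
  move=> t; apply: cauchyX => e e0; have [j hj] : exists j, forall i, (j <= i)%N -> eps i < e / 2 by apply: small; lra.
  exists j => n m jn jm; apply: le_lt_trans (GG n m t) _.
  by have := hj n jn; have := hj m jm; lra.
have gG j t : nX (g t - G j t) <= eps j.
  apply/ler_addgt0Pr => e e0; have [i hi] := small e e0.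
  have h1 := hg t; apply: (nX_cvg_le (cvgB h1 (@cvg_cst _ (G j t) _ _ _))).
  exists i => n jn /=; apply: le_trans (GG n j t) _.
  by have := hi n jn; lra.
exists dg; split => //; exists g => t; split; apply/cvgX_seq => e e0.
  have [j hj] : exists j, forall i, (j <= i)%N -> eps i < e / 3 by apply: small; lra.
  have {}hj := hj j (leqnn j).
  have e3 : 0 < e / 3 by lra.
  have [/cvgX_seq/(_ _ e3)[N hN] _] := hD j t.
  exists N => n /hN h1; have [_ h2] := hF j; have {}h2 := h2 (t + b (dg n)); have h3 := gG j t.
  have := nXB (f (t + b (dg n)) - F j (t + b (dg n)) + (F j (t + b (dg n)) - G j t)) (g t - G j t).
  rewrite addrA subrK subrBB' => h4.
  have := nXD (f (t + b (dg n)) - F j (t + b (dg n))) (F j (t + b (dg n)) - G j t).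
  rewrite addrA subrK; lra.
have [j hj] : exists j, forall i, (j <= i)%N -> eps i < e / 3 by apply: small; lra.
have {}hj := hj j (leqnn j).
have e3 : 0 < e / 3 by lra.
have [_ /cvgX_seq/(_ _ e3)[N hN]] := hD j t.
exists N => n /hN h1; have [_ h2] := hF j; have {}h2 := h2 t; have h3 := gG j (t - b (dg n)).
have := nXB (g (t - b (dg n)) - G j (t - b (dg n)) + (G j (t - b (dg n)) - F j t)) (f t - F j t).
rewrite addrA subrK subrBB' => h4.
have := nXD (g (t - b (dg n)) - G j (t - b (dg n))) (G j (t - b (dg n)) - F j t).
rewrite addrA subrK; lra.
Qed.
End aa_theory.

(** * Convolution of an almost automorphic function with a kernel *)

Section aa_convolution.
Variables (R : realType) (X : completeNormedModType R[i]).
Implicit Types (f g : R -> X) (k : R -> R[i]).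
Notation mu := (@lebesgue_measure R).

(** Weaker than being a test function, so that it also covers [transpose_op a phi], a uniform limit
    of combinations of derivatives of phi. *)
Definition conv_kernel k (r K : R) :=
  [/\ 0 < r, 0 < K, (forall t, r < `|t| -> k t = 0), (forall t, modc (k t) <= K) &
   forall e : R, 0 < e -> exists2 d : R, 0 < d & forall p q, `|p - q| < d -> modc (k p - k q) <= e].

Lemma kernel_refl k r K x : conv_kernel k r K ->
  [/\ forall t, t < x - r \/ x + r < t -> k (x - t) = 0, (forall t, modc (k (x - t)) <= K) &
   forall e : R, 0 < e -> exists2 d : R, 0 < d & forall p q, `|p - q| < d -> modc (k (x - p) - k (x - q)) <= e].
Proof.
move=> [r0 K0 kv kB kc]; split => //.
- move=> t ht; apply: kv; rewrite ltr_normr; apply/orP.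
  by case: ht => h; [left|right]; lra.
- move=> e /kc[d d0 hd]; exists d => // p q pq; apply: hd.
  by rewrite subrBB distrC.
Qed.

Lemma continuous_scale k f (K : R) : 0 < K -> (forall t, modc (k t) <= K) ->
  (forall e : R, 0 < e -> exists2 d : R, 0 < d & forall p q, `|p - q| < d -> modc (k p - k q) <= e) ->
  continuous f -> continuous (fun t => k t *: f t).
Proof.
move=> K0 kB kc /contX cf; apply/contX => t e e0.
have n0 := nX_ge0 (f t).
have [|d1 d10 h1] := cf t (e / (2 * K)); first by rewrite divr_gt0// mulr_gt0.
have [|d2 d20 h2] := kc (e / (2 * (nX (f t) + 1))); first by rewrite divr_gt0// mulr_gt0//; lra.
exists (Num.min d1 d2); first by rewrite lt_min d10.
move=> s; rewrite lt_min => /andP[s1 s2].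
have -> : k s *: f s - k t *: f t = k s *: (f s - f t) + (k s - k t) *: f t.
  by rewrite scalerBr scalerBl addrA subrK.
apply: le_lt_trans (nXD _ _) _; rewrite !nXZ.
have a1 : modc (k s) * nX (f s - f t) <= K * nX (f s - f t) by rewrite ler_wpM2r// nX_ge0.
have a2 : K * nX (f s - f t) < e / 2.
  rewrite mulrC -ltr_pdivlMr//; have := h1 s s1; rewrite invfM mulrA; lra.
have a3 : modc (k s - k t) * nX (f t) <= e / 2.
  have h := h2 s t; rewrite distrC in h; have {}h := h s2.
  apply: (@le_trans _ _ (e / (2 * (nX (f t) + 1)) * (nX (f t) + 1))).
    by apply: ler_pM => //; [exact: modc_ge0|lra].
  by rewrite le_eqVlt; apply/orP; left; apply/eqP; field; lra.
lra.
Qed.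

Lemma vint_conv_shift k f r K x : conv_kernel k r K -> continuous f ->
  vint (fun t => k (x - t) *: f t) = vint (fun s => k (- s) *: f (s + x)).
Proof.
move=> hk cf; have [r0 K0 _ _ _] := hk; have [kv kB kc] := kernel_refl x hk.
rewrite -(@vint_shift _ _ (fun t => k (x - t) *: f t) (x - r) (x + r) x).
- by congr vint; apply/funext => s; rewrite opprD addrCA subrr addr0.
- lra.
- exact: (continuous_scale K0 kB kc).
- by move=> t /kv ->; rewrite scale0r.
Qed.

Lemma continuous_shiftX f (c : R) : continuous f -> continuous (fun t => f (t + c)).
Proof.
move=> cf t; apply: (@continuous_comp _ _ _ (fun t => t + c) f); last exact: cf.
by apply: cvgD; [exact: cvg_id|exact: cvg_cst].
Qed.

Arguments continuous_shiftX {f} c _.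

Lemma Rint_bound (u : R -> R) (a b c : R) : a <= b -> mu.-integrable `[a, b] (EFin \o u) ->
  (forall t, u t <= c) -> \int[mu]_(t in `[a, b]) u t <= c * (b - a).
Proof.
move=> ab iu uc; have -> : c * (b - a) = \int[mu]_(t in `[a, b]) c.
  rewrite Rintegral_cst//; congr (_ * _).
  have := @lebesgue_measure_itv R `[a, b]; rewrite /= => ->.
  rewrite lte_fin; case: ltP => [_//|h].
  by rewrite /= (le_anti (introT andP (conj ab h))) subrr.
apply: le_Rintegral => //.
by apply: continuous_integrable_itv => t; exact: cvg_cst.
Qed.

Lemma dct_itv (u : nat -> R -> R) (v : R -> R) (a b B : R) :
  (forall n, measurable_fun setT (u n)) -> (forall n t, `|u n t| <= B) ->
  (forall t, (fun n => u n t) @ \oo --> v t) ->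
  measurable_fun setT v /\
  (fun n => \int[mu]_(t in `[a, b]) u n t) @ \oo --> \int[mu]_(t in `[a, b]) v t.
Proof.
move=> mu_ uB uv.
have mv : measurable_fun setT v.
  by apply: (measurable_fun_cvg (h := u)) => // t _; exact: uv.
split => //.
have iB : mu.-integrable `[a, b] (cst B%:E).
  by apply: (@continuous_integrable_itv _ (cst B)) => t; exact: cvg_cst.
have B0 : 0 <= B := le_trans (normr_ge0 _) (uB 0%N 0).
have iv : mu.-integrable `[a, b] (EFin \o v).
  apply: (@le_integrable _ _ _ mu _ _ _ (cst B%:E)) => //.
    by apply: measurable_funTS; exact/measurable_EFinP.
  move=> t _ /=; rewrite lee_fin (ger0_norm B0).
  apply: (cvgr_to_le (cvg_norm (uv t))).
  by near=> n; exact: uB.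
have h : (\int[mu]_(t in `[a, b]) (u n t)%:E)%E @[n --> \oo] --> (\int[mu]_(t in `[a, b]) (v t)%:E)%E.
  apply: (@dominated_cvg _ _ _ mu `[a, b] (measurable_itv _) _ _ (cst B%:E)) => //.
  - move=> n; apply/measurable_EFinP; exact: (measurable_funTS (mu_ n)).
  - by move=> t _; apply: cvg_EFin; [exact: nearW|exact: uv].
  - by move=> n t _ /=; rewrite lee_fin.
apply: fine_cvg; rewrite fineK//.
exact: integrable_fin_num.
Unshelve. all: by end_near. Qed.

Lemma cvg_nX (u : nat -> X) (l : X) : u @ \oo --> l -> (fun n => nX (u n)) @ \oo --> nX l.
Proof.
move=> /cvgX_seq h; apply/cvgrPdist_lt => e e0; have [N hN] := h e e0.
exists N => // n /hN; apply: le_lt_trans; rewrite ler_norml.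
have h1 := nXD (u n - l) l; have h2 := nXD (l - u n) (u n).
rewrite subrK in h1; rewrite subrK in h2; rewrite nX_dist in h2.
by apply/andP; split; lra.
Qed.

Lemma cvg_seq_small (u : nat -> R) (e : R) : u @ \oo --> (0 : R) -> 0 < e ->
  exists N, forall n, (N <= n)%N -> u n < e.
Proof.
move=> /cvgrPdist_lt h e0; have [N _ hN] := h e e0; exists N => n /hN.
by rewrite sub0r normrN; apply: le_lt_trans; exact: ler_norm.
Qed.

(** After the substitution t = s + x the kernel no longer depends on x, so nX (h x - h y) is at most
    K times the integral of nX (f (s + x) - f (s + y)) over [-r, r]. As f is bounded, dominated
    convergence makes h (x + a n) a Cauchy sequence; its limit is obtained by completeness and not
    as an integral against g. *)
Lemma AA_conv k f r K : conv_kernel k r K -> almost_automorphic f ->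
  almost_automorphic (fun x => vint (fun t => k (x - t) *: f t)).
Proof.
move=> hk AAf; have [B B0 fB] := AA_bounded AAf; have [cf hf] := AAf.
have [r0 K0 kv kB kc] := hk.
set h := fun x => _.
have rr : - r <= r by lra.
have hE x : h x = vint (fun s => k (- s) *: f (s + x)) by exact: (vint_conv_shift x hk).
have [kv0 kB0 kc0] := kernel_refl 0 hk.
have contk g : continuous g -> continuous (fun s => k (- s) *: g s).
  move=> cg; apply: (@continuous_scale (fun s => k (- s)) g K) => //.
    move=> e /kc0[d d0 hd]; exists d => // p q /hd; by rewrite !sub0r.
have vank g : vanish (fun s => k (- s) *: g s) (- r) r.
  move=> t ht; rewrite kv ?scale0r// normrN ltr_normr.
  by apply/orP; case: ht => ?; [right|left]; lra.
have key x y : nX (h x - h y) <= K * \int[mu]_(s in `[- r, r]) nX (f (s + x) - f (s + y)).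
  have cfx := continuous_shiftX x cf; have cfy := continuous_shiftX y cf.
  have -> : h x - h y = vint (fun s => k (- s) *: (f (s + x) - f (s + y))).
    rewrite !hE.
    have := vint_lin (-1) rr (contk _ cfy) (contk _ cfx) (vank _) (vank _).
    rewrite scaleN1r addrC => <-; congr vint; apply/funext => s.
    by rewrite scaleN1r scalerBr addrC.
  have cd : continuous (fun s => f (s + x) - f (s + y)) by move=> s; apply: cvgB; [exact: cfx|exact: cfy].
  apply: (le_trans (nX_vint rr (contk _ cd) (vank _))).
  rewrite -RintegralZl//; last exact/continuous_integrable_itv/continuous_nX.
  apply: le_Rintegral => //.
  - exact/continuous_integrable_itv/continuous_nX/contk.
  - apply: continuous_integrable_itv => s; apply: cvgM; first exact: cvg_cst.
    exact: continuous_nX.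
  - by move=> s _; rewrite nXZ ler_wpM2r// nX_ge0.
split.
  apply/contX => x e e0.
  have c0 : 0 < B * (2 * r + 2) by rewrite mulr_gt0//; lra.
  have [|d d0 hd] := kc (e / (2 * (B * (2 * r + 2)))); first by rewrite divr_gt0// mulr_gt0.
  exists (Num.min d 1); first by rewrite lt_min d0 ltr01.
  move=> y; rewrite lt_min => /andP[xy xy1].
  have [kvx kBx kcx] := kernel_refl x hk; have [kvy kBy kcy] := kernel_refl y hk.
  have ab : x - r - 1 <= x + r + 1 by lra.
  move: xy1; rewrite ltr_norml => /andP[xy1 xy2].
  have vx : vanish (fun t => k (x - t) *: f t) (x - r - 1) (x + r + 1).
    by move=> t ht; rewrite kvx ?scale0r//; case: ht => ?; [left|right]; lra.
  have vy : vanish (fun t => k (y - t) *: f t) (x - r - 1) (x + r + 1).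
    by move=> t ht; rewrite kvy ?scale0r//; case: ht => ?; [left|right]; lra.
  have cx := continuous_scale K0 kBx kcx cf; have cy := continuous_scale K0 kBy kcy cf.
  have -> : h y - h x = vint (fun t => -1 *: (k (x - t) *: f t) + k (y - t) *: f t).
    by rewrite (vint_lin (-1) ab cx cy vx vy) scaleN1r addrC.
  have cxy := continuous_lin (c := -1) cx cy.
  apply: le_lt_trans (nX_vint ab cxy _) _.
    by move=> t ht; rewrite vx// vy// scaler0 addr0.
  apply: (@le_lt_trans _ _ (e / (2 * (B * (2 * r + 2))) * B * ((x + r + 1) - (x - r - 1)))).
    apply: Rint_bound => //; first exact/continuous_integrable_itv/continuous_nX.
    move=> t; rewrite scaleN1r addrC -scalerBl nXZ; apply: ler_pM => //.
    + exact: modc_ge0.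
    + exact: nX_ge0.
    + by apply: hd; rewrite opprB addrA subrK distrC.
  have -> : x + r + 1 - (x - r - 1) = 2 * r + 2 by ring.
  have -> : e / (2 * (B * (2 * r + 2))) * B * (2 * r + 2) = e / 2.
    by field; apply/andP; split; lra.
  lra.
move=> b; have [j [ij [g hg]]] := hf b.
exists j; split => //; pose a n := b (j n).
have mcont (u : R -> R) : continuous u -> measurable_fun setT u by exact: continuous_measurable_fun.
have B2 (x y : X) : nX x <= B -> nX y <= B -> `|nX (x - y)| <= 2 * B.
  by move=> ? ?; rewrite ger0_norm ?nX_ge0//; have := nXB x y; lra.
have gB t : nX (g t) <= B.
  by have [h1 _] := hg t; apply: (nX_cvg_le h1); exists 0%N => n _; exact: fB.
(* g is only a pointwise limit and need not be continuous, so no [vint] involving g is formed: only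
   norms are integrated, and these are measurable as limits of continuous functions. *)
have D1 (c : R -> X) (y : R) : continuous c -> (forall t, nX (c t) <= B) ->
    measurable_fun setT (fun s : R => nX (g (s + y) - c s)) /\
    (fun m => \int[mu]_(s in `[- r, r]) nX (f (s + (y + a m)) - c s)) @ \oo -->
      \int[mu]_(s in `[- r, r]) nX (g (s + y) - c s).
  move=> cc cB; apply: (@dct_itv (fun m s => nX (f (s + (y + a m)) - c s)) _ _ _ (2 * B)).
  - move=> m; apply: mcont; apply: continuous_nX => s.
    by apply: cvgB; [exact: continuous_shiftX|exact: cc].
  - by move=> m t; apply: B2.
  - move=> t; apply: cvg_nX; apply: cvgB; last exact: cvg_cst.
    have [h1 _] := hg (t + y).
    by rewrite (_ : (fun n => _) = (fun n => f (t + y + b (j n))))//; apply/funext => n; rewrite addrA.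
have D2 x : (fun n => \int[mu]_(s in `[- r, r]) nX (f (s + (x + a n)) - g (s + x))) @ \oo --> (0 : R).
  have -> : (0 : R) = \int[mu]_(s in `[- r, r]) (fun=> 0) s.
    by rewrite Rintegral_cst// mul0r.
  have H1 : forall n, measurable_fun setT (((fun n s => nX (f (s + (x + a n)) - g (s + x))) : nat -> R -> R) n).
    move=> n; have [m1 _] := D1 (fun s => f (s + (x + a n))) x (continuous_shiftX _ cf) (fun t => fB _).
    by under eq_fun do rewrite nX_dist.
  have H2 : forall n t, `|((fun n s => nX (f (s + (x + a n)) - g (s + x))) : nat -> R -> R) n t| <= 2 * B.
    by move=> n t; apply: B2.
  have H3 : forall t, (fun n => ((fun n s => nX (f (s + (x + a n)) - g (s + x))) : nat -> R -> R) n t) @ \oo --> (0 : R).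
    move=> t; rewrite -(@nX0 _ X) -(subrr (g (t + x))); apply: cvg_nX; apply: cvgB; last exact: cvg_cst.
    have [h1 _] := hg (t + x).
    by rewrite (_ : (fun n => _) = (fun n => f (t + x + b (j n))))//; apply/funext => n; rewrite addrA.
  exact: (@dct_itv (fun n s => nX (f (s + (x + a n)) - g (s + x))) (fun=> 0) (- r) r (2 * B) H1 H2 H3).2.
have D3 x : (fun n => \int[mu]_(s in `[- r, r]) nX (g (s + (x - a n)) - f (s + x))) @ \oo --> (0 : R).
  have -> : (0 : R) = \int[mu]_(s in `[- r, r]) (fun=> 0) s.
    by rewrite Rintegral_cst// mul0r.
  have H1 : forall n, measurable_fun setT (((fun n s => nX (g (s + (x - a n)) - f (s + x))) : nat -> R -> R) n).
    by move=> n; have [m1 _] := D1 (fun s => f (s + x)) (x - a n) (continuous_shiftX _ cf) (fun t => fB _).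
  have H2 : forall n t, `|((fun n s => nX (g (s + (x - a n)) - f (s + x))) : nat -> R -> R) n t| <= 2 * B.
    by move=> n t; apply: B2.
  have H3 : forall t, (fun n => ((fun n s => nX (g (s + (x - a n)) - f (s + x))) : nat -> R -> R) n t) @ \oo --> (0 : R).
    move=> t; rewrite -(@nX0 _ X) -(subrr (f (t + x))); apply: cvg_nX; apply: cvgB; last exact: cvg_cst.
    have [_ h1] := hg (t + x).
    by rewrite (_ : (fun n => _) = (fun n => g (t + x - b (j n))))//; apply/funext => n; rewrite addrA.
  exact: (@dct_itv (fun n s => nX (g (s + (x - a n)) - f (s + x))) (fun=> 0) (- r) r (2 * B) H1 H2 H3).2.
have Ig x n : mu.-integrable `[- r, r] (EFin \o (fun s => nX (f (s + (x + a n)) - g (s + x)))).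
  apply: (@le_integrable _ _ _ mu _ _ _ (cst (2 * B)%:E)) => //.
  - apply: measurable_funTS; apply/measurable_EFinP.
    have [m1 _] := D1 (fun s => f (s + (x + a n))) x (continuous_shiftX _ cf) (fun t => fB _).
    by under eq_fun do rewrite nX_dist.
  - by move=> t _ /=; rewrite lee_fin (le_trans (B2 _ _ _ _))// ler_norm.
  - by apply: (@continuous_integrable_itv _ (cst (2 * B))) => t; exact: cvg_cst.
have /choice[G hG] : forall x, exists l : X, (fun n => h (x + a n)) @ \oo --> l.
  move=> x; apply: cauchyX => e e0.
  have [|N hN] := cvg_seq_small (D2 x) (e := e / (2 * K)); first by rewrite divr_gt0// mulr_gt0.
  exists N => n m /hN hn /hN hm; apply: (le_lt_trans (key _ _)).
  apply: (@le_lt_trans _ _ (K * (\int[mu]_(s in `[- r, r]) nX (f (s + (x + a n)) - g (s + x)) +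
      \int[mu]_(s in `[- r, r]) nX (f (s + (x + a m)) - g (s + x))))).
    rewrite ler_wpM2l ?(ltW K0)// -RintegralD//; apply: le_Rintegral => //.
    - apply: continuous_integrable_itv; apply: continuous_nX => s.
      by apply: cvgB; exact: continuous_shiftX.
    - rewrite (_ : _ \o _ = (fun s => ((nX (f (s + (x + a n)) - g (s + x)))%:E + (nX (f (s + (x + a m)) - g (s + x)))%:E)%E)).
        by apply: integrableD => //; exact: Ig.
      by apply/funext => s /=.
    - by move=> s _; apply: le_trans (nXB _ _); rewrite subrBB'.
  rewrite mulrC -ltr_pdivlMr//.
  have -> : e / K = e / (2 * K) + e / (2 * K) by field; lra.
  exact: ltrD.
exists G => x; split; first exact: hG.
apply/cvgX_seq => e e0.
have [|N hN] := cvg_seq_small (D3 x) (e := e / (2 * K)); first by rewrite divr_gt0// mulr_gt0.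
exists N => n /hN hn.
apply: (@le_lt_trans _ _ (e / 2)); last by lra.
(* G (x - a n) is itself the limit in m of h (x - a n + a m); the bound [key] is taken at these
   points and passed to the limit in m. *)
have h1 := hG (x - a n).
apply: (nX_cvg_le (cvgB h1 (@cvg_cst _ (h x) _ _ _))).
have [_ h2] := D1 (fun s => f (s + x)) (x - a n) (continuous_shiftX _ cf) (fun t => fB _).
have h3 : (fun m => \int[mu]_(s in `[- r, r]) nX (f (s + (x - a n + a m)) - f (s + x))
    - \int[mu]_(s in `[- r, r]) nX (g (s + (x - a n)) - f (s + x))) @ \oo --> (0 : R).
  by rewrite -(subrr (\int[mu]_(s in `[- r, r]) nX (g (s + (x - a n)) - f (s + x)))); apply: cvgB => //; exact: cvg_cst.
have [|N' hN'] := cvg_seq_small h3 (e := e / (2 * K) - \int[mu]_(s in `[- r, r]) nX (g (s + (x - a n)) - f (s + x))).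
  by rewrite subr_gt0.
exists N' => m /hN'; rewrite ltrD2r => hm /=; apply: (le_trans (key _ _)).
rewrite mulrC -ler_pdivlMr// (le_trans (ltW hm))//.
by rewrite le_eqVlt; apply/orP; left; apply/eqP; field; lra.
Qed.

End aa_convolution.

(** * Ultradifferentiable classes *)

Section ultra_classes.
Variables (R : realType) (M : nat -> R).
Hypothesis M_gt0 : forall p, 0 < M p.
Implicit Types (u v : R -> R) (h N r : R) (c : ultra_class).
Notation mu := (@lebesgue_measure R).

Definition rc u : R -> R[i] := fun t => (u t)%:C.

(** Unfolds ||rc u||_{1,h} <= N derivative by derivative; being stated in [\bar R], it contains the
    finiteness of the integrals. *)
Definition L1b h N u := forall p, (n1 u^[p] <= (N * M p / h ^+ p)%:E)%E.

Definition supb h N u := forall p t, `|u^[p] t| <= N * M p / h ^+ p.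

Definition csupp r u := forall t, r < `|t| -> u t = 0.

(** The quantifier on h of the two limits: projective for h -> oo, inductive for h -> 0. *)
Definition hclass c (P : R -> Prop) :=
  match c with
  | Beurling => forall h, 0 < h -> P h
  | Roumieu => exists h, 0 < h /\ P h
  end.

(* [rc u] is in D_{L^1}, resp. D^*, iff [EL1 c u], resp. [ET c u]. *)
Definition EL1 c u := rsmooth u /\ hclass c (fun h => exists N, L1b h N u).

Definition ET c u := [/\ rsmooth u, exists r, 0 < r /\ csupp r u &
  hclass c (fun h => exists N, 0 < N /\ supb h N u)].

Lemma derive1n0E (p : nat) : derive1n p (fun _ : R => 0 : R) = fun _ => 0.
Proof.
elim: p => // p IH; rewrite derive1nS IH; apply/funext => x.
by rewrite derive1_cst.
Qed.

Lemma rc_cderiv u p t : cderiv p (rc u) t = (u^[p] t)%:C.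
Proof. by rewrite /cderiv /rc /= derive1n0E. Qed.

Lemma modc_rc u p t : modc (cderiv p (rc u) t) = `|u^[p] t|.
Proof. by rewrite rc_cderiv modcR. Qed.

Lemma rsmooth_cst0 : rsmooth (fun _ : R => 0 : R).
Proof. by move=> p x; rewrite derive1n0E; exact: derivable_cst. Qed.

Lemma smoothP (f : R -> R[i]) : smooth f <->
  rsmooth (fun t => complex.Re (f t)) /\ rsmooth (fun t => complex.Im (f t)).
Proof.
split=> [h|[h1 h2] p t]; last by split; [exact: h1|exact: h2].
by split => p t; have [] := h p t.
Qed.

Lemma smooth_rc u : rsmooth u -> smooth (rc u).
Proof. by move=> su; apply/smoothP; split; [exact: su|exact: rsmooth_cst0]. Qed.

Lemma norm_L1_rc h N u : 0 < h -> L1b h N u -> (norm_L1 M h (rc u) <= N%:E)%E.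
Proof.
move=> h0 hu; apply: ge_ereal_sup => _ [p _ <-].
have hp : 0 < h ^+ p / M p by rewrite divr_gt0// exprn_gt0.
under eq_integral do rewrite modc_rc.
apply: (@le_trans _ _ ((h ^+ p / M p)%:E * (N * M p / h ^+ p)%:E)%E).
  by apply: lee_wpmul2l; [rewrite lee_fin ltW|exact: hu].
rewrite -EFinM lee_fin le_eqVlt; apply/orP; left; apply/eqP; field.
by rewrite !gt_eqF// exprn_gt0.
Qed.

Lemma L1b_finite h N u p : L1b h N u -> (n1 u^[p] < +oo)%E.
Proof. by move=> /(_ p) /le_lt_trans; apply; rewrite ltry. Qed.

Lemma L1b_integrable h N u p : rsmooth u -> L1b h N u -> mu.-integrable setT (EFin \o u^[p]).
Proof. by move=> su /(L1b_finite p) fu; apply: integrable_n1 => //; exact: rsmooth_meas. Qed.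

Lemma carrier_DL1h h N u : 0 < h -> rsmooth u -> L1b h N u -> carrier (DL1h M h) (rc u).
Proof.
move=> h0 su hu; split; last by rewrite (le_lt_trans (norm_L1_rc h0 hu))// ltry.
split; first exact: smooth_rc.
move=> p; rewrite (_ : (fun t => _) = EFin \o (fun t => `|u^[p] t|)).
  exact: integrable_abs (L1b_integrable p su hu).
by apply/funext => t; rewrite modc_rc.
Qed.

Lemma carrier_DL1 c u : EL1 c u -> carrier (DL1 M c) (rc u).
Proof.
case: c => -[su] hu; last first.
  by have [h [h0 [N hN]]] := hu; exists h; split => //; exact: carrier_DL1h hN.
move: hu => /= hu h h0; have [N hN] := hu h h0; exact: carrier_DL1h hN.
Qed.

Lemma L1bW h h' N u : 0 < h' -> h' <= h -> 0 <= N -> L1b h N u -> L1b h' N u.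
Proof.
move=> h0 hh N0 hu p; apply: le_trans (hu p) _; rewrite lee_fin.
rewrite ler_wpM2l//; first by rewrite mulr_ge0// ltW.
rewrite lef_pV2 ?posrE ?exprn_gt0//; last exact: lt_le_trans hh.
by rewrite lerXn2r// nnegrE ltW//; exact: lt_le_trans hh.
Qed.

Lemma supbW h h' N N' u : 0 < h' -> h' <= h -> 0 <= N -> N <= N' -> supb h N u -> supb h' N' u.
Proof.
move=> h0 hh N0 NN hu p t; apply: le_trans (hu p t) _.
have hp : 0 < h by exact: lt_le_trans hh.
apply: ler_pM.
- by rewrite mulr_ge0// ltW.
- by rewrite invr_ge0 exprn_ge0// ltW.
- by rewrite ler_wpM2r// ltW.
- rewrite lef_pV2 ?posrE ?exprn_gt0//.
  by rewrite lerXn2r// nnegrE ltW.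
Qed.

Lemma L1b_ge0 h N u : L1b h N u -> 0 <= N.
Proof.
move=> /(_ 0%N); rewrite expr0 divr1 => h0.
have := le_trans (n1_ge0 _) h0; rewrite lee_fin pmulr_lge0//.
Qed.

Lemma hclass_imply c (P Q : R -> Prop) : (forall h, 0 < h -> P h -> Q h) -> hclass c P -> hclass c Q.
Proof.
case: c => /= PQ; first by move=> hP h h0; apply: PQ => //; exact: hP.
by move=> [h [h0 Ph]]; exists h; split => //; exact: PQ.
Qed.

Lemma hclass_and c (P Q : R -> Prop) :
  (forall h h', 0 < h' -> h' <= h -> P h -> P h') -> (forall h h', 0 < h' -> h' <= h -> Q h -> Q h') ->
  hclass c P -> hclass c Q -> hclass c (fun h => P h /\ Q h).
Proof.
case: c => /= mP mQ; first by move=> hP hQ h h0; split; [exact: hP|exact: hQ].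
move=> [h1 [h10 P1]] [h2 [h20 Q2]]; exists (Num.min h1 h2).
have h0 : 0 < Num.min h1 h2 by rewrite lt_min h10.
split => //; split; first by apply: (mP h1) => //; rewrite ge_min lexx.
by apply: (mQ h2) => //; rewrite ge_min lexx orbT.
Qed.

Lemma derive1n_zero u (U : set R) : open U -> (forall t, U t -> u t = 0) ->
  forall p t, U t -> u^[p] t = 0.
Proof.
move=> oU h; elim=> [|p IH] t Ut; first exact: h.
rewrite derive1nS derive1E.
have nU : \forall s \near t, u^[p] s = (cst 0 : R -> R) s.
  by move: oU; rewrite openE => /(_ _ Ut); apply: filterS => s; exact: IH.
by rewrite (near_eq_derive _ nU) derive_cst.
Qed.

Lemma csupp_derive r u p : csupp r u -> csupp r u^[p].
Proof.
move=> hu t rt; apply: (@derive1n_zero u [set t | r < `|t|]) => //.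
apply: (@open_comp _ _ (fun t : R => `|t|) [set x | r < x]); last exact: open_gt.
by move=> x _; exact: norm_continuous.
Qed.

Lemma supp_itv (f : R -> R[i]) r : (forall t, r < `|t| -> f t = 0) -> supp f `<=` `[- r, r]%classic.
Proof.
move=> hf; have cl : closed (`[- r, r]%classic : set R) by exact: itv_closed.
rewrite /supp [X in _ `<=` X]((closure_id _).1 cl); apply: closure_subset => t /= ft; rewrite in_itv/= -ler_norml leNgt; apply/negP => /hf ft0.
by rewrite ft0 eqxx in ft.
Qed.

(** The supremum in the norm only sees t in K. Off K, f vanishes on the open complement of its
    support, hence so do its derivatives, and the bound holds on the whole line. *)
Lemma carrier_DKh_rc K h (f : R -> R[i]) : carrier (DKh M K h) f -> compact K -> 0 < h ->
  exists r N, [/\ 0 < r, 0 < N, smooth f, (forall t, r < `|t| -> f t = 0) &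
    forall p t, modc (cderiv p f t) <= N * M p / h ^+ p].
Proof.
move=> [[sf sK] nf] cK h0.
have [r [_ hr]] := compact_bounded cK.
pose r' := `|r| + 1.
have r'0 : 0 < r' by rewrite /r' ltr_wpDl.
have fz t : r' < `|t| -> f t = 0.
  move=> rt; apply/eqP; apply: contraT => ft.
  have Kt : K t by apply: sK; exact: subset_closure.
  have := hr r'; rewrite {1}/r' => /(_ _) h'.
  have /h' /(_ t Kt) /= : r < `|r| + 1 by rewrite (le_lt_trans (ler_norm _))// ltrDl.
  by move=> h3; move: rt; rewrite ltNge h3.
have [N N0 hN] : exists2 N, 0 < N & forall p t, K t -> h ^+ p * modc (cderiv p f t) / M p <= N.
  exists (`|fine (norm_sup M h K f)| + 1); first by rewrite ltr_wpDl.
  move=> p t Kt.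
  have : ((h ^+ p * modc (cderiv p f t) / M p)%:E <= norm_sup M h K f)%E.
    by apply: ereal_sup_ubound; exists p => //; exists t.
  case: (norm_sup M h K f) nf => [s| |]//= _; rewrite ?lee_fin ?leeNy_eq// => h1.
  by apply: (le_trans h1); rewrite (le_trans (ler_norm _))// lerDl.
exists r', N; split => // p t.
have [Kt|nKt] := pselect (K t).
  have := hN p t Kt; rewrite ler_pdivrMr// mulrC -ler_pdivlMr ?exprn_gt0//.
have op : open (~` supp f) by apply: closed_openC; exact: closed_closure.
have nst : (~` supp f) t by move=> st; apply: nKt; exact: sK.
have zf s : (~` supp f) s -> f s = 0.
  move=> ns; apply/eqP; apply: contraT => fs; exfalso; apply: ns; exact: subset_closure.
have -> : cderiv p f t = 0.
  rewrite /cderiv (@derive1n_zero _ (~` supp f))//; last by move=> s /zf ->.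
  by rewrite (@derive1n_zero _ (~` supp f))// => s /zf ->.
rewrite ComplexField.Normc.normc0 divr_ge0 ?mulr_ge0 ?exprn_ge0 ?ltW//.
Qed.

Lemma modc_re (z : R[i]) : `|complex.Re z| <= modc z.
Proof. by case: z => a b /=; rewrite -sqrtr_sqr ler_wsqrtr// lerDl sqr_ge0. Qed.

Lemma modc_im (z : R[i]) : `|complex.Im z| <= modc z.
Proof. by case: z => a b /=; rewrite -sqrtr_sqr ler_wsqrtr// lerDr sqr_ge0. Qed.

Lemma modc_le (z : R[i]) : modc z <= `|complex.Re z| + `|complex.Im z|.
Proof.
case: z => a b /=; rewrite -[leRHS]ger0_norm ?addr_ge0// -sqrtr_sqr ler_wsqrtr//.
rewrite -(real_normK (num_real a)) -(real_normK (num_real b)) sqrrD.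
by rewrite addrAC lerDl mulrn_wge0// mulr_ge0.
Qed.

Lemma carrier_DKh_of h r N (f : R -> R[i]) : 0 < h -> 0 < r -> smooth f ->
  (forall t, r < `|t| -> f t = 0) ->
  (forall p t, modc (cderiv p f t) <= N * M p / h ^+ p) -> carrier (DKh M `[- r, r] h) f.
Proof.
move=> h0 r0 sf zf hf; split; first by split => //; exact: supp_itv.
apply: (@le_lt_trans _ _ N%:E); last by rewrite ltry.
apply: ge_ereal_sup => _ [p _ [t _ <-]]; rewrite lee_fin ler_pdivrMr// mulrC -ler_pdivlMr ?exprn_gt0//.
Qed.

(** Reduces the test space to real functions. For the converse the bounds of the two parts are added
    at a common h, found by [hclass_and], and K is a symmetric interval containing both supports. *)
Lemma carrier_DtestP c (f : R -> R[i]) : carrier (Dtest M c) f <->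
  ET c (fun t => complex.Re (f t)) /\ ET c (fun t => complex.Im (f t)).
Proof.
split.
  move=> [K [cK]].
  have key h : 0 < h -> carrier (DKh M K h) f ->
     [/\ rsmooth (fun t => complex.Re (f t)) /\ rsmooth (fun t => complex.Im (f t)),
       exists r, [/\ 0 < r, csupp r (fun t => complex.Re (f t)) & csupp r (fun t => complex.Im (f t))] &
       exists N, [/\ 0 < N, supb h N (fun t => complex.Re (f t)) & supb h N (fun t => complex.Im (f t))]].
    move=> h0 /carrier_DKh_rc /(_ cK h0)[r [N [r0 N0 /smoothP sf zf hf]]]; split => //.
      by exists r; split => // t /zf ->.
    exists N; split => // p t; apply: le_trans (hf p t).
      exact: (modc_re (cderiv p f t)).
    exact: (modc_im (cderiv p f t)).
  case: c => /=.
    move=> hf; have [[s1 s2] [r [r0 c1 c2]] _] := key 1 ltr01 (hf _ ltr01).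
    split; split => //; try by exists r.
      by move=> h h0; have [_ _ [N [N0 ? ?]]] := key h h0 (hf _ h0); exists N.
    by move=> h h0; have [_ _ [N [N0 ? ?]]] := key h h0 (hf _ h0); exists N.
  move=> [h [h0 hf]]; have [[s1 s2] [r [r0 c1 c2]] [N [N0 ? ?]]] := key h h0 hf.
  by split; split => //; try (by exists r); exists h; split => //; exists N.
move=> [[s1 [r1 [r10 c1]] b1] [s2 [r2 [r20 c2]] b2]].
have sf : smooth f by apply/smoothP.
pose r := Num.max r1 r2.
have r0 : 0 < r by rewrite /r lt_max r10.
have zf t : r < `|t| -> f t = 0.
  rewrite /r gt_max => /andP[/c1 h1 /c2 h2].
  by apply/eqP; rewrite eq_complex; apply/andP; split; apply/eqP.
exists `[- r, r]%classic; split; first exact: segment_compact.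
have mono u h h' : 0 < h' -> h' <= h -> (exists N, 0 < N /\ supb h N u) -> exists N, 0 < N /\ supb h' N u.
  by move=> h'0 hh [N [N0 hN]]; exists N; split => //; exact: (supbW h'0 hh (ltW N0) (lexx N)).
have := hclass_and (mono _) (mono _) b1 b2.
move=> /(@hclass_imply _ _ (fun h => carrier (DKh M `[- r, r] h) f)) H.
have {}H : hclass c (fun h => carrier (DKh M `[- r, r] h) f).
  apply: H => h h0 [[N1 [N10 h1]] [N2 [N20 h2]]].
  apply: (@carrier_DKh_of _ _ (N1 + N2)) => // p t.
  apply: le_trans (modc_le _) _; rewrite mulrDl mulrDl.
  by apply: lerD; [exact: h1|exact: h2].
by case: c H b1 b2.
Qed.

Lemma L1b_lin h N N' a u v : rsmooth u -> rsmooth v -> L1b h N u -> L1b h N' v ->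
  L1b h (`|a| * N + N') (fun x => a * u x + v x).
Proof.
move=> su sv hu hv p; have [_ ->] := rsmooth_lin a su sv.
have mu_ := rsmooth_meas p su; have mv := rsmooth_meas p sv.
apply: le_trans (n1D _ mv) _; first exact: measurable_funM.
rewrite n1Z// !mulrDl EFinD; apply: leeD; last exact: hv.
rewrite -!mulrA EFinM mulrA; apply: lee_wpmul2l; first by rewrite lee_fin.
exact: hu.
Qed.

Lemma L1b_mono h u h' : 0 < h' -> h' <= h -> (exists N, L1b h N u) -> exists N, L1b h' N u.
Proof. by move=> h0 hh [N hN]; exists N; apply: (L1bW h0 hh (L1b_ge0 hN) hN). Qed.

Lemma EL1_lin c a u v : EL1 c u -> EL1 c v -> EL1 c (fun x => a * u x + v x).
Proof.
move=> [su hu] [sv hv]; split; first by have [] := rsmooth_lin a su sv.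
have H := hclass_and (fun h h' => @L1b_mono h u h') (fun h h' => @L1b_mono h v h') hu hv.
apply: hclass_imply H => h h0 [[N hN] [N' hN']].
by exists (`|a| * N + N'); exact: L1b_lin.
Qed.

Lemma supb_lin h N N' a u v : rsmooth u -> rsmooth v -> supb h N u -> supb h N' v ->
  supb h (`|a| * N + N') (fun x => a * u x + v x).
Proof.
move=> su sv hu hv p t; have [_ ->] := rsmooth_lin a su sv.
rewrite mulrDl mulrDl; apply: le_trans (ler_normD _ _) _; apply: lerD; last exact: hv.
by rewrite normrM -!mulrA ler_wpM2l// mulrA; exact: hu.
Qed.

Lemma supb_mono h u h' : 0 < h' -> h' <= h -> (exists N, 0 < N /\ supb h N u) ->
  exists N, 0 < N /\ supb h' N u.
Proof.
by move=> h0 hh [N [N0 hN]]; exists N; split => //; apply: (supbW h0 hh (ltW N0) (lexx N) hN).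
Qed.

Lemma ET_lin c a u v : ET c u -> ET c v -> ET c (fun x => a * u x + v x).
Proof.
move=> [su [r [r0 cu]] hu] [sv [r' [r'0 cv]] hv]; split.
- by have [] := rsmooth_lin a su sv.
- exists (Num.max r r'); split; first by rewrite lt_max r0.
  by move=> t; rewrite gt_max => /andP[/cu -> /cv ->]; rewrite mulr0 addr0.
- have H := hclass_and (fun h h' => @supb_mono h u h') (fun h h' => @supb_mono h v h') hu hv.
  apply: hclass_imply H => h h0 [[N [N0 hN]] [N' [N'0 hN']]].
  by exists (`|a| * N + N'); split; [rewrite ltr_wpDl// mulr_ge0// ltW|exact: supb_lin].
Qed.

Lemma ET_0 c : ET c (fun=> 0).
Proof.
split; first exact: rsmooth_cst0.
  by exists 1; split.
have H h : 0 < h -> exists N, 0 < N /\ supb h N (fun=> 0).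
  move=> h0; exists 1; split => // p t.
  by rewrite derive1n0E normr0 divr_ge0 ?exprn_ge0 ?mulr_ge0 ?ltW.
by case: c => //; exists 1; split => //; exact: H.
Qed.

Lemma n1_csupp (w : R -> R) r N : measurable_fun setT w -> 0 < r -> csupp r w ->
  (forall t, `|w t| <= N) -> (n1 w <= (2 * r * N)%:E)%E.
Proof.
move=> mw r0 cw wN; have N0 : 0 <= N := le_trans (normr_ge0 _) (wN 0).
have rr : - r <= r by lra.
have mI : measurable_fun setT (\1_(`[- r, r]) : R -> R) by exact: measurable_indic.
apply: (@le_trans _ _ (n1 (fun t => N * (\1_(`[- r, r]) t : R))%R)).
  apply: le_n1 => //; first exact: measurable_funM.
  move=> t; rewrite indicE mem_setE in_itv/= -ler_norml.
  have [tr|/cw ->] := leP `|t| r; last by rewrite mulr0 normr0.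
  by rewrite mulr1 (ger0_norm N0).
rewrite n1Z// n1_indic// (ger0_norm N0) -EFinM lee_fin.
by rewrite le_eqVlt; apply/orP; left; apply/eqP; ring.
Qed.

Lemma supb_L1b h r N u : rsmooth u -> 0 < r -> csupp r u -> supb h N u -> L1b h (2 * r * N) u.
Proof.
move=> su r0 cu hu p.
apply: le_trans (n1_csupp (rsmooth_meas p su) r0 (csupp_derive p cu) (hu p)) _.
by rewrite !mulrA lexx.
Qed.

Lemma ET_EL1 c u : ET c u -> EL1 c u.
Proof.
move=> [su [r [r0 cu]] hu]; split => //; apply: hclass_imply hu => h h0 [N [N0 hN]].
by exists (2 * r * N); exact: supb_L1b.
Qed.

Lemma EL1_0 c : EL1 c (fun=> 0).
Proof. exact/ET_EL1/ET_0. Qed.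

Lemma L1b_refl h N u a : rsmooth u -> L1b h N u -> L1b h N (fun t => u (a - t)).
Proof.
move=> su hu p; have [_ ->] := rsmooth_refl a su; have mu_ := rsmooth_meas p su.
rewrite n1Z; last by apply: measurableT_comp => //; exact: measurable_funB.
by rewrite normrX normrN1 expr1n mul1e n1_refl.
Qed.

Lemma supb_refl h N u a : rsmooth u -> supb h N u -> supb h N (fun t => u (a - t)).
Proof.
move=> su hu p t; have [_ ->] := rsmooth_refl a su.
by rewrite normrM normrX normrN1 expr1n mul1r; exact: hu.
Qed.

Lemma csupp_refl r u a : csupp r u -> csupp (r + `|a|) (fun t => u (a - t)).
Proof.
move=> cu t ht; apply: cu; have := ler_normD (a - t) (- a).
have -> : a - t - a = - t by ring.
rewrite !normrN; lra.
Qed.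

Lemma EL1_refl c u a : EL1 c u -> EL1 c (fun t => u (a - t)).
Proof.
move=> [su hu]; split; first by have [] := rsmooth_refl a su.
by apply: hclass_imply hu => h h0 [N hN]; exists N; exact: L1b_refl.
Qed.

Lemma ET_refl c u a : ET c u -> ET c (fun t => u (a - t)).
Proof.
move=> [su [r [r0 cu]] hu]; split.
- by have [] := rsmooth_refl a su.
- exists (r + `|a|); split; last exact: csupp_refl.
  by rewrite ltr_wpDr.
- by apply: hclass_imply hu => h h0 [N [N0 hN]]; exists N; split => //; exact: supb_refl.
Qed.

Section bounded_functional.
Variables (X : completeNormedModType R[i]) (c : ultra_class) (T : (R -> R[i]) -> X).
Hypothesis hT : continuous_linear (DL1 M c) T.

(** Restricted to [EL1], since [T] carries no information elsewhere; N is positive so that u can be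
    divided by it. *)
Definition TBound h C := forall u, EL1 c u -> forall N, 0 < N -> L1b h N u ->
  nX (T (rc u)) <= C * N.

Lemma T_lin a u v : EL1 c u -> EL1 c v ->
  T (rc (fun x => a * u x + v x)) = a%:C *: T (rc u) + T (rc v).
Proof.
move=> hu hv; have := hT.1 a%:C _ _ (carrier_DL1 hu) (carrier_DL1 hv).
by move=> <-; congr T; apply/funext => t; rewrite /rc rmorphD rmorphM.
Qed.

Lemma T_complex (f : R -> R[i]) : EL1 c (fun t => complex.Re (f t)) -> EL1 c (fun t => complex.Im (f t)) ->
  T f = 'i%C *: T (rc (fun t => complex.Im (f t))) + T (rc (fun t => complex.Re (f t))).
Proof.
move=> hu hv; rewrite -(hT.1 'i%C _ _ (carrier_DL1 hv) (carrier_DL1 hu)).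
congr T; apply/funext => t; rewrite /rc addrC; case: (f t) => x y.
by apply/eqP; rewrite eq_complex/=; apply/andP; split; apply/eqP; ring.
Qed.

Lemma T_0 : T (rc (fun=> 0)) = 0.
Proof.
have := T_lin 1 (EL1_0 c) (EL1_0 c).
rewrite (_ : (fun=> 1 * 0 + 0) = (fun=> 0)); last by apply/funext => t; rewrite mulr0 addr0.
rewrite scale1r => /eqP; rewrite -subr_eq0 opprD addrA subrr sub0r oppr_eq0 => /eqP; exact.
Qed.

Lemma T_boundP h e : 0 < h -> 0 < e ->
  (forall u, EL1 c u -> (norm_L1 M h (rc u) < e%:E)%E -> nX (T (rc u)) < 1) ->
  TBound h (2 / e).
Proof.
move=> h0 e0 H u hu N N0 hN.
(* a * u has norm at most e / 2 < e, which produces the constant 2 / e. The term + 0 below only fits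
   it to [EL1_lin]. *)
pose a := e / (2 * N); have a0 : 0 < a by rewrite divr_gt0// mulr_gt0.
have hau := EL1_lin a hu (EL1_0 c).
have := H _ hau; rewrite T_lin//; last exact: EL1_0.
rewrite T_0 addr0 nXZr gtr0_norm// => {}H.
have : (norm_L1 M h (rc (fun x => a * u x + 0)%R) < e%:E)%E.
  have h0b : L1b h 0 (fun=> 0).
    by move=> p; rewrite derive1n0E !mul0r /n1; under eq_integral do rewrite normr0; rewrite integral0.
  have := L1b_lin a hu.1 (EL1_0 c).1 hN h0b.
  move=> /(norm_L1_rc h0) /le_lt_trans; apply; rewrite lte_fin addr0 gtr0_norm// /a.
  have -> : e / (2 * N) * N = e / 2 by field; lra.
  lra.
move=> /H; rewrite mulrC -ltr_pdivlMr// => /ltW /le_trans; apply.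
by rewrite le_eqVlt; apply/orP; left; apply/eqP; rewrite /a; field; apply/andP; split; lra.
Qed.

Lemma nbhs0_T : nbhs0 (DL1 M c) [set u | nX (T u) < 1].
Proof.
have := hT.2 _ 1 (carrier_DL1 (EL1_0 c)) ltr01.
rewrite T_0; congr (nbhs0 _ _); apply/funext => u /=; rewrite subr0 -nX_lt.
by congr (nX (T _) < 1 : Prop); apply/funext => t; rewrite /rc add0r.
Qed.

End bounded_functional.

(** A neighbourhood of 0 in the projective limit involves finitely many h; as ||.||_{1,h} increases
    with h, the largest of them is enough. *)
Lemma T_bound_Beurling (X : completeNormedModType R[i]) (T : (R -> R[i]) -> X) :
  continuous_linear (DL1 M Beurling) T ->
  exists h C, [/\ 0 < h, 0 < C & TBound Beurling T h C].
Proof.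
move=> hT; have [s [V [hV hU]]] := nbhs0_T hT.
have [h [e [h0 e0 he]]] : exists h e, [/\ 0 < h, 0 < e &
   forall u, EL1 Beurling u -> (norm_L1 M h (rc u) < e%:E)%E -> forall i, i \in s -> V i (rc u)].
  elim: s hV {hU} => [|i s IH] hV; first by exists 1, 1; split.
  have [|h [e [h0 e0 he]]] := IH; first by move=> j js; apply: hV; rewrite inE js orbT.
  have [i0 [e' [e'0 he']]] := hV i (mem_head _ _).
  exists (Num.max h i), (Num.min e e'); split.
  - by rewrite lt_max h0.
  - by rewrite lt_min e0.
  - move=> u hu hn j; have mono h' : 0 < h' -> h' <= Num.max h i -> (norm_L1 M h' (rc u) <= norm_L1 M (Num.max h i) (rc u))%E.
      move=> h'0 hh; apply: ge_ereal_sup => _ [p _ <-].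
      apply: (@le_trans _ _ ((Num.max h i ^+ p / M p)%:E * \int[mu]_t (modc (cderiv p (rc u) t))%:E)%E).
        apply: lee_wpmul2r; first by apply: integral_ge0 => t _; rewrite lee_fin modc_ge0.
        rewrite lee_fin; apply: ler_wpM2r; first by rewrite invr_ge0 ltW.
        by rewrite lerXn2r// nnegrE ltW//; exact: lt_le_trans hh.
      by apply: ereal_sup_ubound; exists p.
    have hmin : (norm_L1 M (Num.max h i) (rc u) < e%:E)%E /\ (norm_L1 M (Num.max h i) (rc u) < e'%:E)%E.
      by split; apply: (lt_le_trans hn); rewrite lee_fin ge_min lexx ?orbT.
    rewrite inE => /predU1P[->|js].
      apply: he'; first by have := carrier_DL1 hu; apply.
      by apply: le_lt_trans hmin.2; apply: mono => //; rewrite le_max lexx orbT.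
    apply: (he u hu) => //; apply: le_lt_trans hmin.1; apply: mono => //; by rewrite le_max lexx.
exists h, (2 / e); split; [by []|by rewrite divr_gt0|].
apply: T_boundP => // u hu hn; apply: hU; first exact: (carrier_DL1 hu).
exact: he.
Qed.

(** A neighbourhood of 0 in the inductive limit contains a set V that is a neighbourhood of 0 for
    every single norm, which gives one bound for each h. *)
Lemma T_bound_Roumieu (X : completeNormedModType R[i]) (T : (R -> R[i]) -> X) :
  continuous_linear (DL1 M Roumieu) T ->
  forall h, 0 < h -> exists C, 0 < C /\ TBound Roumieu T h C.
Proof.
move=> hT h h0; have [V [_ _ VU hV]] := nbhs0_T hT.
have [e [e0 he]] := hV h h0.
exists (2 / e); split; first by rewrite divr_gt0.
apply: T_boundP => // u hu hn; apply: VU; apply: he => //.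
split; last by apply: lt_trans hn _; rewrite ltry.
have [su [h1 [h10 [N1 hN1]]]] := hu; split; first exact: smooth_rc.
move=> p; rewrite (_ : (fun t => _) = EFin \o (fun t => `|u^[p] t|)).
  exact: integrable_abs (L1b_integrable p su hN1).
by apply/funext => t; rewrite modc_rc.
Qed.
End ultra_classes.

(** * Translation and Riemann sums in the norms of D_{L^1} *)

Section fubini.
Variables (R : realType) (M : nat -> R).
Hypothesis M_gt0 : forall p, 0 < M p.
Implicit Types (u v phi psi : R -> R) (h N r : R) (c : ultra_class).
Notation mu := (@lebesgue_measure R).

Lemma n1B u v : measurable_fun setT u -> measurable_fun setT v ->
  (n1 (fun x => u x - v x)%R <= n1 u + n1 v)%E.
Proof.
move=> mu_ mv; have -> : n1 v = n1 (fun x => -1 * v x) by rewrite n1Z// normrN1 mul1e.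
rewrite (_ : (fun x => _) = (fun x => u x + -1 * v x)); last by apply/funext => x; rewrite mulN1r.
by apply: n1D => //; exact: measurable_funM.
Qed.

Lemma pow_small (q N e : R) : 0 <= q -> q < 1 -> 0 <= N -> 0 < e ->
  exists P : nat, forall p, (P <= p)%N -> N * q ^+ p <= e.
Proof.
move=> q0 q1 N0 e0.
have /cvgrPdist_lt H : (fun n : nat => q ^+ n) @ \oo --> (0 : R) by apply: cvg_expr; rewrite ger0_norm.
have e1 : 0 < e / (N + 1) by rewrite divr_gt0//; lra.
have [P _ hP] := H _ e1.
exists P => p /hP; rewrite /= sub0r normrN ger0_norm ?exprn_ge0// ltr_pdivlMr; last by lra.
have : 0 <= q ^+ p by rewrite exprn_ge0.
nra.
Qed.

(* Large p are controlled by (h0 / h)^p and small p by eta: no stability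
   condition on M is needed. *)
Lemma L1b_small h0 h N e : 0 < h0 -> h0 < h -> 0 <= N -> 0 < e ->
  exists P eta, 0 < eta /\ forall w : nat -> \bar R,
    (forall p, w p <= (N * M p / h ^+ p)%:E)%E -> (forall p, (p < P)%N -> (w p <= eta%:E)%E) ->
    forall p, (w p <= (e * M p / h0 ^+ p)%:E)%E.
Proof.
move=> h00 hh N0 e0; have hp : 0 < h by exact: lt_trans hh.
have [P hP] : exists P : nat, forall p, (P <= p)%N -> N * (h0 / h) ^+ p <= e.
  by apply: pow_small => //; [rewrite divr_ge0// ltW|rewrite ltr_pdivrMr// mul1r].
have [eta [eta0 heta]] : exists eta, 0 < eta /\ forall p, (p < P)%N -> eta <= e * M p / h0 ^+ p.
  elim: P {hP} => [|P [eta [eta0 IH]]]; first by exists 1.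
  exists (Num.min eta (e * M P / h0 ^+ P)); split.
    by rewrite lt_min eta0 divr_gt0 ?mulr_gt0// exprn_gt0.
  move=> p; rewrite ltnS leq_eqVlt => /predU1P[->|/IH]; first by rewrite ge_min lexx orbT.
  by apply: le_trans; rewrite ge_min lexx.
exists P, eta; split => // w w1 w2 p.
have [pP|Pp] := ltnP p P; first by apply: le_trans (w2 p pP) _; rewrite lee_fin heta.
apply: le_trans (w1 p) _; rewrite lee_fin ler_pdivrMr ?exprn_gt0//.
have := hP p Pp; rewrite expr_div_n => H.
have -> : e * M p / h0 ^+ p * h ^+ p = e * (M p * (h ^+ p / h0 ^+ p)).
  by rewrite -!mulrA; congr (_ * (_ * _)); rewrite mulrC.
have -> : N * M p = N * (h0 ^+ p / h ^+ p) * (M p * (h ^+ p / h0 ^+ p)).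
  by field; rewrite !gt_eqF// exprn_gt0.
by rewrite ler_wpM2r// mulr_ge0 ?divr_ge0 ?exprn_ge0// ltW.
Qed.

Lemma n1_translate2 u p (a b : R) : rsmooth u ->
  (n1 (fun t => u^[p] (a - t) - u^[p] (b - t))%R <= (`|a - b|)%:E * n1 u^[p.+1])%E.
Proof.
move=> su.
rewrite -(@n1_refl _ _ b); last first.
  by apply: measurable_funB; (apply: measurableT_comp; [exact: rsmooth_meas|exact: measurable_funB]).
rewrite (_ : (fun x => _) = (fun x => u^[p] (x + (a - b)) - u^[p] x)).
  apply: n1_translate; last exact: rsmooth_cont.
  by move=> x; exact: rsmooth_is_derive.
by apply/funext => x; congr (u^[p] _ - u^[p] _); ring.
Qed.

(** The orders p < P are controlled by [n1_translate2], the others by [L1b_small]; the bound 2 * N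
    used there comes from the two translates. *)
Lemma L1b_translate h0 h N phi e : rsmooth phi -> L1b M h N phi -> 0 < h0 -> h0 < h -> 0 < e ->
  exists2 d : R, 0 < d & forall a b : R, `|a - b| < d -> forall p,
   (n1 (fun t => phi^[p] (a - t) - phi^[p] (b - t))%R <= (e * M p / h0 ^+ p)%:E)%E.
Proof.
move=> su hN h00 hh e0; have N0 := L1b_ge0 M_gt0 hN; have hp : 0 < h by exact: lt_trans hh.
have N20 : 0 <= 2 * N by rewrite mulr_ge0.
have [P [eta [eta0 H]]] := L1b_small h00 hh N20 e0.
have [d [d0 hd]] : exists d, 0 < d /\ forall p, (p < P)%N -> d * (N * M p.+1 / h ^+ p.+1) <= eta.
  elim: P {H} => [|P [d [d0 IH]]]; first by exists 1.
  have w0 : 0 <= N * M P.+1 / h ^+ P.+1 by rewrite divr_ge0 ?mulr_ge0 ?exprn_ge0 // ltW.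
  exists (Num.min d (eta / (N * M P.+1 / h ^+ P.+1 + 1))); split.
    by rewrite lt_min d0 divr_gt0//; lra.
  move=> p; rewrite ltnS leq_eqVlt => /predU1P[->|/IH].
    apply: (@le_trans _ _ (eta / (N * M P.+1 / h ^+ P.+1 + 1) * (N * M P.+1 / h ^+ P.+1))).
      by rewrite ler_wpM2r// ge_min lexx orbT.
    by rewrite mulrAC ler_pdivrMr; [nra|lra].
  apply: le_trans; rewrite ler_wpM2r ?ge_min ?lexx//.
  by rewrite divr_ge0 ?mulr_ge0 ?exprn_ge0 // ltW.
exists d => // a b ab; apply: H => p.
  have m (a' : R) : measurable_fun setT (fun t : R => phi^[p] (a' - t)).
    by apply: measurableT_comp; [exact: rsmooth_meas|exact: measurable_funB].
  apply: le_trans (n1B (m a) (m b)) _.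
  rewrite !n1_refl; try exact: rsmooth_meas.
  by apply: le_trans (leeD (hN p) (hN p)) _; rewrite -EFinD lee_fin le_eqVlt; apply/orP; left; apply/eqP; ring.
move=> pP; apply: le_trans (n1_translate2 p a b su) _.
apply: (@le_trans _ _ (d%:E * (N * M p.+1 / h ^+ p.+1)%:E)%E).
  by apply: lee_pmul => //; [exact: n1_ge0|rewrite lee_fin ltW].
by rewrite -EFinM lee_fin hd.
Qed.

(** Tonelli, after cutting H off by the indicator of D. The bound g may depend on x: mollification
    takes it proportional to the density. *)
Lemma minkowski_integral (H : R * R -> R) (D : set R) (g : R -> R) :
  measurable_fun setT H -> measurable D -> measurable_fun setT g -> (forall x, 0 <= g x) ->
  (forall x, D x -> (n1 (fun t => H (x, t)) <= (g x)%:E)%E) ->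
  measurable_fun setT (fun t => \int[mu]_(x in D) H (x, t)) /\
  (n1 (fun t => \int[mu]_(x in D) H (x, t))%R <= \int[mu]_(x in D) (g x)%:E)%E.
Proof.
move=> mH mD mg g0 hk.
pose HD (p : R * R) : R := (\1_D p.1 : R) * H p.
have mHD : measurable_fun setT HD.
  by apply: measurable_funM => //; apply: measurableT_comp; [exact: measurable_indic|exact: measurable_fst].
have E t : \int[mu]_(x in D) H (x, t) = \int[mu]_x HD (x, t).
  rewrite Rintegral_mkcond; apply: eq_Rintegral => x _.
  by rewrite patchE /HD indicE/=; case: ifP => _; rewrite ?mul1r ?mul0r.
under eq_fun do rewrite E.
have mE : measurable_fun setT (EFin \o HD) by exact/measurable_EFinP.
have mM : measurable_fun setT (fun t => \int[mu]_x HD (x, t)).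
  rewrite /Rintegral; apply: (measurableT_comp (f := fine)); first exact: fine_measurable.
  rewrite (_ : (fun _ => _) = (fun t => (\int[mu]_x (EFin \o HD)^\+%E (x, t)
   - \int[mu]_x (EFin \o HD)^\-%E (x, t))%E)).
    apply: emeasurable_funB.
      apply: (@measurable_fun_fubini_tonelli_G _ _ _ _ _ mu (EFin \o HD)^\+%E) => //.
      exact: measurable_funepos.
    apply: (@measurable_fun_fubini_tonelli_G _ _ _ _ _ mu (EFin \o HD)^\-%E) => //.
    exact: measurable_funeneg.
  by apply/funext => t; rewrite integralE; congr (_ - _)%E; apply: eq_integral => s _; rewrite ?funeposE ?funenegE.
split => //.
have ma : measurable_fun setT (fun p : R * R => (`|HD p|)%:E).
  by apply/measurable_EFinP; apply: measurableT_comp.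
apply: (@le_trans _ _ (\int[mu]_t \int[mu]_x (`|HD (x, t)|)%:E)%E).
  apply: ge0_le_integral => //.
  - exact: measurable_norm.
  - exact: (@measurable_fun_fubini_tonelli_G _ _ _ _ _ mu (fun p : R * R => (`|HD p|)%:E)).
  - move=> t _; rewrite /Rintegral.
    have mt : measurable_fun setT (fun x => (HD (x, t))%:E).
      by apply/measurable_EFinP; apply: measurableT_comp => //; exact: measurable_pair2.
    apply: le_trans (le_abse_integral mu measurableT mt).
    by case: (integral _ _ _) => [s| |] //=; rewrite normr0 leey.
rewrite -(@fubini_tonelli _ _ _ _ _ mu mu (fun p : R * R => (`|HD p|)%:E))//=.
rewrite [leRHS]integral_mkcond/=.
apply: ge0_le_integral => //.
- by move=> x _; apply: integral_ge0 => t _; rewrite lee_fin.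
- exact: (@measurable_fun_fubini_tonelli_F _ _ _ _ _ mu (fun p : R * R => (`|HD p|)%:E)).
- apply/(measurable_restrictT _ mD); apply: measurable_funTS; exact/measurable_EFinP.
- move=> x _; rewrite patchE.
  have hE t : HD (x, t) = (x \in D)%:R * H (x, t) by rewrite /HD indicE.
  under eq_integral do rewrite hE.
  have [xD|xD] := boolP (x \in D).
    apply: le_trans (hk x (set_mem xD)).
    by rewrite le_eqVlt; apply/orP; left; apply/eqP; apply: eq_integral => t _; rewrite mul1r.
  by rewrite integral0_eq// => t _; rewrite mul0r normr0.
Qed.

Lemma minkowski_n1 (H : R * R -> R) (D : set R) (k : R) : 0 <= k ->
  measurable_fun setT H -> measurable D ->
  (forall x, D x -> (n1 (fun t => H (x, t)) <= k%:E)%E) ->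
  measurable_fun setT (fun t => \int[mu]_(x in D) H (x, t)) /\
  (n1 (fun t => \int[mu]_(x in D) H (x, t))%R <= k%:E * mu D)%E.
Proof.
move=> k0 mH mD hk.
have [m1 m2] := minkowski_integral mH mD (@measurable_cst _ _ _ _ _ k) (fun=> k0) hk.
by split => //; apply: le_trans m2 _; rewrite (integral_cst mu mD k%:E).
Qed.

End fubini.

Section fubini.
Variables (R : realType) (M : nat -> R).
Hypothesis M_gt0 : forall p, 0 < M p.
Implicit Types (u v phi psi : R -> R) (h N r : R) (c : ultra_class).
Notation mu := (@lebesgue_measure R).

Lemma Mh_ge0 N h p : 0 <= N -> 0 < h -> 0 <= N * M p / h ^+ p.
Proof. by move=> N0 hp; rewrite divr_ge0 ?exprn_ge0 ?(ltW hp)// mulr_ge0// ltW. Qed.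

(** On each cell the error is the integral over y of psi (s n) f (s n - t) - psi y f (y - t);
    Minkowski's inequality bounds its L^1 norm by k times the length of the cell. *)
Lemma riemann_sum_n1 (f psi : R -> R) (k d : R) (n : nat) (x s : nat -> R) :
  continuous f -> continuous psi -> 0 <= k ->
  (forall a b : R, `|a - b| < d -> (n1 (fun t => psi a * f (a - t) - psi b * f (b - t))%R <= k%:E)%E) ->
  (forall i, (i < n)%N -> [/\ x i <= s i, s i <= x i.+1 & x i.+1 - x i < d]) ->
  let D t := \sum_(i < n) (x i.+1 - x i) * (psi (s i) * f (s i - t)) -
     \int[mu]_(y in `[x 0%N, x n]) (psi y * f (y - t)) in
  measurable_fun setT D /\ (n1 D <= (k * (x n - x 0%N))%:E)%E.
Proof.
move=> cf cpsi k0 hk; elim: n => [|n IH] hx D.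
  have -> : D = fun=> 0.
    by apply/funext => t; rewrite /D big_ord0 set_itv1 Rintegral_set1 subrr.
  split; first exact: measurable_cst.
  by rewrite subrr mulr0 /n1; under eq_integral do rewrite normr0; rewrite integral0.
have [] := IH (fun i ii => hx i (ltnW ii)).
set D' := fun t => _ => mD' nD'.
have x0n : x 0%N <= x n.
  have : forall k, (k <= n)%N -> x 0%N <= x k.
    elim => // j IHj jn; apply: (le_trans (IHj (ltnW jn))).
    by have [? ? _] := hx j (ltnW jn); lra.
  exact.
have [sn1 sn2 dn] := hx n (ltnSn n).
have xn1 : x n <= x n.+1 by lra.
have cfy t : continuous (fun y => psi y * f (y - t)).
  move=> y; apply: cvgM; first exact: cpsi.
  apply: (@continuous_comp _ _ _ (fun y => y - t) f); last exact: cf.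
  by apply: cvgB; [exact: cvg_id|exact: cvg_cst].
pose H (p : R * R) := psi (s n) * f (s n - p.2) - psi p.1 * f (p.1 - p.2).
have mf := continuous_measurable_fun cf; have mpsi := continuous_measurable_fun cpsi.
have mH : measurable_fun setT H.
  apply: measurable_funB; apply: measurable_funM.
  - exact: measurable_cst.
  - apply: (measurableT_comp mf); apply: measurable_funB; [exact: measurable_cst|exact: measurable_snd].
  - apply: (measurableT_comp mpsi); exact: measurable_fst.
  - apply: (measurableT_comp mf); apply: measurable_funB; [exact: measurable_fst|exact: measurable_snd].
have hkH y : `]x n, x n.+1]%classic y -> (n1 (fun t => H (y, t)) <= k%:E)%E.
  by rewrite /= in_itv/= => /andP[? ?]; apply: hk; rewrite ltr_norml; apply/andP; split; lra.
have [mw nw] := minkowski_n1 k0 mH (measurable_itv _) hkH.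
have DE : D = fun t => D' t + \int[mu]_(y in `]x n, x n.+1]) H (y, t).
  apply/funext => t; rewrite /D /D' big_ord_recr/=.
  have ig : mu.-integrable `[x 0%N, x n.+1] (EFin \o (fun y => psi y * f (y - t))).
    exact: continuous_integrable_itv.
  have -> : \int[mu]_(y in `[x 0%N, x n.+1]) (psi y * f (y - t)) = \int[mu]_(y in `[x 0%N, x n]) (psi y * f (y - t))
      + \int[mu]_(y in `]x n, x n.+1]) (psi y * f (y - t)).
    by rewrite -(Rintegral_itvB ig)// ?bnd_simp// addrC subrK.
  have sub : `]x n, x n.+1]%classic `<=` `[x 0%N, x n.+1]%classic.
    by apply: subset_itvr; rewrite bnd_simp.
  have -> : \int[mu]_(y in `]x n, x n.+1]) H (y, t) =
     (x n.+1 - x n) * (psi (s n) * f (s n - t)) - \int[mu]_(y in `]x n, x n.+1]) (psi y * f (y - t)).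
    rewrite /H RintegralB//; last exact: integrableS ig.
      rewrite /= Rintegral_cst// mulrC; congr (_ * _ - _).
      have := @lebesgue_measure_itv R `]x n, x n.+1]; rewrite /= => ->.
      rewrite lte_fin; case: ltP => [_//|h].
      by rewrite /= (le_anti (introT andP (conj xn1 h))) subrr.
    apply: (@integrableS _ _ _ mu `[x 0%N, x n.+1]) => //.
    by apply: (@continuous_integrable_itv _ (fun=> psi (s n) * f (s n - t))) => y; exact: cvg_cst.
  ring.
split; first by rewrite DE; exact: measurable_funD.
rewrite DE; apply: le_trans (n1D mD' mw) _.
have -> : k * (x n.+1 - x 0%N) = k * (x n - x 0%N) + k * (x n.+1 - x n) by ring.
rewrite EFinD; apply: leeD => //; apply: le_trans nw _.
have := @lebesgue_measure_itv R `]x n, x n.+1]; rewrite /= => ->.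
rewrite lte_fin; case: ltP => [_|h]; first by rewrite -EFinB -EFinM.
by rewrite /= (le_anti (introT andP (conj xn1 h))) subrr mulr0 mule0.
Qed.

Lemma sum_refl c (phi : R -> R) (n : nat) (w s : nat -> R) : EL1 M c phi ->
  EL1 M c (fun t => \sum_(i < n) w i * phi (s i - t)) /\
  forall p, (fun t => \sum_(i < n) w i * phi (s i - t))^[p] =
    (fun t => (-1) ^+ p * \sum_(i < n) w i * phi^[p] (s i - t)).
Proof.
move=> hphi; elim: n => [|n [IH1 IH2]].
  have -> : (fun t : R => \sum_(i < 0) w i * phi (s i - t)) = fun=> 0.
    by apply/funext => t; rewrite big_ord0.
  split; first exact: EL1_0.
  by move=> p; rewrite derive1n0E; apply/funext => t; rewrite big_ord0 mulr0.
have E : (fun t : R => \sum_(i < n.+1) w i * phi (s i - t)) =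
   (fun t => w n * phi (s n - t) + \sum_(i < n) w i * phi (s i - t)).
  by apply/funext => t; rewrite big_ord_recr/= addrC.
have hn := EL1_refl (s n) hphi.
rewrite E; split; first exact: EL1_lin.
move=> p; have [_ ->] := rsmooth_lin (w n) hn.1 IH1.1; rewrite IH2.
have [_ ->] := rsmooth_refl (s n) hphi.1.
by apply/funext => t; rewrite big_ord_recr/=; ring.
Qed.

Lemma EL1_bounded c u p : EL1 M c u -> exists B : R, forall x, `|u^[p] x| <= B.
Proof.
move=> [su hu]; exists (fine (n1 u^[p]) + fine (n1 u^[p.+1])).
have [h [N hN]] : exists h N, L1b M h N u.
  by case: c hu => /= [/(_ 1 ltr01)[N ?]|[h [_ [N ?]]]]; [exists 1, N|exists h, N].
apply: n1_bounded.
- by move=> x; exact: rsmooth_is_derive.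
- exact: rsmooth_cont.
- exact: L1b_finite hN.
- exact: L1b_finite hN.
Qed.

Lemma corr_EL1 c (phi psi : R -> R) : EL1 M c phi -> mu.-integrable setT (EFin \o psi) ->
  EL1 M c (corr phi psi) /\ forall p, (corr phi psi)^[p] = (fun t => (-1) ^+ p * corr phi^[p] psi t).
Proof.
move=> hphi ipsi; have [mpsi fpsi] := n1_integrable ipsi.
have [s1 s2] := rsmooth_corr2 ipsi hphi.1 (fun p => EL1_bounded p hphi).
split => //; split => //; have [su hu] := hphi; apply: hclass_imply hu => h h0 [N hN].
exists (N * fine (n1 psi)) => p; rewrite s2.
have mp := rsmooth_meas p su.
rewrite n1Z; last exact: measurable_corr.
rewrite normrX normrN1 expr1n mul1e; apply: le_trans (corr_n1 mp mpsi) _.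
rewrite -[n1 psi]fineK; last by rewrite ge0_fin_numE// n1_ge0.
apply: (@le_trans _ _ ((N * M p / h ^+ p)%:E * (fine (n1 psi))%:E)%E).
  by apply: lee_wpmul2r; [rewrite lee_fin fine_ge0// n1_ge0|exact: hN].
by rewrite -EFinM lee_fin le_eqVlt; apply/orP; left; apply/eqP; rewrite fineK ?ge0_fin_numE ?n1_ge0//; ring.
Qed.

Lemma csupp_integrable (psi : R -> R) r : continuous psi -> 0 < r -> csupp r psi ->
  (exists B : R, forall t, `|psi t| <= B) /\ mu.-integrable setT (EFin \o psi).
Proof.
move=> cpsi r0 cs.
have [B hB] : exists B : R, forall t, `|psi t| <= B.
  have rr : - r <= r by lra.
  have cn : {within `[- r, r], continuous (fun t => `|psi t|)}.
    by apply: continuous_subspaceT => t; apply: cvg_norm; exact: cpsi.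
  have [m mr hm] := EVT_max rr cn.
  exists `|psi m| => t; have [tr|/cs ->] := leP `|t| r; last by rewrite normr0.
  by apply: hm; rewrite in_itv/= -ler_norml.
split; first by exists B.
have mpsi := continuous_measurable_fun cpsi.
apply: integrable_n1 => //; apply: le_lt_trans (n1_csupp mpsi r0 cs hB) _.
by rewrite ltry.
Qed.

Section with_functional.
Variables (X : completeNormedModType R[i]) (c : ultra_class) (T : (R -> R[i]) -> X).
Hypothesis hT : continuous_linear (DL1 M c) T.

Lemma conv_rc (phi : R -> R) x : Defs.conv T (rc phi) x = T (rc (fun t => phi (x - t))).
Proof. by []. Qed.

Lemma T_sub u v : EL1 M c u -> EL1 M c v ->
  T (rc u) - T (rc v) = T (rc (fun x => -1 * v x + u x)).
Proof. by move=> hu hv; rewrite (T_lin M_gt0 hT)// rmorphN1 scaleN1r addrC. Qed.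

Lemma L1b_sub_n1 h e u v : rsmooth u -> rsmooth v ->
  (forall p, (n1 (fun t => u^[p] t - v^[p] t)%R <= (e * M p / h ^+ p)%:E)%E) ->
  L1b M h e (fun x => -1 * v x + u x).
Proof.
move=> su sv H p; have [_ ->] := rsmooth_lin (-1) sv su.
by rewrite (_ : (fun x => _) = (fun t => u^[p] t - v^[p] t))//; apply/funext => t; ring.
Qed.

Lemma conv_cont h0 h C N (phi : R -> R) : 0 < h0 -> h0 < h -> 0 < C -> TBound M c T h0 C ->
  EL1 M c phi -> L1b M h N phi -> continuous (Defs.conv T (rc phi)).
Proof.
move=> h00 hh C0 hC hphi hN; apply/contX => x e e0.
have e1 : 0 < e / (2 * C) by rewrite divr_gt0// mulr_gt0.
have [d d0 hd] := L1b_translate M_gt0 hphi.1 hN h00 hh e1.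
exists d => // y xy; rewrite !conv_rc.
have hx := EL1_refl x hphi; have hy := EL1_refl y hphi.
rewrite (T_sub hy hx).
have [_ dx] := rsmooth_refl x hphi.1; have [_ dy] := rsmooth_refl y hphi.1.
have : L1b M h0 (e / (2 * C)) (fun t => -1 * phi (x - t) + phi (y - t)).
  apply: L1b_sub_n1; [exact: hy.1|exact: hx.1|] => p; rewrite dx dy.
  rewrite (_ : (fun t => _) = (fun t => (-1) ^+ p * (phi^[p] (y - t) - phi^[p] (x - t)))); last by apply/funext => t; ring.
  have mphi (a : R) : measurable_fun setT (fun t : R => phi^[p] (a - t)).
    by apply: measurableT_comp; [exact: rsmooth_meas hphi.1|exact: measurable_funB].
  rewrite n1Z; last exact: measurable_funB.
  by rewrite normrX normrN1 expr1n mul1e; apply: hd; rewrite distrC.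
move=> /(hC _ (EL1_lin M_gt0 (-1) hx hy) _ e1) /le_lt_trans; apply.
have -> : C * (e / (2 * C)) = e / 2 by field; lra.
lra.
Qed.

Lemma T_corr h0 h C N r (phi psi : R -> R) : 0 < h0 -> h0 < h -> 0 < C -> TBound M c T h0 C ->
  EL1 M c phi -> L1b M h N phi -> continuous psi -> 0 < r -> csupp r psi ->
  T (rc (corr phi psi)) = vint (fun x => (psi x)%:C *: Defs.conv T (rc phi) x).
Proof.
move=> h00 hh C0 hC hphi hN cpsi r0 cs; apply/esym.
have N0 := L1b_ge0 M_gt0 hN; have hp : 0 < h by exact: lt_trans hh.
have [[B hB] ipsi] := csupp_integrable cpsi r0 cs.
have B0 : 0 <= B := le_trans (normr_ge0 _) (hB 0).
have [hU dU] := corr_EL1 hphi ipsi.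
have rr : - r <= r by lra.
have cconv := conv_cont h00 hh C0 hC hphi hN.
have van (f : R -> R) : (forall t, psi t = 0 -> f t = 0) -> forall t, t < - r \/ r < t -> f t = 0.
  by move=> hf t ht; apply: hf; apply: cs; rewrite ltr_normr; apply/orP; case: ht => ?; [right|left]; lra.
have uc e : 0 < e -> exists2 d : R, 0 < d & forall p q, `|p - q| < d -> `|psi p - psi q| <= e.
  move=> e0; apply: (@heine R (fun p q => `|psi p - psi q|) (- r) r) => //.
  - by move=> p q; rewrite distrC.
  - by move=> p q s; exact: ler_distD.
  - move=> t e' e'0; have := cpsi t; move=> /cvgrPdist_lt /(_ e' e'0) /nbhs_ballP[d /= d0 hd].
    by exists d => // s ts; rewrite distrC; exact: hd.
  - by move=> p q hp' hq; rewrite (van psi)// (van psi)// subrr normr0.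
apply: (@vint_eq _ _ _ (- r) r) => //.
- have [K0 hK0] : exists K : R, 0 < K /\ forall t, modc ((psi t)%:C) <= K.
    by exists (B + 1); split; [lra|move=> t; rewrite modcR; have := hB t; lra].
  apply: (@continuous_scale _ _ (fun t => (psi t)%:C) _ K0) => //; try by case: hK0.
  move=> e /uc[d d0 hd]; exists d => // p q /hd.
  by rewrite -rmorphB modcR.
- by move=> t ht; rewrite (van psi)// scale0r.
move=> e e0.
(* [k1] makes C * (k1 * (2 * r)) equal to e / 2. One half of it pays for the oscillation of psi
   against the norm N of phi, the other for the translation of phi against the bound B of psi. *)
pose k1 := e / (2 * C * (2 * r)).
have k10 : 0 < k1 by rewrite divr_gt0// !mulr_gt0.
have k2 : 0 < k1 / (2 * (N + 1)) by rewrite divr_gt0// mulr_gt0//; lra.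
have k3 : 0 < k1 / (2 * (B + 1)) by rewrite divr_gt0// mulr_gt0//; lra.
have [d1 d10 hd1] := uc _ k2.
have [d2 d20 hd2] := L1b_translate M_gt0 hphi.1 hN h00 hh k3.
exists (Num.min d1 d2); split; first by rewrite lt_min d10.
move=> n x s x0 xn hx; rewrite -nX_lt.
have [hS dS] := sum_refl n (fun i => (x i.+1 - x i) * psi (s i)) s hphi.
have -> : \sum_(i < n) (x i.+1 - x i)%:C *: ((psi (s i))%:C *: Defs.conv T (rc phi) (s i)) =
    T (rc (fun t => \sum_(i < n) (x i.+1 - x i) * psi (s i) * phi (s i - t))).
  elim: n {xn hx hS dS} => [|n IH].
    rewrite big_ord0 (_ : (fun t : R => _) = fun=> 0) ?(T_0 M_gt0 hT)//.
    by apply/funext => t; rewrite big_ord0.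
  rewrite big_ord_recr/= IH scalerA -rmorphM/= addrC conv_rc -(T_lin M_gt0 hT).
  - by congr (T (rc _)); apply/funext => t; rewrite big_ord_recr/= addrC.
  - exact: EL1_refl.
  - by have [] := sum_refl n (fun i => (x i.+1 - x i) * psi (s i)) s hphi.
rewrite (T_sub hS hU).
have L : L1b M h0 (k1 * (2 * r)) (fun t => -1 * corr phi psi t + \sum_(i < n) (x i.+1 - x i) * psi (s i) * phi (s i - t)).
  apply: L1b_sub_n1; [exact: hS.1|exact: hU.1|] => p; rewrite dS dU.
  have mp := rsmooth_meas p hphi.1; have cp := rsmooth_cont (p := p) hphi.1.
  have k1W := ltW k10; have h0W := ltW h00.
  have Mh : 0 <= k1 * M p / h0 ^+ p by exact: Mh_ge0.
  have key (a b : R) : `|a - b| < Num.min d1 d2 ->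
      (n1 (fun t => psi a * phi^[p] (a - t) - psi b * phi^[p] (b - t))%R <= (k1 * M p / h0 ^+ p)%:E)%E.
    rewrite lt_min => /andP[ab1 ab2].
    have mphi (a' : R) : measurable_fun setT (fun t : R => phi^[p] (a' - t)).
      by apply: measurableT_comp => //; exact: measurable_funB.
    rewrite (_ : (fun t => _) = (fun t => (psi a - psi b) * phi^[p] (a - t) + psi b * (phi^[p] (a - t) - phi^[p] (b - t)))); last by apply/funext => t; ring.
    apply: le_trans (n1D _ _) _; [exact: measurable_funM|by apply: measurable_funM => //; exact: measurable_funB|].
    rewrite !n1Z//; last exact: measurable_funB.
    rewrite n1_refl//.
    apply: (@le_trans _ _ ((k1 / (2 * (N + 1)))%:E * (N * M p / h ^+ p)%:E + B%:E * (k1 / (2 * (B + 1)) * M p / h0 ^+ p)%:E)%E).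
      apply: leeD; apply: lee_pmul => //.
      - exact: n1_ge0.
      - by rewrite lee_fin hd1.
      - exact: n1_ge0.
      - by rewrite lee_fin.
      - exact: hd2.
    rewrite -!EFinM -EFinD lee_fin.
    have e1 : M p / h ^+ p <= M p / h0 ^+ p.
      apply: ler_wpM2l; first exact/ltW/M_gt0.
      rewrite lef_pV2 ?posrE ?exprn_gt0//.
      by rewrite lerXn2r ?nnegrE ?ltW.
    have W0 : 0 <= M p / h0 ^+ p by rewrite divr_ge0 ?exprn_ge0// ltW.
    have a1 : k1 / (2 * (N + 1)) * N <= k1 / 2.
      rewrite mulrAC ler_pdivrMr; last by lra.
      have -> : k1 / 2 * (2 * (N + 1)) = k1 * N + k1 by field.
      by rewrite lerDl ltW.
    have a2 : B * (k1 / (2 * (B + 1))) <= k1 / 2.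
      rewrite mulrC mulrAC ler_pdivrMr; last by lra.
      have -> : k1 / 2 * (2 * (B + 1)) = k1 * B + k1 by field.
      by rewrite lerDl ltW.
    have -> : k1 * M p / h0 ^+ p = k1 / 2 * (M p / h0 ^+ p) + k1 / 2 * (M p / h0 ^+ p) by field; rewrite gt_eqF// exprn_gt0.
    apply: lerD.
      apply: (@le_trans _ _ (k1 / (2 * (N + 1)) * N * (M p / h0 ^+ p))); last by rewrite ler_wpM2r.
      rewrite -[leRHS]mulrA ler_wpM2l ?(ltW k2)// -mulrA ler_wpM2l//.
    apply: (@le_trans _ _ (B * (k1 / (2 * (B + 1))) * (M p / h0 ^+ p))); last by rewrite ler_wpM2r.
    by rewrite !mulrA.
  have [mD nD] := riemann_sum_n1 cp cpsi Mh key hx.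
  rewrite x0 xn in mD nD.
  rewrite (_ : (fun t => _) = (fun t => (-1) ^+ p * (\sum_(i < n) (x i.+1 - x i) * (psi (s i) * phi^[p] (s i - t)) -
     \int[mu]_(y in `[- r, r]) (psi y * phi^[p] (y - t))))).
    rewrite n1Z// normrX normrN1 expr1n mul1e; apply: le_trans nD _.
    by rewrite lee_fin le_eqVlt; apply/orP; left; apply/eqP; ring.
  apply/funext => t; rewrite -mulrBr; congr (_ * (_ - _)).
    by apply: eq_bigr => i _; rewrite mulrA.
  rewrite corrE//; last exact: continuous_measurable_fun.
  rewrite [RHS]Rintegral_mkcond; apply: eq_Rintegral => y _.
  rewrite patchE mem_setE in_itv/= -ler_norml; have [yr|/cs ->] := leP `|y| r; first by rewrite mulrC.
  by rewrite mulr0.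
have k1r : 0 < k1 * (2 * r) by apply: mulr_gt0 => //; exact: mulr_gt0.
apply: le_lt_trans (hC _ (EL1_lin M_gt0 (-1) hU hS) _ k1r L) _.
have -> : C * (k1 * (2 * r)) = e / 2 by rewrite /k1; field; apply/andP; split; lra.
lra.
Qed.
End with_functional.

End fubini.

(** * Chains of averages and bump functions *)

Section chain.
Variable R : realType.
Implicit Types (u w : R -> R) (k : nat -> R -> R).
Notation mu := (@lebesgue_measure R).

(** The truncation of v_p after n kernels, with u in the place of v_(p+n). *)
Fixpoint chain k u (p n : nat) : R -> R :=
  if n is n'.+1 then corr (k p) (chain k u p.+1 n') else u.

Definition prob_density (f : R -> R) :=
  [/\ mu.-integrable setT (EFin \o f), forall x, 0 <= f x & \int[mu]_x f x = 1].

(** Averaging against a probability density preserves both conditions, so one pair (B, L) serves all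
    the stages of a chain. *)
Definition good (B L : R) w := (forall x, 0 <= w x <= B) /\ (forall x y, `|w x - w y| <= L * `|x - y|).

Lemma prob_n1 f : prob_density f -> n1 f = 1%E.
Proof.
move=> [fi f0 f1]; have [_ ff] := n1_integrable fi.
rewrite -[n1 f]fineK; last by rewrite ge0_fin_numE// n1_ge0.
by congr EFin; rewrite -f1 /n1 /Rintegral; congr fine; apply: eq_integral => x _; rewrite ger0_norm.
Qed.

Lemma lip_cont w L : (forall x y, `|w x - w y| <= L * `|x - y|) -> continuous w.
Proof.
move=> h x; apply/cvgrPdist_lt => e e0; apply/nbhs_ballP.
have L1 : 0 < `|L| + 1 by rewrite ltr_wpDl.
exists (e / (`|L| + 1)); rewrite /= ?divr_gt0// => y /= xy; apply: le_lt_trans (h x y) _.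
apply: (@le_lt_trans _ _ ((`|L| + 1) * `|x - y|)).
  by rewrite ler_wpM2r// (le_trans (ler_norm _))// lerDl.
by rewrite mulrC -ltr_pdivlMr.
Qed.

Lemma good_meas B L w : good B L w -> measurable_fun setT w.
Proof. by move=> [_ /lip_cont]; exact: continuous_measurable_fun. Qed.

Lemma good_bound B L w : good B L w -> forall x, `|w x| <= B.
Proof. by move=> [h _] x; have /andP[h1 h2] := h x; rewrite ger0_norm. Qed.

Lemma corr_diff f w w' (B e : R) x : prob_density f ->
  measurable_fun setT w -> measurable_fun setT w' ->
  (forall y, `|w y| <= B) -> (forall y, `|w' y| <= B) ->
  (forall y, `|w y - w' y| <= e) -> `|corr f w x - corr f w' x| <= e.
Proof.
move=> pf mw mw' wB wB' H; have [fi f0 f1] := pf.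
rewrite -RintegralB//; try exact: corr_int.
have -> : \int[mu]_s (f s * w (x + s) - f s * w' (x + s)) = corr f (fun y => w y - w' y) x.
  by apply: eq_Rintegral => s _; rewrite mulrBr.
apply: le_trans (corr_le _ fi _ H) _; first exact: measurable_funB.
by rewrite prob_n1//= mulr1.
Qed.

Lemma corr_good B L f w : prob_density f -> good B L w -> good B L (corr f w).
Proof.
move=> pf gw; have [fi f0 f1] := pf; have [w0 wL] := gw.
have mw := good_meas gw; have wB := good_bound gw.
split => [x|x y].
  apply/andP; split.
    by apply: Rintegral_ge0 => s _; rewrite mulr_ge0//; have /andP[] := w0 (x + s).
  by apply: le_trans (ler_norm _) _; apply: le_trans (corr_le _ fi mw wB) _; rewrite prob_n1//= mulr1.
rewrite -RintegralB//; try by apply: corr_int wB.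
have -> : \int[mu]_s (f s * w (x + s) - f s * w (y + s)) = \int[mu]_s (f s * (w (x + s) - w (y + s))).
  by apply: eq_Rintegral => s _; rewrite mulrBr.
have := @Rint_le R f (fun s => w (x + s) - w (y + s)) (L * `|x - y|) fi.
rewrite prob_n1//= mulr1; apply.
  by apply: measurable_funB; exact: measurable_shift.
move=> s; apply: le_trans (wL _ _) _.
by rewrite (_ : x + s - (y + s) = x - y)//; ring.
Qed.

Lemma chain_good B L k u p n : (forall j, prob_density (k j)) -> good B L u -> good B L (chain k u p n).
Proof. by move=> pk gu; elim: n p => [//|n IH] p /=; exact: corr_good. Qed.

(* [v p] is the infinite average k_p (k_(p+1) (... u)). *)
Lemma chain_limit k u (a : nat -> R) (B L S : R) :
  (forall j, prob_density (k j)) -> good B L u -> 0 <= L -> (forall j, 0 <= a j) ->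
  (forall n, \sum_(i < n) a i <= S) ->
  (forall j w, good B L w -> forall x, `|corr (k j) w x - w x| <= L * a j) ->
  exists v : nat -> R -> R, exists tau : nat -> R,
  [/\ forall p, good B L (v p), forall p, v p = corr (k p) (v p.+1),
     forall p x, (fun n => chain k u p n x) @ \oo --> v p x,
     forall p x, `|v p x - u x| <= L * tau p &
     [/\ tau @ \oo --> (0 : R), forall p, tau p <= S & forall p, 0 <= tau p]].
Proof.
move=> pk gu L0 a0 aS ka.
pose A n := \sum_(i < n) a i.
have AS n : A n.+1 = A n + a n by rewrite /A big_ord_recr.
have ndA : nondecreasing_seq A by apply/nondecreasing_seqP => n; rewrite AS lerDl.
have cA : cvgn A.
  by apply: nondecreasing_is_cvgn => //; exists S => _ [n _ <-]; exact: aS.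
pose Al := limn A.
have AAl n : A n <= Al by exact: nondecreasing_cvgn_le.
have AlS : Al <= S.
  by apply: (cvgr_to_le cA); near=> n; exact: aS.
(* One more kernel is inserted innermost, next to u, at a cost of L * a (p + n); the outer averages
   do not increase it. *)
have step n p x : `|chain k u p n.+1 x - chain k u p n x| <= L * a (p + n)%N.
  elim: n p x => [|n IH] p x; first by rewrite addn0; exact: ka.
  rewrite [chain _ _ _ n.+2]/= [chain _ _ _ n.+1]/=.
  have g1 := chain_good p.+1 n.+1 pk gu; have g2 := chain_good p.+1 n pk gu.
  apply: (corr_diff x (pk p) (good_meas g1) (good_meas g2) (good_bound g1) (good_bound g2)) => y.
  by have := IH p.+1 y; rewrite addSnnS.
have cauchy n m p x : (n <= m)%N -> `|chain k u p m x - chain k u p n x| <= L * (A (p + m)%N - A (p + n)%N).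
  elim: m => [|m IH]; first by rewrite leqn0 => /eqP ->; rewrite !subrr normr0 mulr0.
  rewrite leq_eqVlt => /predU1P[->|nm]; first by rewrite !subrr normr0 mulr0.
  have := step m p x; have := IH nm; have := ler_normD (chain k u p m.+1 x - chain k u p m x) (chain k u p m x - chain k u p n x).
  rewrite addrA subrK addnS AS.
  have -> : L * (A (p + m)%N + a (p + m)%N - A (p + n)%N) = L * a (p + m)%N + L * (A (p + m)%N - A (p + n)%N) by ring.
  by move=> h1 h2 h3; apply: (le_trans h1); exact: lerD.
pose tau p := Al - A p.
have tau0 p : 0 <= tau p by rewrite subr_ge0.
have ctau : tau @ \oo --> (0 : R).
  by rewrite -(subrr Al); apply: cvgB; [exact: cvg_cst|exact: cA].
have ltau e : 0 < e -> exists N, forall n, (N <= n)%N -> L * tau n < e.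
  move=> e0; have : (fun n => L * tau n) @ \oo --> (0 : R).
    by rewrite -[X in _ --> X](mulr0 L); apply: cvgM => //; exact: cvg_cst.
  move=> /cvgrPdist_lt /(_ e e0)[N _ hN]; exists N => n /hN.
  by rewrite /= sub0r normrN ger0_norm// mulr_ge0.
have /choice[v0 hv0] : forall px : nat * R, exists l : R, (fun n => chain k u px.1 n px.2) @ \oo --> l.
  move=> [p x] /=; apply/cvg_ex.
  (* Adding L * A (p + n) makes the sequence nondecreasing, by [step], and it stays bounded; so it
     converges. *)
  pose b n := chain k u p n x + L * A (p + n)%N.
  have cb : cvgn b.
    apply: nondecreasing_is_cvgn.
      apply/nondecreasing_seqP => n; rewrite /b addnS AS mulrDr.
      by have := step n p x; rewrite ler_norml => /andP[h1 _]; lra.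
    exists (B + L * S) => _ [n _ <-]; rewrite /b; apply: lerD.
      by have [/(_ x)/andP[]] := chain_good p n pk gu.
    by rewrite ler_wpM2l// aS.
  have -> : (fun n => chain k u p n x) = (fun n => b n - L * A (n + p)%N).
    by apply/funext => n; rewrite /b addnC addrK.
  apply: is_cvgB => //; apply: is_cvgM; first exact: is_cvg_cst.
  by apply/cvg_ex; exists Al; rewrite (cvg_shiftn p A).
pose v p x := v0 (p, x).
have hv p x : (fun n => chain k u p n x) @ \oo --> v p x by exact: (hv0 (p, x)).
have vw p x n : `|v p x - chain k u p n x| <= L * tau (p + n)%N.
  have h1 : (fun m => `|chain k u p m x - chain k u p n x|) @ \oo --> `|v p x - chain k u p n x|.
    by apply: cvg_norm; apply: cvgB; [exact: hv|exact: cvg_cst].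
  apply: (cvgr_to_le h1); near=> m.
  have nm : (n <= m)%N by near: m; exact: nbhs_infty_ge.
  by apply: le_trans (cauchy _ _ _ _ nm) _; rewrite ler_wpM2l// lerD2r.
have gv p : good B L (v p).
  split => [x|x y].
    apply/andP; split.
      apply: (cvgr_to_ge (hv p x)); near=> n.
      by have [/(_ x)/andP[]] := chain_good p n pk gu.
    apply: (cvgr_to_le (hv p x)); near=> n.
    by have [/(_ x)/andP[]] := chain_good p n pk gu.
  have h1 : (fun n => `|chain k u p n x - chain k u p n y|) @ \oo --> `|v p x - v p y|.
    by apply: cvg_norm; apply: cvgB; exact: hv.
  apply: (cvgr_to_le h1); near=> n.
  by have [_ /(_ x y)] := chain_good p n pk gu.
exists v, tau; split => //.
- move=> p; apply/funext => x; apply/eqP; rewrite -subr_eq0 -normr_le0.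
  apply/ler_addgt0Pr => e e0; rewrite add0r.
  have [N hN] := ltau (e / 2) ltac:(lra).
  have h1 := vw p x N.+1.
  have g2 := chain_good p.+1 N pk gu.
  have h2 := corr_diff x (pk p) (good_meas g2) (good_meas (gv p.+1)) (good_bound g2) (good_bound (gv p.+1))
     (fun y => ltac:(rewrite distrC; exact: (vw p.+1 y N))).
  have h3 := hN (p.+1 + N)%N (leq_addl _ _).
  rewrite addnS -addSn in h1.
  have := ler_normD (v p x - chain k u p N.+1 x) (chain k u p N.+1 x - corr (k p) (v p.+1) x).
  rewrite addrA subrK => /le_trans; apply.
  rewrite /= in h1 h2 *; lra.
- by move=> p x; have := vw p x 0%N; rewrite addn0.
- split => // p; rewrite /tau; have : 0 <= A p by rewrite sumr_ge0.
  lra.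
Unshelve. all: by end_near. Qed.

End chain.

(** * Derivatives along a chain *)

Section chain_derivatives.
Variable R : realType.
Notation mu := (@lebesgue_measure R).
Variables (v : nat -> R -> R) (d a : nat -> R) (e : nat).
(** One relation for both constructions: box kernels give e = 1, d_p = 1 / a_p with a_p the width;
    exponential kernels give e = 0, a_p = 0 and d_p plus or minus the rate. *)
Hypothesis dv : forall p (x : R), is_derive x 1 (v p) (d p * (v p.+1 (x + a p) - v (p + e)%N x)).

Fixpoint chain_der (q p : nat) (x : R) : R :=
  if q is q'.+1 then d p * (chain_der q' p.+1 (x + a p) - chain_der q' (p + e)%N x) else v p x.

Lemma chain_der_is_derive q p (x : R) : is_derive x 1 (chain_der q p) (chain_der q.+1 p x).
Proof.
elim: q p x => [|q IH] p x; first exact: dv.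
have d1 : is_derive x 1 (fun y => chain_der q p.+1 (y + a p)) (chain_der q.+1 p.+1 (x + a p)).
  by have h := IH p.+1 (x + a p); apply: is_derive_eq; rewrite addr0 mulr1.
have d2 := IH (p + e)%N x.
have d3 : is_derive x 1 (fun y => chain_der q p.+1 (y + a p) - chain_der q (p + e)%N y)
   (chain_der q.+1 p.+1 (x + a p) - chain_der q.+1 (p + e)%N x) by exact: is_deriveB.
exact: (@is_deriveZ _ _ _ _ (d p) _ _ _ d3).
Qed.

Lemma chain_smooth p : rsmooth (v p) /\ forall q, (v p)^[q] = chain_der q p.
Proof. exact: (@derive_seq _ (fun q => chain_der q p) (fun q x => chain_der_is_derive q p x)). Qed.

(** With e = 1 both branches move from p to p + 1, so each derivative contributes a factor 2 * |d|
    and each index is used once. *)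
Lemma chain_der_sup B : e = 1%N -> (forall p x, `|v p x| <= B) ->
  forall q p x, `|chain_der q p x| <= B * \prod_(i < q) (2 * `|d (p + i)%N|).
Proof.
move=> e1 vB; elim=> [|q IH] p x; first by rewrite big_ord0 mulr1.
rewrite /= normrM big_ord_recl/= addn0.
have h1 := IH p.+1 (x + a p); have h2 := IH p.+1 x; rewrite e1 addn1.
have h3 := ler_normB (chain_der q p.+1 (x + a p)) (chain_der q p.+1 x).
set P := \prod_(i < q) _ in h1 h2.
have -> : \prod_(i < q) (2 * `|d (p + bump 0 i)%N|) = P by apply: eq_bigr => i _; rewrite addSnnS.
have -> : B * (2 * `|d p| * P) = `|d p| * (2 * (B * P)) by ring.
rewrite ler_wpM2l//; lra.
Qed.

(** With e = 0 one branch stays at p, and its product starts one index lower than that of the other;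
    monotonicity of |d| bounds both by the product starting at p + 1. *)
Lemma chain_der_n1 (B : R) : e = 0%N -> (forall p, (n1 (v p) <= B%:E)%E) -> 0 <= B ->
  (forall p, `|d p| <= `|d p.+1|) ->
  forall q p, (n1 (chain_der q p) <= (B * \prod_(i < q) (2 * `|d (p + i)%N|))%:E)%E.
Proof.
move=> e0 vB B0 dd; elim=> [|q IH] p; first by rewrite big_ord0 mulr1.
have m q' p' : measurable_fun setT (chain_der q' p').
  apply: continuous_measurable_fun; apply: is_derive_cont => x; exact: chain_der_is_derive.
have ms : measurable_fun setT (fun x : R => chain_der q p.+1 (x + a p)).
  by apply: measurableT_comp => //; exact: measurable_funD.
rewrite [chain_der q.+1 p]/= n1Z; last exact: measurable_funB.
have := n1B ms (m q (p + e)%N); rewrite n1_shift// e0 addn0 => h.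
have h1 := IH p.+1; have h2 := IH p.
rewrite big_ord_recl/= addn0.
have -> : \prod_(i < q) (2 * `|d (p + bump 0 i)%N|) = \prod_(i < q) (2 * `|d (p.+1 + i)%N|).
  by apply: eq_bigr => i _; rewrite addSnnS.
set P := \prod_(i < q) (2 * `|d (p.+1 + i)%N|) in h1 *.
have h3 : \prod_(i < q) (2 * `|d (p + i)%N|) <= P.
  by apply: ler_prod => i _; rewrite mulr_ge0//= ler_wpM2l// addSn.
apply: (@le_trans _ _ ((`|d p|)%:E * (B * P + B * P)%:E)%E).
  apply: lee_wpmul2l; first by rewrite lee_fin.
  apply: le_trans h _; rewrite EFinD; apply: leeD => //; apply: le_trans h2 _.
  by rewrite lee_fin ler_wpM2l.
by rewrite -EFinM lee_fin le_eqVlt; apply/orP; left; apply/eqP; ring.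
Qed.

End chain_derivatives.

Section box.
Variable R : realType.
Notation mu := (@lebesgue_measure R).
Implicit Types (w : R -> R) (a : R).

Definition box a : R -> R := fun s => a^-1 * \1_(`[0, a]) s.

Lemma box_prob a : 0 < a -> prob_density (box a).
Proof.
move=> a0; have ii := integrable_indic_itv (ltW a0).
split.
- exact: integrable_scale.
- by move=> x; rewrite /box indicE mulr_ge0// invr_ge0 ltW.
- rewrite /box RintegralZl//.
  have -> : \int[mu]_x (\1_(`[0, a]) x : R) = a.
    rewrite -[RHS](subr0 a); have := n1_indic (ltW a0); rewrite /n1 /Rintegral => h.
    rewrite -[RHS]/(fine (a - 0)%:E) -h; congr fine; apply: eq_integral => x _.
    by rewrite ger0_norm// indicE.
  by rewrite mulVf// gt_eqF.
Qed.

Lemma corr_box a w t : measurable_fun setT w -> (exists B : R, forall x, `|w x| <= B) -> 0 < a ->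
  corr (box a) w t = a^-1 * corr \1_(`[0, a]) w t.
Proof.
move=> mw [B wB] a0; rewrite /corr -RintegralZl//.
  by apply: eq_Rintegral => s _; rewrite /box mulrA.
exact: (corr_int t (integrable_indic_itv (ltW a0)) mw wB).
Qed.

Lemma antiderivative_ray w (x : R) : continuous w ->
  (forall b : R, mu.-integrable `]-oo, b] (EFin \o w)) ->
  is_derive x 1 (fun y => \int[mu]_(t in `]-oo, y]) w t) (w x).
Proof.
move=> cw iw; have xx : x < x + 1 by rewrite ltrDl.
have [H1 H2] := @continuous_FTC1 R w -oo%O x (x + 1) xx (iw _) (ltNyr _) (cw x).
by apply: DeriveDef; [exact: H1|rewrite -derive1E; exact: H2].
Qed.

Lemma is_derive_box a w (x : R) : 0 < a -> continuous w -> mu.-integrable setT (EFin \o w) ->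
  (exists B : R, forall x, `|w x| <= B) ->
  is_derive x 1 (corr (box a) w) (a^-1 * (w (x + a) - w x)).
Proof.
move=> a0 cw iw hB; have mw := continuous_measurable_fun cw.
have dW y := antiderivative_ray y cw (fun b => @integrableS _ _ _ mu setT _ _ measurableT (measurable_itv _) (@subsetT _ _) iw).
set W := fun y => _ in dW.
have -> : corr (box a) w = fun t => a^-1 * (W (t + a) - W t).
  by apply/funext => t; rewrite corr_box// (ftc_indic _ (ltW a0) dW cw).
have d1 : is_derive x 1 (fun t => W (t + a)) (w (x + a)).
  by have h := dW (x + a); apply: is_derive_eq; rewrite addr0 mulr1.
have d3 : is_derive x 1 (fun y => W (y + a) - W y) (w (x + a) - w x) by exact: is_deriveB.
exact: (@is_deriveZ _ _ _ _ (a^-1) _ _ _ d3).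
Qed.

Lemma box_close B L a w x : 0 < a -> 0 <= L -> good B L w -> `|corr (box a) w x - w x| <= L * a.
Proof.
move=> a0 L0 gw; have pb := box_prob a0; have [fi f0 f1] := pb; have [w0 wL] := gw.
have mw := good_meas gw; have wB := good_bound gw.
have -> : corr (box a) w x - w x = \int[mu]_s (box a s * (\1_(`[0, a]) s * (w (x + s) - w x))).
  rewrite -[X in _ - X]mul1r -{1}f1 -RintegralZr// -RintegralB//.
  - apply: eq_Rintegral => s _; rewrite /box indicE; case: (s \in _) => /=; ring.
  - exact: (corr_int x fi mw wB).
  - rewrite (_ : _ \o _ = EFin \o (fun s => w x * box a s)); last by apply/funext => s /=; rewrite mulrC.
    exact: integrable_scale.
have := @Rint_le R (box a) (fun s => \1_(`[0, a]) s * (w (x + s) - w x)) (L * a) fi.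
rewrite prob_n1//= mulr1; apply.
  apply: measurable_funM; first exact: measurable_indic.
  by apply: measurable_funB => //; exact: measurable_shift.
move=> s; rewrite indicE mem_setE in_itv/=; case: andP => [[s0 sa]|_]; last first.
  by rewrite mul0r normr0 mulr_ge0// ltW.
rewrite mul1r; apply: le_trans (wL _ _) _.
have -> : x + s - x = s by ring.
by rewrite ger0_norm// ler_wpM2l.
Qed.

Lemma box_supp a w r : 0 < a -> measurable_fun setT w -> (exists B : R, forall x, `|w x| <= B) ->
  csupp r w -> csupp (r + a) (corr (box a) w).
Proof.
move=> a0 mw wB cs t ht; rewrite corr_box// corr_indic.
rewrite (_ : \int[mu]_(s in `[0, a]) w (t + s) = \int[mu]_(s in `[0, a]) 0).
  by rewrite Rintegral_cst// mul0r mulr0.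
apply: eq_Rintegral => s; rewrite mem_setE in_itv/= => /andP[s0 sa]; apply: cs.
have := ler_normB (t + s) s; rewrite addrK (ger0_norm s0); lra.
Qed.
End box.

(** * Bump functions of the Beurling class *)

Section bumps.
Variables (R : realType) (M : nat -> R).
Hypothesis M_gt0 : forall p, 0 < M p.
Implicit Types (u w : R -> R) (h N r : R).
Notation mu := (@lebesgue_measure R).

Lemma M3'_sum : cond_M3' M -> exists S, forall n, \sum_(j < n) M j / M j.+1 <= S.
Proof.
rewrite /cond_M3' => h.
have f0 p : (0 <= (M p.-1 / M p)%:E)%E by rewrite lee_fin divr_ge0 ?ltW.
exists (fine (\sum_(1 <= p <oo) (M p.-1 / M p)%:E)%E) => n.
have f1 : (0 <= \sum_(1 <= p <oo) (M p.-1 / M p)%:E)%E by apply: nneseries_ge0 => p _ _.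
have : (\sum_(1 <= p < n.+1) (M p.-1 / M p)%:E <= \sum_(1 <= p <oo) (M p.-1 / M p)%:E)%E.
  by apply: nneseries_lim_ge => p _ _.
rewrite -[X in (_ <= X)%E -> _]fineK; last by rewrite ge0_fin_numE.
rewrite big_add1/= big_mkord sumEFin lee_fin; exact.
Qed.

(* With t_j the tails of sum q_j, the weights b_j = q_j / sqrt t_j are summable
   by telescoping, and b_j / q_j tends to infinity. *)
Lemma slow_weights (q : nat -> R) S : (forall j, 0 < q j) -> (forall n, \sum_(j < n) q j <= S) ->
  exists b : nat -> R, exists S', [/\ forall j, 0 < b j, forall n, \sum_(j < n) b j <= S' &
    forall K, exists J, forall j, (J <= j)%N -> K * q j <= b j].
Proof.
move=> q0 qS; pose A n := \sum_(j < n) q j.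
have AS n : A n.+1 = A n + q n by rewrite /A big_ord_recr.
have ndA : nondecreasing_seq A by apply/nondecreasing_seqP => n; rewrite AS lerDl ltW.
have cA : cvgn A.
  by apply: nondecreasing_is_cvgn => //; exists S => _ [n _ <-]; exact: qS.
pose Al := limn A; pose t j := Al - A j.
have t0 j : 0 < t j.
  rewrite subr_gt0; apply: (@lt_le_trans _ _ (A j.+1)); first by rewrite AS ltrDl.
  exact: nondecreasing_cvgn_le.
have tS j : t j - t j.+1 = q j by rewrite /t AS; ring.
have s0 j : 0 < Num.sqrt (t j) by rewrite sqrtr_gt0.
have sq j : Num.sqrt (t j) ^+ 2 = t j by rewrite sqr_sqrtr// ltW.
exists (fun j => q j / Num.sqrt (t j)), (2 * Num.sqrt (t 0%N)); split.
- by move=> j; rewrite divr_gt0.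
- move=> n; suff : \sum_(j < n) q j / Num.sqrt (t j) <= 2 * (Num.sqrt (t 0%N) - Num.sqrt (t n)).
    by move=> h; apply: (le_trans h); rewrite ler_wpM2l// lerBlDr lerDl ltW.
  elim: n => [|n IH]; first by rewrite big_ord0 subrr mulr0.
  (* q n is a difference of squares of square roots, (sqrt t_n - sqrt t_(n+1)) (sqrt t_n + sqrt
     t_(n+1)), and the second factor is at most 2 sqrt t_n. *)
  rewrite big_ord_recr/=; have h : q n / Num.sqrt (t n) <= 2 * (Num.sqrt (t n) - Num.sqrt (t n.+1)).
    have -> : q n = Num.sqrt (t n) ^+ 2 - Num.sqrt (t n.+1) ^+ 2 by rewrite !sq tS.
    rewrite ler_pdivrMr// subr_sqr.
    have : Num.sqrt (t n.+1) <= Num.sqrt (t n).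
      by rewrite ler_wsqrtr// -subr_ge0 tS ltW.
    by have := s0 n; have := s0 n.+1; nra.
  lra.
- move=> K; pose K' := `|K| + 1; have K0 : 0 < K' by rewrite ltr_wpDl.
  have : (fun j => t j) @ \oo --> (0 : R).
    by rewrite -(subrr Al); apply: cvgB; [exact: cvg_cst|exact: cA].
  have K2 : 0 < (K' ^+ 2)^-1 by rewrite invr_gt0 exprn_gt0.
  move=> /cvgrPdist_lt /(_ _ K2)[J _ hJ]; exists J => j /hJ.
  rewrite /= sub0r normrN gtr0_norm// => tj.
  rewrite ler_pdivlMr// mulrAC -[leRHS]mul1r ler_wpM2r ?(ltW (q0 j))//.
  apply: (@le_trans _ _ (K' * Num.sqrt (t j))).
    by rewrite ler_wpM2r ?(ltW (s0 j))// (le_trans (ler_norm _))// lerDl.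
  have : Num.sqrt (t j) < K'^-1.
    have -> : K'^-1 = Num.sqrt ((K' ^+ 2)^-1).
      by rewrite -exprVn sqrtr_sqr gtr0_norm// invr_gt0.
    by rewrite ltr_sqrt.
  by rewrite -(ltr_pM2l K0) divff ?gt_eqF// => /ltW.
Qed.

Lemma prod_bounded (c : nat -> R) : (forall j, 0 <= c j) -> (exists J, forall j, (J <= j)%N -> c j <= 1) ->
  exists C, 0 < C /\ forall p, \prod_(j < p) c j <= C.
Proof.
(* [P] multiplies only the factors above 1, so it dominates the partial products up to J; later
   factors no longer increase the product. *)
move=> c0 [J hJ]; pose P := fix P n := if n is n'.+1 then P n' * Num.max 1 (c n') else 1 : R.
have P1 n : 1 <= P n.
  by elim: n => // n IH /=; apply: mulr_ege1 => //; rewrite le_max lexx.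
exists (P J); split; first by apply: lt_le_trans (P1 J).
move=> p.
have h n : \prod_(j < n) c j <= P n.
  elim: n => [|n IH]; first by rewrite big_ord0.
  rewrite big_ord_recr/=; apply: ler_pM => //; first by rewrite prodr_ge0.
  by rewrite le_max lexx orbT.
have [pJ|Jp] := leqP p J.
  apply: (le_trans (h p)); elim: J pJ {hJ} => [|J IH]; first by rewrite leqn0 => /eqP ->.
  rewrite leq_eqVlt => /predU1P[->//|]; rewrite ltnS => /IH h1; apply: (le_trans h1) => /=.
  rewrite -[leLHS]mulr1; apply: ler_pM => //; first by apply: le_trans (P1 J).
  by rewrite le_max lexx.
elim: p Jp => // p IH; rewrite ltnS leq_eqVlt => /predU1P[<-|Jp].
  rewrite big_ord_recr/= -[leRHS]mulr1; apply: ler_pM => //; first by rewrite prodr_ge0.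
    exact: h.
  exact: hJ.
rewrite big_ord_recr/= -[leRHS]mulr1; apply: ler_pM => //; first by rewrite prodr_ge0.
  exact: IH.
by apply: hJ; exact: ltnW.
Qed.

Lemma prodM p : M 0%N = 1 -> \prod_(j < p) (M j.+1 / M j) = M p.
Proof.
move=> M0; elim: p => [|p IH]; first by rewrite big_ord0 M0.
by rewrite big_ord_recr/= IH mulrCA divff ?mulr1// gt_eqF.
Qed.

(** Boxes of widths a_j are applied to a tent. Summable widths keep the support in [-eps, eps], and
    the q-th derivative is at most e times the product of the 2 / a_j. In the Beurling class this
    has to be O(M_q / h^q) for every h, so a_j must outgrow each multiple of M_j / M_(j+1): this is
    what [slow_weights] provides. *)
Lemma ultra_bump (eps : R) : M 0%N = 1 -> cond_M3' M -> 0 < eps ->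
  exists rho : R -> R, [/\ ET M Beurling rho, csupp eps rho & prob_density rho].
Proof.
move=> M0 hM3 eps0; have [S hS] := M3'_sum hM3.
have q0 j : 0 < M j / M j.+1 by rewrite divr_gt0.
have [b [S' [b0 bS bK]]] := slow_weights q0 hS.
have S'0 : 0 <= S' by have := bS 0%N; rewrite big_ord0.
have [e [e0 eE]] : exists e : R, 0 < e /\ e + e = eps.
  by exists (eps / 2); split; [rewrite divr_gt0|field].
(* This scale gives the widths a total of at most e / 2, so that tent and boxes together have radius
   below e + e = eps. *)
pose de := e / (2 * (S' + 1)).
have de0 : 0 < de by rewrite divr_gt0// mulr_gt0//; lra.
pose a j := de * b j.
have a0 j : 0 < a j by rewrite mulr_gt0.
have aS n : \sum_(i < n) a i <= e / 2.
  rewrite -mulr_sumr; apply: (@le_trans _ _ (de * S')); first by rewrite ler_wpM2l// ltW.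
  rewrite /de mulrAC ler_pdivrMr; last by lra.
  have -> : e / 2 * (2 * (S' + 1)) = e * S' + e by field.
  by rewrite lerDl ltW.
pose u (x : R) := Num.max 0 (e - `|x|).
have gu : good e 1 u.
  split => [x|x y].
    by rewrite /u le_max lexx/= ge_max (ltW e0)/= lerBlDr lerDl.
  rewrite mul1r /u /Num.max; have := ler_dist_dist x y; rewrite !ler_norml => /andP[h1 h2].
  by apply/andP; split; case: ltP => ?; case: ltP => ?; lra.
have pk j : prob_density (box (a j)) by exact: box_prob.
have [v [tau [gv vE cv vu [ctau tauS tau0]]]] := chain_limit pk gu ler01 (fun j => ltW (a0 j)) aS
  (fun j w gw x => box_close x (a0 j) ler01 gw).
have Bex w : good e 1 w -> exists B : R, forall x, `|w x| <= B.
  by move=> gw; exists e; exact: good_bound gw.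
have supp_chain n p : csupp (e + \sum_(i < n) a (p + i)%N) (chain (fun j => box (a j)) u p n).
  elim: n p => [|n IH] p /=.
    by rewrite big_ord0 addr0 => t ht; rewrite /u max_l// subr_le0 ltW.
  rewrite big_ord_recl/= addn0 [X in e + X]addrC addrA; apply: box_supp.
  - exact: a0.
  - exact: (good_meas (chain_good _ _ pk gu)).
  - exact/Bex/(chain_good _ _ pk gu).
  - have := IH p.+1; congr (csupp (e + _) _).
    by apply: eq_bigr => i _; rewrite /= addSnnS.
have sv p : csupp eps (v p).
  move=> t ht; have hn n : chain (fun j => box (a j)) u p n t = 0.
    apply: supp_chain; apply: le_lt_trans ht; rewrite -eE lerD2l.
    apply: (@le_trans _ _ (e / 2)); last by lra.
    apply: le_trans (aS (p + n)%N); rewrite big_split_ord/= lerDr.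
    by apply: sumr_ge0 => i _; exact: ltW.
  apply/eqP; rewrite -normr_le0; apply: (cvgr_to_le (cvg_norm (cv p t))).
  by near=> n; rewrite hn normr0.
have dv p (x : R) : is_derive x 1 (v p) ((a p)^-1 * (v p.+1 (x + a p) - v (p + 1)%N x)).
  rewrite vE addn1; have cvp := lip_cont (gv p.+1).2.
  have [hB iv] := csupp_integrable cvp eps0 (sv p.+1).
  exact: is_derive_box.
have [sv0 dv0] := chain_smooth dv 0%N.
have bv0 q x := @chain_der_sup R v (fun p => (a p)^-1) a 1%N e (erefl 1%N) (fun p x => good_bound (gv p) x) q 0%N x.
have Ev : ET M Beurling (v 0%N).
  split => //; first by exists eps; split => //; exact: sv.
  move=> h h0; pose c j := 2 * h * (M j / M j.+1) / a j.
  have c0 j : 0 <= c j.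
    apply: divr_ge0; last exact/ltW/a0; apply: mulr_ge0; last exact/ltW/q0.
    by rewrite mulr_ge0// ltW.
  (* The factors 2 h (M_j / M_(j+1)) / a_j are eventually at most 1, by the growth property of b. *)
  have [|C [C0 hC]] := prod_bounded c0.
    have [J hJ] := bK (2 * h / de); exists J => j /hJ h1.
    rewrite /c ler_pdivrMr// mul1r.
    have -> : 2 * h * (M j / M j.+1) = de * (2 * h / de * (M j / M j.+1)).
      by field; rewrite !gt_eqF.
    by rewrite ler_wpM2l// ltW.
  exists (e * C); split; first by rewrite mulr_gt0.
  move=> q x; rewrite dv0; apply: (le_trans (bv0 q x)).
  have -> : e * C * M q / h ^+ q = e * (C * (M q / h ^+ q)) by rewrite !mulrA.
  apply: ler_wpM2l; first exact: ltW.
  have -> : \prod_(i < q) (2 * `|(a (0 + i)%N)^-1|) = (\prod_(i < q) c i) * (M q / h ^+ q).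
    rewrite -(prodM q M0) -[in RHS](card_ord q) -prodr_const card_ord -prodf_div -big_split/=.
    apply: eq_bigr => i _; rewrite add0n gtr0_norm ?invr_gt0// /c; field.
    by rewrite !gt_eqF.
  by rewrite ler_wpM2r// divr_ge0 ?exprn_ge0 ?ltW.
have mv := good_meas (gv 0%N).
have [_ iv] := csupp_integrable (lip_cont (gv 0%N).2) eps0 (sv 0%N).
have [_ fv] := n1_integrable iv.
pose I := fine (n1 (v 0%N)).
have I0 : 0 < I.
  (* At 0 the tent equals e and the chain moves it by at most e / 2. Being 1-Lipschitz, v_0 is then
     at least e / 4 on [-e/4, e/4], so that it can be normalized. *)
  have v00 : e / 2 <= v 0%N 0.
    have := vu 0%N 0; rewrite mul1r /u normr0 subr0 max_r ?(ltW e0)//.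
    by rewrite ler_norml => /andP[h1 _]; have := tauS 0%N; lra.
  have ee : - (e / 4) <= e / 4 by lra.
  have mI : measurable_fun setT (\1_(`[(- (e / 4)), (e / 4)]) : R -> R) by exact: measurable_indic.
  have : (n1 (fun s => (e / 4) * (\1_(`[(- (e / 4)), (e / 4)]) s : R))%R <= n1 (v 0%N))%E.
    apply: le_n1 => //; first exact: measurable_funM.
    move=> s; rewrite indicE mem_setE in_itv/=; case: andP => [[s1 s2]|_]; last by rewrite mulr0 normr0.
    rewrite mulr1 gtr0_norm; last by lra.
    have [_ /(_ 0 s)] := gv 0%N; rewrite mul1r sub0r normrN => h1.
    have h2 : `|s| <= e / 4 by rewrite ler_norml s1.
    move: h1; rewrite ler_norml => /andP[h1 h3].
    by apply: le_trans (ler_norm _); lra.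
  rewrite n1Z// n1_indic// -[n1 (v 0%N)]fineK; last by rewrite ge0_fin_numE// n1_ge0.
  rewrite -EFinM lee_fin -/I; apply: lt_le_trans; rewrite gtr0_norm; last by lra.
  by rewrite mulr_gt0//; lra.
exists (fun x => I^-1 * v 0%N x + 0); split.
- by apply: (ET_lin M_gt0) => //; exact: ET_0.
- by move=> t /(sv 0%N) ->; rewrite mulr0 addr0.
- under eq_fun do rewrite addr0.
  split; first exact: integrable_scale.
    by move=> x; rewrite mulr_ge0 ?invr_ge0 ?(ltW I0)//; have [/(_ x)/andP[]] := gv 0%N.
  rewrite RintegralZl//.
  have -> : \int[mu]_x v 0%N x = I.
    by congr fine; apply: eq_integral => x _; rewrite ger0_norm//; have [/(_ x)/andP[]] := gv 0%N.
  by rewrite mulVf// gt_eqF.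
Unshelve. all: by end_near. Qed.
End bumps.

(** * Density of the test functions *)

Section density.
Variables (R : realType) (M : nat -> R).
Hypothesis M_gt0 : forall p, 0 < M p.
Implicit Types (u v phi psi : R -> R) (h N r : R) (c : ultra_class).
Notation mu := (@lebesgue_measure R).

Lemma L1b_bounded h N u p : rsmooth u -> L1b M h N u -> exists B : R, forall x, `|u^[p] x| <= B.
Proof.
move=> su hN; exists (fine (n1 u^[p]) + fine (n1 u^[p.+1])).
apply: n1_bounded.
- by move=> x; exact: rsmooth_is_derive.
- exact: rsmooth_cont.
- exact: L1b_finite hN.
- exact: L1b_finite hN.
Qed.

Lemma n1_tail phi (e : R) : mu.-integrable setT (EFin \o phi) -> 0 < e ->
  exists n : nat, (n1 (fun x => phi x - \1_(`[- n%:R, n%:R]) x * phi x)%R <= e%:E)%E.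
Proof.
move=> iphi e0; have [mphi fphi] := n1_integrable iphi.
have mI (n : nat) : measurable_fun setT (fun x : R => phi x - \1_(`[- n%:R, n%:R]) x * phi x).
  by apply: measurable_funB => //; apply: measurable_funM => //; exact: measurable_indic.
have bI (n : nat) x : `|phi x - \1_(`[- n%:R, n%:R]) x * phi x| <= `|phi x|.
  by rewrite indicE; case: (x \in _) => /=; rewrite ?mul1r ?subrr ?normr0// mul0r subr0.
pose f (n : nat) x : \bar R := (`|phi x - \1_(`[- n%:R, n%:R]) x * phi x|)%:E.
have [_ _] : [/\ mu.-integrable setT (fun=> 0%E : \bar R),
   (fun n => \int[mu]_x `|f n x - 0|)%E @ \oo --> 0%E &
   (fun n => \int[mu]_x f n x)%E @ \oo --> (\int[mu]_x 0)%E].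
  apply: (@dominated_convergence _ _ _ mu _ measurableT f (fun=> 0%E) (fun x => (`|phi x|)%:E)).
  - by move=> n; exact: measurable_norm.
  - exact: measurable_cst.
  - apply: aeW => x _; apply: cvg_near_cst.
    have [n hn] : exists n : nat, `|x| <= n%:R.
      by exists (Num.truncn `|x|).+1; exact/ltW/truncnS_gt.
    exists n => // m /= nm; rewrite /f indicE mem_set ?mul1r ?subrr ?normr0//=.
    rewrite in_itv/= -ler_norml; apply: le_trans hn _.
    by rewrite ler_nat.
  - by apply: integrable_abs.
  - by apply: aeW => x n _; rewrite /f gee0_abs ?lee_fin.
rewrite integral0 => H.
have /fine_cvgP[h1 /cvgrPdist_le/(_ _ e0) h2] := H.
near \oo => n; exists n.
have fn : (n1 (fun x => phi x - \1_(`[- n%:R, n%:R]) x * phi x)%R \is a fin_num).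
  by near: n; exact: h1.
have : `|0 - fine (n1 (fun x => phi x - \1_(`[- n%:R, n%:R]) x * phi x)%R)| <= e by near: n; exact: h2.
rewrite sub0r normrN ger0_norm ?fine_ge0 ?n1_ge0// => hn.
by rewrite -(fineK fn) lee_fin.
Unshelve. all: by end_near.
Qed.

(** The error is the average, with weight rho, of the differences between translates of phi^(p) and
    phi^(p); Minkowski's inequality turns [L1b_translate] into a bound for all p at once. *)
Lemma mollify_close h0 h N (e : R) phi : rsmooth phi -> L1b M h N phi -> 0 < h0 -> h0 < h -> 0 < e ->
  exists2 d : R, 0 < d & forall rho, prob_density rho -> csupp d rho ->
    forall p, (n1 (fun t => (corr rho phi^[p] t - phi^[p] t)%R) <= (e * M p / h0 ^+ p)%:E)%E.
Proof.
move=> su hN h00 hh e0; have [d d0 hd] := L1b_translate M_gt0 su hN h00 hh e0.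
(* Halved because [csupp] leaves |s| <= d / 2 possible, while the translation estimate wants a
   strict |s| < d. *)
exists (d / 2); first by rewrite divr_gt0.
move=> rho prho cs p; have [fi f0 f1] := prho; have [mrho _] := n1_integrable fi.
have mp := rsmooth_meas p su; have [B hB] := L1b_bounded p su hN.
have k0 : 0 <= e * M p / h0 ^+ p by exact: (Mh_ge0 M_gt0 p (ltW e0) h00).
pose H (z : R * R) : R := rho z.1 * (phi^[p] (z.2 + z.1) - phi^[p] z.2).
have mH : measurable_fun setT H.
  apply: measurable_funM; first by apply: measurableT_comp => //; exact: measurable_fst.
  apply: measurable_funB; last by apply: measurableT_comp => //; exact: measurable_snd.
  by apply: (measurableT_comp mp); apply: measurable_funD; [exact: measurable_snd|exact: measurable_fst].
have E t : corr rho phi^[p] t - phi^[p] t = \int[mu]_s H (s, t).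
  rewrite -[X in _ - X]mul1r -{1}f1 -RintegralZr// -RintegralB//.
  - by apply: eq_Rintegral => s _; rewrite /H/= mulrBr.
  - exact: corr_int t fi mp hB.
  - by apply: (@integrable_bmul _ _ _ `|phi^[p] t|).
under eq_fun do rewrite E.
have g0 x : 0 <= rho x * (e * M p / h0 ^+ p) by rewrite mulr_ge0.
have mg : measurable_fun setT (fun x => rho x * (e * M p / h0 ^+ p)) by exact: measurable_funM.
have [|_ h2] := minkowski_integral mH measurableT mg g0.
  move=> s _; rewrite (_ : (fun t => H (s, t)) = (fun t => rho s * (phi^[p] (t + s) - phi^[p] t)))//.
  have mt : measurable_fun setT (fun t : R => phi^[p] (t + s)).
    by apply: measurableT_comp => //; exact: measurable_funD.
  rewrite n1Z; last first.
    exact: measurable_funB.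
  rewrite ger0_norm// EFinM; have [ds|sd] := ltP (d / 2) `|s|.
    by rewrite cs// !mul0e.
  apply: lee_wpmul2l; first by rewrite lee_fin.
  rewrite -(n1_refl 0); last first.
    exact: measurable_funB.
  have sd' : `|s - 0| < d by rewrite subr0; lra.
  have := hd s 0 sd' p; rewrite (_ : (fun t => phi^[p] (s - t) - phi^[p] (0 - t)) =
     (fun x => phi^[p] (0 - x + s) - phi^[p] (0 - x)))//.
  by apply/funext => t; congr (phi^[p] _ - _); ring.
apply: le_trans h2 _; rewrite (_ : integral _ _ _ = n1 (fun x => e * M p / h0 ^+ p * rho x)).
  by rewrite n1Z// prob_n1// mule1 ger0_norm.
by rewrite /n1; apply: eq_integral => x _; rewrite (mulrC (e * _ / _)) ger0_norm// g0.
Qed.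

(** phi is cut off by an indicator before being mollified: the derivatives fall on rho, so the
    result is a test function of the Beurling class even though the cut is not continuous. The
    radius n is chosen after rho, because the error of the cut is multiplied by the norm N' of
    rho. *)
Lemma density h0 h N (e : R) phi : M 0%N = 1 -> cond_M3' M ->
  rsmooth phi -> L1b M h N phi -> 0 < h0 -> h0 < h -> 0 < e ->
  exists phi', ET M Beurling phi' /\
    forall p, (n1 (fun t => (phi^[p] t - phi'^[p] t)%R) <= (e * M p / h0 ^+ p)%:E)%E.
Proof.
move=> M0 hM3 su hN h00 hh e0; have e20 : 0 < e / 2 by rewrite divr_gt0.
have [d d0 hd] := mollify_close su hN h00 hh e20.
have [rho [Trho srho prho]] := ultra_bump M_gt0 M0 hM3 d0.
have {}hd := hd rho prho srho.
have [irho _ _] := prho; have [sr [rr [rr0 csr]] hr] := Trho.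
have Erho := ET_EL1 Trho.
have [N' hN'] := Erho.2 h0 h00; have N'0 := L1b_ge0 M_gt0 hN'.
have iphi := L1b_integrable 0 su hN.
have [mphi fphi] := n1_integrable iphi.
have brho p : exists B : R, forall x, `|rho^[p] x| <= B := L1b_bounded p sr hN'.
have bphi p : exists B : R, forall x, `|phi^[p] x| <= B := L1b_bounded p su hN.
have t0 : 0 < e / (2 * (N' + 1)) by rewrite divr_gt0// mulr_gt0// ltr_wpDl.
have [n hn] := n1_tail iphi t0.
pose w x : R := \1_(`[- n%:R, n%:R]) x * phi x.
have mw : measurable_fun setT w by apply: measurable_funM => //; exact: measurable_indic.
have iw : mu.-integrable setT (EFin \o w).
  apply: integrable_n1 => //; apply: le_lt_trans fphi; apply: le_n1 => // x.
  rewrite /w normrM indicE; case: (x \in _); rewrite /= ?normr1 ?normr0 ?mul1r ?mul0r//.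
have [s1 D1] := rsmooth_corr2 iphi sr brho.
have [_ D1'] := rsmooth_corr irho su bphi.
have [s2 D2] := rsmooth_corr2 iw sr brho.
exists (corr rho w); split; last first.
  move=> p; have mp := rsmooth_meas p su.
  have m1 := rsmooth_meas p s1; have m2 := rsmooth_meas p s2.
  have -> : (fun t => phi^[p] t - (corr rho w)^[p] t) =
    (fun t => ((corr rho phi)^[p] t - (corr rho w)^[p] t) + -1 * (corr rho phi^[p] t - phi^[p] t)).
    by apply/funext => t; rewrite -D1'; ring.
  have mc : measurable_fun setT (fun t : R => corr rho phi^[p] t - phi^[p] t).
    by rewrite -D1'; exact: measurable_funB.
  apply: le_trans (n1D _ _) _; [exact: measurable_funB|exact: measurable_funM|].
  rewrite n1Z// normrN1 mul1e.
  have -> : (e * M p / h0 ^+ p)%:E = ((e / 2 * M p / h0 ^+ p)%:E + (e / 2 * M p / h0 ^+ p)%:E)%E.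
    by rewrite -EFinD; congr EFin; field; exact: expf_neq0 (lt0r_neq0 h00).
  apply: leeD (hd p).
  rewrite D1 D2.
  have mrp := rsmooth_meas p sr; have [B hB] := brho p.
  have -> : (fun t => (-1) ^+ p * corr rho^[p] phi t - (-1) ^+ p * corr rho^[p] w t) =
      (fun t => (-1) ^+ p * corr rho^[p] (fun x => phi x - w x) t).
    apply/funext => t; rewrite -mulrBr; congr (_ * _).
    rewrite !corrE//; last exact: measurable_funB.
    have mt : measurable_fun setT (fun x : R => rho^[p] (x - t)).
      by apply: (measurableT_comp mrp); exact: measurable_funB.
    rewrite -RintegralB//.
    - by apply: eq_Rintegral => x _; rewrite mulrBr.
    - under eq_fun do rewrite mulrC.
      by apply: (@integrable_bmul _ _ _ B).
    - under eq_fun do rewrite mulrC.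
      by apply: (@integrable_bmul _ _ _ B).
  have mpw : measurable_fun setT (fun x => phi x - w x) by exact: measurable_funB.
  rewrite n1Z; last exact: measurable_corr.
  rewrite normrX normrN1 expr1n mul1e; apply: le_trans (corr_n1 mrp mpw) _.
  apply: (@le_trans _ _ ((N' * M p / h0 ^+ p)%:E * (e / (2 * (N' + 1)))%:E)%E).
    by apply: lee_pmul => //; [exact: n1_ge0|exact: n1_ge0].
  rewrite -EFinM lee_fin.
  have -> : N' * M p / h0 ^+ p * (e / (2 * (N' + 1))) = (N' / (N' + 1)) * (e / 2 * M p / h0 ^+ p).
    field; rewrite expf_neq0 ?(lt0r_neq0 h00)//=; lra.
  rewrite ler_piMl ?(Mh_ge0 M_gt0 p (ltW e20) h00)//.
  by rewrite ler_pdivrMr ?mul1r; lra.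
split => //.
  have nd0 : 0 < n%:R + d by rewrite ltr_wpDl.
  exists (n%:R + d); split => // t ht; rewrite /corr (_ : \int[mu]_s _ = \int[mu]_(s in setT) 0).
    by rewrite Rintegral_cst//= mul0r.
  apply: eq_Rintegral => s _; have [ds|sd] := ltP d `|s|; first by rewrite srho// mul0r.
  rewrite /w indicE memNset ?mul0r ?mulr0//= in_itv/= -ler_norml => tn.
  have := ler_normB (t + s) s; rewrite addrK; lra.
move=> k k0; have [N2 [N20 hN2]] := hr k k0.
(* The extra N2 keeps the constant positive when w vanishes. *)
exists (N2 * fine (n1 w) + N2); split.
  by rewrite ltr_wpDl// mulr_ge0 ?fine_ge0 ?n1_ge0// ltW.
move=> p t; rewrite D2 normrM normrX normrN1 expr1n mul1r.
have mrp := rsmooth_meas p sr.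
rewrite corrE//; under eq_Rintegral do rewrite mulrC.
have mt : measurable_fun setT (fun x : R => rho^[p] (x - t)).
  by apply: (measurableT_comp mrp); exact: measurable_funB.
apply: le_trans (Rint_le iw mt (fun x => hN2 p (x - t))) _.
rewrite !mulrDl; apply: ler_wpDr; first exact: (Mh_ge0 M_gt0 p (ltW N20) k0).
by rewrite le_eqVlt; apply/orP; left; apply/eqP; ring.
Qed.
End density.

(** * T * phi beyond the test functions *)

Section key_lemma.
Variables (R : realType) (M : nat -> R).
Hypothesis M_gt0 : forall p, 0 < M p.
Implicit Types (u v phi psi : R -> R) (h N r : R) (c : ultra_class).
Notation mu := (@lebesgue_measure R).

Lemma corr_L1b h N u psi : rsmooth u -> L1b M h N u -> mu.-integrable setT (EFin \o psi) ->
  rsmooth (corr u psi) /\ L1b M h (N * fine (n1 psi)) (corr u psi).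
Proof.
move=> su hN ipsi; have [mpsi fpsi] := n1_integrable ipsi.
have [s D] := rsmooth_corr2 ipsi su (fun p => L1b_bounded p su hN).
split => // p; rewrite D; have mp := rsmooth_meas p su.
rewrite n1Z; last exact: measurable_corr.
rewrite normrX normrN1 expr1n mul1e; apply: le_trans (corr_n1 mp mpsi) _.
have -> : (N * fine (n1 psi) * M p / h ^+ p)%:E = ((N * M p / h ^+ p)%:E * n1 psi)%E.
  rewrite -[in RHS](fineK (x := n1 psi)) ?ge0_fin_numE ?n1_ge0//.
  by rewrite -EFinM; congr EFin; ring.
by apply: lee_wpmul2r; [exact: n1_ge0|exact: hN].
Qed.

Section vector.
Variable X : completeNormedModType R[i].

Lemma csupp_vanish (F : R -> X) psi r : csupp r psi -> vanish (fun x => (psi x)%:C *: F x) (- r) r.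
Proof.
by move=> cs t ht; rewrite cs ?scale0r// ltr_normr; apply/orP; case: ht => ?; [right|left]; lra.
Qed.

Lemma continuous_rscale (F : R -> X) psi : continuous psi -> continuous F ->
  continuous (fun x => (psi x)%:C *: F x).
Proof.
move=> cpsi /contX cF; apply/contX => t e e0.
have n0 := nX_ge0 (F t).
have [|d1 d10 h1] := cF t (e / (2 * (`|psi t| + 1))).
  by rewrite divr_gt0// mulr_gt0// ltr_wpDl.
have e1 : 0 < Num.min 1 (e / (2 * (nX (F t) + 1))).
  by rewrite lt_min ltr01 divr_gt0// mulr_gt0//; lra.
have := cpsi t; move=> /cvgrPdist_lt /(_ _ e1) /nbhs_ballP[d2 /= d20 h2].
exists (Num.min d1 d2); first by rewrite lt_min d10.
move=> s; rewrite lt_min => /andP[/h1 ts1 /h2]; rewrite lt_min => /andP[ts2 ts3].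
have -> : (psi s)%:C *: F s - (psi t)%:C *: F t =
   (psi s)%:C *: (F s - F t) + ((psi s - psi t)%:C) *: F t.
  by rewrite rmorphB/= scalerBr scalerBl addrA subrK.
apply: le_lt_trans (nXD _ _) _; rewrite !nXZr.
rewrite ltr_pdivlMr in ts1; last by rewrite mulr_gt0// ltr_wpDl.
rewrite ltr_pdivlMr in ts3; last by rewrite mulr_gt0//; lra.
have p1 : `|psi s| <= `|psi t| + 1.
  have := ler_distD (psi t) (psi s) 0; rewrite !subr0 (distrC (psi s)); lra.
have := nX_ge0 (F s - F t); rewrite (distrC (psi s)); move: ts1 ts3 p1.
have := normr_ge0 (psi s); have := normr_ge0 (psi t - psi s).
move: (`|psi s|) (`|psi t - psi s|) (`|psi t|) (nX (F s - F t)) (nX (F t)) n0 => a b a' y z; nra.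
Qed.

Lemma vint_close (F G : R -> X) psi r (B e : R) : continuous psi -> continuous F -> continuous G ->
  0 < r -> csupp r psi -> (forall t, `|psi t| <= B) -> (forall t, nX (F t - G t) <= e) ->
  nX (vint (fun x => (psi x)%:C *: F x) - vint (fun x => (psi x)%:C *: G x)) <= B * e * (2 * r).
Proof.
move=> cpsi cF cG r0 cs hB he; have rr : - r <= r by lra.
have cFp := continuous_rscale cpsi cF; have cGp := continuous_rscale cpsi cG.
have vF := csupp_vanish F cs; have vG := csupp_vanish G cs.
rewrite -[X in X - _]addr0 addrC addrA addrC add0r -scaleN1r -(vint_lin (-1) rr cGp cFp vG vF).
have cH : continuous (fun t => -1 *: ((psi t)%:C *: G t) + (psi t)%:C *: F t).
  by apply: (@continuous_lin _ _ (-1) (fun t => (psi t)%:C *: G t) (fun t => (psi t)%:C *: F t)).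
have vH : vanish (fun t => -1 *: ((psi t)%:C *: G t) + (psi t)%:C *: F t) (- r) r.
  by move=> t ht; rewrite vG// vF// scaler0 addr0.
apply: le_trans (nX_vint rr cH vH) _.
have -> : 2 * r = r - (- r) by ring.
apply: Rint_bound => //.
  by apply: continuous_integrable_itv; exact: continuous_nX.
move=> t; rewrite scaleN1r addrC -scalerBr nXZr.
by apply: ler_pM => //; exact: nX_ge0.
Qed.

Variable T : (R -> R[i]) -> X.

(* Approximating [phi] by test functions makes [T * phi] a uniform limit of
   almost automorphic functions even though [phi] is not in the test space. *)
Lemma AA_density h0 h (C : R) N phi : M 0%N = 1 -> cond_M3' M ->
  continuous_linear (DL1 M Beurling) T -> 0 < h0 -> h0 < h -> 0 < C ->
  TBound M Beurling T h0 C -> rsmooth phi -> L1b M h N phi ->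
  (forall u, ET M Beurling u -> almost_automorphic (Defs.conv T (rc u))) ->
  exists2 F : R -> X, almost_automorphic F & forall psi r, continuous psi -> 0 < r -> csupp r psi ->
    EL1 M Beurling (corr phi psi) ->
    T (rc (corr phi psi)) = vint (fun x => (psi x)%:C *: F x).
Proof.
move=> M0 hM3 hT h00 hh C0 hC su hN hAA.
pose e (n : nat) : R := n.+1%:R^-1.
have e0 n : 0 < e n by rewrite invr_gt0 ltr0n.
have esmall (d : R) : 0 < d -> exists K : nat, forall n, (K <= n)%N -> e n < d.
  move=> d0; exists (Num.truncn d^-1) => n Kn.
  rewrite /e -[ltRHS]invrK ltf_pV2 ?posrE ?invr_gt0//.
  by apply: lt_le_trans (truncnS_gt _) _; rewrite ler_nat ltnS.
have /choice[f hf] : forall n, exists phi', ET M Beurling phi' /\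
    forall p, (n1 (fun t => (phi^[p] t - phi'^[p] t)%R) <= (e n * M p / h0 ^+ p)%:E)%E.
  by move=> n; exact: (density M_gt0 M0 hM3 su hN h00 hh (e0 n)).
have fT n := (hf n).1; have fE n := ET_EL1 (fT n); have sf n := (fE n).1.
pose F n := Defs.conv T (rc (f n)).
have FA n : almost_automorphic (F n) by exact: hAA.
(* f n and f m are compared through phi, at distance e n + e m in ||.||_{1,h0}, but [T] itself is
   evaluated at test functions only. *)
have Fdiff n m x : nX (F n x - F m x) <= C * (e m + e n).
  rewrite /F !conv_rc (T_sub M_gt0 hT (EL1_refl x (fE n)) (EL1_refl x (fE m))).
  apply: hC.
  - exact: (EL1_lin M_gt0 (-1) (EL1_refl x (fE m)) (EL1_refl x (fE n))).
  - exact: addr_gt0.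
  have L1 := L1b_sub_n1 su (sf m) (hf m).2; have L2 := L1b_sub_n1 su (sf n) (hf n).2.
  have s1 := (rsmooth_lin (-1) (sf m) su).1; have s2 := (rsmooth_lin (-1) (sf n) su).1.
  have := L1b_lin (-1) s2 s1 L2 L1; rewrite normrN1 mul1r addrC => L3.
  have s3 := (rsmooth_lin (-1) s2 s1).1.
  have := L1b_refl x s3 L3; congr (L1b _ _ _ _).
  by apply/funext => t; ring.
have /choice[G hG] : forall x, exists l : X, (fun n => F n x) @ \oo --> l.
  move=> x; apply: cauchyX => d d0.
  have [K hK] := esmall (d / (2 * C)) (divr_gt0 d0 (mulr_gt0 (ltr0Sn _ 1) C0)).
  exists K => n m /hK Kn /hK Km; apply: le_lt_trans (Fdiff n m x) _.
  move: Kn Km; rewrite !ltr_pdivlMr ?mulr_gt0//; nra.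
have GF n x : nX (G x - F n x) <= C * (e n + e n).
  rewrite nX_dist; apply/ler_addgt0Pr => d d0.
  have /cvgX_seq/(_ d d0)[K hK] := hG x.
  have := hK (maxn K n) (leq_maxl _ _); have := Fdiff n (maxn K n) x.
  have en : e (maxn K n) <= e n.
    by rewrite /e lef_pV2 ?posrE ?ltr0n// ler_nat ltnS leq_maxr.
  have := nXD (F n x - F (maxn K n) x) (F (maxn K n) x - G x); rewrite addrA subrK.
  have := e0 n; nra.
have GA : almost_automorphic G.
  apply: AA_uniform => d d0.
  have [K hK] := esmall (d / (2 * C)) (divr_gt0 d0 (mulr_gt0 (ltr0Sn _ 1) C0)).
  exists (F K) => // t; apply: le_trans (GF K t) _; apply/ltW.
  by have := hK K (leqnn K); rewrite ltr_pdivlMr ?mulr_gt0//; nra.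
exists G => // psi r cpsi r0 cs hU.
have [[B hB] ipsi] := csupp_integrable cpsi r0 cs.
have B0 : 0 <= B := le_trans (normr_ge0 _) (hB 0).
have fpsi := (n1_integrable ipsi).2.
have n10 : 0 <= fine (n1 psi) by apply: fine_ge0; exact: n1_ge0.
(* Although phi may be outside the domain of [T], corr phi psi is inside, and it differs from corr
   (f n) psi by at most e n times ||psi||_1; the + 1 provides the positive bound that [TBound]
   requires. *)
have bound n : nX (T (rc (corr phi psi)) - vint (fun x => (psi x)%:C *: G x)) <=
    e n * (C * (fine (n1 psi) + 1) + B * (C * 2) * (2 * r)).
  have [hUn _] := corr_EL1 (fE n) ipsi.
  (* f n has every norm finite, so [T_corr] may be applied to it with any h above h0. *)
  have hh1 : h0 < h0 + 1 by lra.
  have h10 : 0 < h0 + 1 by lra.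
  have [N1 hN1] := (fE n).2 _ h10.
  have E1 := T_corr M_gt0 hT h00 hh1 C0 hC (fE n) hN1 cpsi r0 cs.
  have D1 : nX (T (rc (corr phi psi)) - T (rc (corr (f n) psi))) <= C * (e n * (fine (n1 psi) + 1)).
    rewrite (T_sub M_gt0 hT hU hUn); apply: hC.
    - exact: (EL1_lin M_gt0 (-1) hUn hU).
    - by rewrite mulr_gt0// ltr_wpDl.
    have L1 := L1b_sub_n1 su (sf n) (hf n).2; have s1 := (rsmooth_lin (-1) (sf n) su).1.
    have [s2 L2] := corr_L1b s1 L1 ipsi.
    have -> : (fun x => -1 * corr (f n) psi x + corr phi psi x) =
              corr (fun x => -1 * f n x + phi x) psi.
      apply/funext => t; have mpsi := measurable_shift t (n1_integrable ipsi).1.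
      have iphi := L1b_integrable 0 su hN; have iff := L1b_integrable 0 (sf n) hN1.
      have psiB s : `|psi (t + s)| <= B by exact: hB.
      rewrite /corr -RintegralZl//; last exact: (@integrable_bmul _ _ _ B).
      rewrite -RintegralD//.
      + by apply: eq_Rintegral => s _; ring.
      + by apply: integrable_scale; exact: (@integrable_bmul _ _ _ B).
      + exact: (@integrable_bmul _ _ _ B).
    move=> p; apply: le_trans (L2 p) _; rewrite lee_fin.
    rewrite ler_wpM2r ?invr_ge0 ?exprn_ge0 ?(ltW h00)//.
    by rewrite ler_wpM2r ?(ltW (M_gt0 p))// ler_wpM2l ?(ltW (e0 n))// lerDl.
  have D2 := vint_close cpsi (FA n).1 GA.1 r0 cs hB (e := C * (e n + e n)).
  have {}D2 := D2 (fun t => eq_ind _ (fun z => z <= _) (GF n t) _ (nX_dist _ _)).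
  rewrite -E1 in D2.
  have := nXD (T (rc (corr phi psi)) - T (rc (corr (f n) psi)))
    (T (rc (corr (f n) psi)) - vint (fun x => (psi x)%:C *: G x)); rewrite addrA subrK.
  nra.
apply/subr0_eq/nX_eq0/le_anti; rewrite nX_ge0 andbT.
apply/ler_addgt0Pr => d d0; rewrite add0r.
set K := C * _ + _ in bound.
have K0 : 0 <= K by rewrite addr_ge0// !mulr_ge0//; lra.
have K1 : 0 < K + 1 by rewrite ltr_wpDl.
have [n hn] := esmall _ (divr_gt0 d0 K1).
apply: le_trans (bound n) _; have := hn n (leqnn n); rewrite ltr_pdivlMr//.
have := e0 n; nra.
Qed.

End vector.
End key_lemma.

(** * Regularization: (iii) and (iv) *)

Section regularization.
Variables (R : realType) (M : nat -> R).
Hypothesis M_gt0 : forall p, 0 < M p.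
Implicit Types (u v phi psi : R -> R) (h N r : R) (c : ultra_class).
Notation mu := (@lebesgue_measure R).

(** Here the derivatives fall on psi. Hence [T] may be applied to corr k psi for any integrable k,
    even one outside the space. *)
Lemma corr_integrable_EL1 c k psi : mu.-integrable setT (EFin \o k) -> EL1 M c psi ->
  EL1 M c (corr k psi).
Proof.
move=> ik hpsi; have [mk fk] := n1_integrable ik; have [spsi cpsi] := hpsi.
have [s1 s2] := rsmooth_corr ik spsi (fun p => EL1_bounded p hpsi).
split => //; apply: hclass_imply cpsi => h h0 [N hN].
exists (fine (n1 k) * N) => p; rewrite s2; have mp := rsmooth_meas p spsi.
apply: le_trans (corr_n1 mk mp) _.
have -> : (fine (n1 k) * N * M p / h ^+ p)%:E = (n1 k * (N * M p / h ^+ p)%:E)%E.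
  rewrite -[in RHS](fineK (x := n1 k)) ?ge0_fin_numE ?n1_ge0//.
  by rewrite -EFinM; congr EFin; ring.
by apply: lee_wpmul2l; [exact: n1_ge0|exact: hN].
Qed.

Section vector.
Variable X : completeNormedModType R[i].
Variables (c : ultra_class) (T : (R -> R[i]) -> X).
Hypothesis hT : continuous_linear (DL1 M c) T.

Definition corr_represented phi (F : R -> X) := forall psi, ET M c psi ->
  T (rc (corr phi psi)) = vint (fun x => (psi x)%:C *: F x).

Lemma conv_distr_split (phi psi : R -> R[i]) : let p1 t := complex.Re (phi t) in
  let p2 t := complex.Im (phi t) in let q1 t := complex.Re (psi t) in let q2 t := complex.Im (psi t) in
  mu.-integrable setT (EFin \o p1) -> mu.-integrable setT (EFin \o p2) -> ET M c q1 -> ET M c q2 ->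
  conv_distr T phi psi = 'i%C *: (T (rc (corr p2 q1)) + T (rc (corr p1 q2))) +
     (- T (rc (corr p2 q2)) + T (rc (corr p1 q1))).
Proof.
move=> p1 p2 q1 q2 i1 i2 hq1 hq2.
have E1 := ET_EL1 hq1; have E2 := ET_EL1 hq2.
have e11 := corr_integrable_EL1 i1 E1; have e12 := corr_integrable_EL1 i1 E2.
have e21 := corr_integrable_EL1 i2 E1; have e22 := corr_integrable_EL1 i2 E2.
have int k q t : mu.-integrable setT (EFin \o k) -> EL1 M c q ->
    mu.-integrable setT (EFin \o (fun s => k s * q (t + s))).
  move=> ik hq; have [B hB] := EL1_bounded 0 hq.
  by apply: (corr_int t ik _ hB); exact: (rsmooth_meas 0 hq.1).
have -> : conv_distr T phi psi = T (fun t =>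
    (-1 * corr p2 q2 t + corr p1 q1 t) +i* (1 * corr p2 q1 t + corr p1 q2 t)).
  congr T; apply/funext => t; rewrite /cint; congr (_ +i* _).
    rewrite /corr -RintegralZl//; last exact: int.
    rewrite -RintegralD//; [|by apply: integrable_scale; exact: int|exact: int].
    apply: eq_Rintegral => s _; rewrite /p1 /p2 /q1 /q2; case: (phi s) => a b; case: (psi _) => a' b' /=; ring.
  rewrite /corr -RintegralZl//; last exact: int.
  rewrite -RintegralD//; [|by apply: integrable_scale; exact: int|exact: int].
  apply: eq_Rintegral => s _; rewrite /p1 /p2 /q1 /q2; case: (phi s) => a b; case: (psi _) => a' b' /=; ring.
rewrite (T_complex M_gt0 hT)/=.
- by rewrite (T_lin M_gt0 hT 1 e21 e12) (T_lin M_gt0 hT (-1) e22 e11) scale1r rmorphN1 scaleN1r.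
- exact: (EL1_lin M_gt0).
- exact: (EL1_lin M_gt0).
Qed.

(** The product of a complex number and a split vector; the sign comes from the square of i. *)
Lemma complex_scale_split (a b : R[i]) (x y : X) :
  (a + 'i%C * b) *: ('i%C *: x + y) = 'i%C *: (a *: x + b *: y) + (- (b *: x) + a *: y).
Proof.
rewrite scalerDl !scalerDr !scalerA.
have -> : 'i%C * b * 'i%C = - b by rewrite mulrAC -expr2 sqr_i mulN1r.
rewrite scaleNr (mulrC a 'i%C) [LHS]addrACA (addrC (a *: y)) [LHS]addrACA.
by rewrite -!addrA; congr (_ + _); rewrite !addrA; congr (_ + _); rewrite addrC.
Qed.

Lemma regular_split (F1 F2 : R -> X) (psi : R -> R[i]) r : continuous F1 -> continuous F2 ->
  let q1 t := complex.Re (psi t) in let q2 t := complex.Im (psi t) in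
  continuous q1 -> continuous q2 -> 0 < r -> csupp r q1 -> csupp r q2 ->
  let V q F := vint (fun x => (q x)%:C *: F x : X) in
  regular (fun t => 'i%C *: F2 t + F1 t) psi = 'i%C *: (V q1 F2 + V q2 F1) + (- V q2 F2 + V q1 F1).
Proof.
move=> cF1 cF2 q1 q2 cq1 cq2 r0 cs1 cs2 V; have rr : - r <= r by lra.
pose W (q : R -> R) (F : R -> X) (x : R) : X := (q x)%:C *: F x.
have c11 : continuous (W q1 F1) by exact: continuous_rscale.
have c12 : continuous (W q1 F2) by exact: continuous_rscale.
have c21 : continuous (W q2 F1) by exact: continuous_rscale.
have c22 : continuous (W q2 F2) by exact: continuous_rscale.
have v11 : vanish (W q1 F1) (- r) r by exact: csupp_vanish.
have v12 : vanish (W q1 F2) (- r) r by exact: csupp_vanish.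
have v21 : vanish (W q2 F1) (- r) r by exact: csupp_vanish.
have v22 : vanish (W q2 F2) (- r) r by exact: csupp_vanish.
have lin_v a (f g : R -> X) : vanish f (- r) r -> vanish g (- r) r ->
    vanish (fun t => a *: f t + g t) (- r) r.
  by move=> vf vg t ht; rewrite vf// vg// scaler0 addr0.
have -> : V q1 F2 + V q2 F1 = vint (fun t => 1 *: W q1 F2 t + W q2 F1 t).
  by rewrite (vint_lin 1 rr c12 c21 v12 v21) scale1r.
have -> : - V q2 F2 + V q1 F1 = vint (fun t => -1 *: W q2 F2 t + W q1 F1 t).
  by rewrite (vint_lin (-1) rr c22 c11 v22 v11) scaleN1r.
have ca : continuous (fun t => 1 *: W q1 F2 t + W q2 F1 t) by exact: continuous_lin.
have cb : continuous (fun t => -1 *: W q2 F2 t + W q1 F1 t) by exact: continuous_lin.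
rewrite -(vint_lin 'i%C rr ca cb (lin_v _ _ _ v12 v21) (lin_v _ _ _ v22 v11)).
congr vint; apply/funext => t; rewrite /W scale1r scaleN1r.
have -> : psi t = (q1 t)%:C + 'i%C * (q2 t)%:C.
  by rewrite /q1 /q2; case: (psi t) => a b; apply/eqP; rewrite eq_complex/=; apply/andP; split; apply/eqP; ring.
exact: complex_scale_split.
Qed.

Lemma AA_distr_of_parts (phi : R -> R[i]) (F1 F2 : R -> X) :
  mu.-integrable setT (EFin \o (fun t => complex.Re (phi t))) ->
  mu.-integrable setT (EFin \o (fun t => complex.Im (phi t))) ->
  almost_automorphic F1 -> almost_automorphic F2 ->
  corr_represented (fun t => complex.Re (phi t)) F1 ->
  corr_represented (fun t => complex.Im (phi t)) F2 ->
  AA_distr c M (conv_distr T phi).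
Proof.
move=> i1 i2 A1 A2 H1 H2; exists (fun t => 'i%C *: F2 t + F1 t); first exact: AA_lin.
move=> psi /(carrier_DtestP M_gt0)[hq1 hq2].
rewrite conv_distr_split// !H1// !H2//.
have [s1 [r1 [r10 cs1]] _] := hq1; have [s2 [r2 [r20 cs2]] _] := hq2.
have r0 : 0 < Num.max r1 r2 by rewrite lt_max r10.
rewrite (@regular_split _ _ _ (Num.max r1 r2) A1.1 A2.1)//.
- exact: (rsmooth_cont (p := 0) s1).
- exact: (rsmooth_cont (p := 0) s2).
- by move=> t; rewrite gt_max => /andP[/cs1].
- by move=> t; rewrite gt_max => /andP[_ /cs2].
Qed.

(** Where the gap comes from: in the Beurling case [T] fixes h0 and u has the norm h0 + 1; in the
    Roumieu case u fixes h and [T] is bounded for h / 2. *)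
Lemma TBound_EL1 u : EL1 M c u -> exists h0 h C N,
  [/\ 0 < h0, h0 < h, 0 < C, TBound M c T h0 C & L1b M h N u].
Proof.
case: c hT => hT' [su hu].
  have [h0 [C [h00 C0 hC]]] := T_bound_Beurling M_gt0 hT'.
  have h1 : 0 < h0 + 1 by lra.
  have [N hN] := hu _ h1.
  by exists h0, (h0 + 1), C, N; split => //; lra.
have [h [h0 [N hN]]] := hu; have h2 : 0 < h / 2 by rewrite divr_gt0.
have [C [C0 hC]] := T_bound_Roumieu M_gt0 hT' h2.
by exists (h / 2), h, C, N; split => //; lra.
Qed.

Lemma conv_represented u : EL1 M c u -> continuous (Defs.conv T (rc u)) /\
  corr_represented u (Defs.conv T (rc u)).
Proof.
move=> hu; have [h0 [h [C [N [h00 hh C0 hC hN]]]]] := TBound_EL1 hu.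
split; first exact: (conv_cont M_gt0 hT h00 hh C0 hC hu hN).
move=> psi [spsi [r [r0 cs]] _].
exact: (T_corr M_gt0 hT h00 hh C0 hC hu hN (rsmooth_cont (p := 0) spsi) r0 cs).
Qed.

Lemma assertion_iii_real u : assertion_iii c M T -> ET M c u ->
  almost_automorphic (Defs.conv T (rc u)).
Proof.
move=> h hu; apply: h; apply/(carrier_DtestP M_gt0); split; first exact: hu.
exact: (ET_0 M_gt0).
Qed.

End vector.

(** In the Beurling case 2 * h0 is a convenient value above h0 for [AA_density]. In the Roumieu case
    each D^{M_p,h}_K already lies in the test space, and only the two notions of convolution have to
    be matched. *)
Lemma iii_to_iv (X : completeNormedModType R[i]) c (T : (R -> R[i]) -> X) :
  M 0%N = 1 -> cond_M3' M -> continuous_linear (DL1 M c) T ->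
  assertion_iii c M T -> assertion_iv c M T.
Proof.
move=> M0 hM3 hT hiii.
have parts K h (phi : R -> R[i]) : 0 < h -> compact K -> carrier (DKh M K h) phi ->
    exists r N, [/\ 0 < r, 0 < N,
     [/\ rsmooth (fun t => complex.Re (phi t)), csupp r (fun t => complex.Re (phi t))
      & supb M h N (fun t => complex.Re (phi t))] &
     [/\ rsmooth (fun t => complex.Im (phi t)), csupp r (fun t => complex.Im (phi t))
      & supb M h N (fun t => complex.Im (phi t))]].
  move=> h0 cK hphi; have [r [N [r0 N0 /smoothP[s1 s2] cs hN]]] := carrier_DKh_rc M_gt0 hphi cK h0.
  exists r, N; split => //; split => //.
  - by move=> t /cs ->.
  - by move=> p t; apply: le_trans (hN p t); exact: (modc_re (cderiv p phi t)).
  - by move=> t /cs ->.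
  - by move=> p t; apply: le_trans (hN p t); exact: (modc_im (cderiv p phi t)).
case: c hT hiii => hT hiii.
  have [h0 [C [h00 C0 hC]]] := T_bound_Beurling M_gt0 hT.
  have h10 : 0 < 2 * h0 by rewrite mulr_gt0.
  have hh : h0 < 2 * h0 by lra.
  exists (2 * h0); split => // K cK phi hphi.
  have [r [N [r0 N0 [s1 c1 b1] [s2 c2 b2]]]] := parts _ _ _ h10 cK hphi.
  have L1 := supb_L1b s1 r0 c1 b1; have L2 := supb_L1b s2 r0 c2 b2.
  have i1 := L1b_integrable 0 s1 L1; have i2 := L1b_integrable 0 s2 L2.
  have hr u := @assertion_iii_real X Beurling T u hiii.
  have [F1 A1 H1] := AA_density M_gt0 M0 hM3 hT h00 hh C0 hC s1 L1 hr.
  have [F2 A2 H2] := AA_density M_gt0 M0 hM3 hT h00 hh C0 hC s2 L2 hr.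
  apply: (AA_distr_of_parts hT i1 i2 A1 A2).
    move=> psi hpsi; have [sp [rp [rp0 cp]] _] := hpsi.
    apply: (H1 _ _ (rsmooth_cont (p := 0) sp) rp0 cp).
    exact: corr_integrable_EL1 (ET_EL1 hpsi).
  move=> psi hpsi; have [sp [rp [rp0 cp]] _] := hpsi.
  apply: (H2 _ _ (rsmooth_cont (p := 0) sp) rp0 cp).
  exact: corr_integrable_EL1 (ET_EL1 hpsi).
move=> h h0 K cK phi hphi.
have [r [N [r0 N0 [s1 c1 b1] [s2 c2 b2]]]] := parts _ _ _ h0 cK hphi.
have L1 := supb_L1b s1 r0 c1 b1; have L2 := supb_L1b s2 r0 c2 b2.
have i1 := L1b_integrable 0 s1 L1; have i2 := L1b_integrable 0 s2 L2.
have T1 : ET M Roumieu (fun t => complex.Re (phi t)).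
  by split => //; [exists r|exists h; split => //; exists N].
have T2 : ET M Roumieu (fun t => complex.Im (phi t)).
  by split => //; [exists r|exists h; split => //; exists N].
have [_ H1] := conv_represented hT (ET_EL1 T1).
have [_ H2] := conv_represented hT (ET_EL1 T2).
exact: (AA_distr_of_parts hT i1 i2 (assertion_iii_real hiii T1) (assertion_iii_real hiii T2) H1 H2).
Qed.

End regularization.

(** * Uniqueness by testing, and (iv) implies (iii) *)

Section testing.
Variables (R : realType) (M : nat -> R).
Hypothesis M_gt0 : forall p, 0 < M p.
Implicit Types (u v phi psi : R -> R) (h N r : R) (c : ultra_class).
Notation mu := (@lebesgue_measure R).

Lemma prob_refl f (a : R) : prob_density f -> prob_density (fun x => f (a - x)).
Proof.
move=> pf; have [fi f0 f1] := pf; have [mf _] := n1_integrable fi.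
have mg : measurable_fun setT (fun x : R => f (a - x)).
  by apply: measurableT_comp => //; exact: measurable_funB.
have n1g : n1 (fun x => f (a - x)) = 1%E by rewrite n1_refl// prob_n1.
split => //; first by apply: integrable_n1 => //; rewrite n1g ltry.
have -> : 1 = fine (n1 (fun x => f (a - x))) by rewrite n1g.
by rewrite /n1 /Rintegral; congr fine; apply: eq_integral => x _; rewrite ger0_norm.
Qed.

Lemma Rintegral_vanish (f : R -> R) a b : (forall t, t < a \/ b < t -> f t = 0) ->
  \int[mu]_(t in `[a, b]) f t = \int[mu]_t f t.
Proof.
move=> hf; rewrite Rintegral_mkcond; apply: eq_Rintegral => x _; rewrite patchE.
case: ifPn => // /negP h; apply/esym/hf; have [xa|ax] := ltP x a; first by left.
have [bx|xb] := ltP b x; first by right.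
by exfalso; apply: h; rewrite inE/= in_itv/= ax xb.
Qed.

(** [lower_sum_le], applied to f and to -f with values lowered by the oscillation k, encloses the
    sum. *)
Lemma riemann_sum_cvg (f : R -> R) a b (e : R) : continuous f -> a <= b ->
  (forall t, t < a \/ b < t -> f t = 0) -> 0 < e ->
  exists2 d : R, 0 < d & forall n (x s : nat -> R), tagged_partition a b d n x s ->
    `|\sum_(i < n) (x i.+1 - x i) * f (s i) - \int[mu]_t f t| <= e.
Proof.
move=> cf ab vf e0; rewrite -(Rintegral_vanish vf).
have [k e1 kE] : exists2 k : R, 0 < k & k * (b - a) <= e.
  exists (e / (b - a + 1)); first by rewrite divr_gt0//; lra.
  by rewrite mulrAC ler_pdivrMr; nra.
have [d d0 hd] : exists2 d : R, 0 < d & forall p q, `|p - q| < d -> `|f p - f q| <= k.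
  apply: (@heine R (fun p q => `|f p - f q|) a b) => //.
  - by move=> p q; rewrite distrC.
  - by move=> p q s; exact: ler_distD.
  - move=> t e' e'0; have := cf t; move=> /cvgrPdist_lt /(_ e' e'0) /nbhs_ballP[d /= d0 hd].
    by exists d => // s ts; rewrite distrC; exact: hd.
  - by move=> p q hp' hq; rewrite vf// vf// subrr normr0.
exists d => // n x s [x0 xn hx].
have xm i : (i < n)%N -> x i <= x i.+1 by move=> /hx[h1 h2 _]; exact: le_trans h2.
have close i t : (i < n)%N -> x i <= t -> t <= x i.+1 -> `|f t - f (s i)| <= k.
  move=> /hx[h1 h2 h3] h4 h5; apply: hd; apply: le_lt_trans h3.
  by rewrite ler_norml; apply/andP; split; lra.
have S : \sum_(i < n) (x i.+1 - x i) * k <= e.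
  by rewrite -mulr_suml sum_telescope xn x0 mulrC.
have L1 : \sum_(i < n) (x i.+1 - x i) * (f (s i) - k) <= \int[mu]_(t in `[a, b]) f t.
  rewrite -x0 -xn; apply: (lower_sum_le (s := fun i => f (s i) - k) cf xm).
  by move=> i t hi h1 h2; have := close i t hi h1 h2; rewrite ler_norml => /andP[h3 h4]; lra.
have L2 : \sum_(i < n) (x i.+1 - x i) * (- f (s i) - k) <= \int[mu]_(t in `[a, b]) (- f t).
  have cN : continuous (fun t => - f t) by move=> t; apply: cvgN; exact: cf.
  rewrite -x0 -xn; apply: (lower_sum_le (s := fun i => - f (s i) - k) cN xm).
  by move=> i t hi h1 h2; have := close i t hi h1 h2; rewrite ler_norml => /andP[h3 h4]; lra.
have EN : \int[mu]_(t in `[a, b]) (- f t) = - \int[mu]_(t in `[a, b]) f t.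
  under eq_Rintegral do rewrite -mulN1r.
  by rewrite RintegralZl ?mulN1r//; exact: continuous_integrable_itv.
rewrite EN in L2.
have E1 : \sum_(i < n) (x i.+1 - x i) * (f (s i) - k) =
  \sum_(i < n) (x i.+1 - x i) * f (s i) - \sum_(i < n) (x i.+1 - x i) * k.
  by rewrite -sumrB; apply: eq_bigr => i _; rewrite mulrBr.
have E2 : \sum_(i < n) (x i.+1 - x i) * (- f (s i) - k) =
  - \sum_(i < n) (x i.+1 - x i) * f (s i) - \sum_(i < n) (x i.+1 - x i) * k.
  by rewrite -sumrN -sumrB; apply: eq_bigr => i _; ring.
rewrite E1 in L1; rewrite E2 in L2.
by rewrite ler_norml; apply/andP; split; lra.
Qed.

Section vector.
Variable X : completeNormedModType R[i].

Lemma vint_scale_cst (f : R -> R) (v : X) a b : continuous f -> a <= b ->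
  (forall t, t < a \/ b < t -> f t = 0) ->
  vint (fun t => (f t)%:C *: v) = (\int[mu]_t f t)%:C *: v.
Proof.
move=> cf ab vf; apply: (@vint_eq _ _ _ a b).
- by apply: (@continuous_rscale R X (fun=> v)) => // t; exact: cvg_cst.
- exact: ab.
- by move=> t ht; rewrite vf// scale0r.
move=> e e0; have e1 : 0 < e / (nX v + 1) by rewrite divr_gt0// ltr_wpDl ?nX_ge0.
have [d d0 hd] := riemann_sum_cvg cf ab vf e1.
exists d; split => // n x s x0 xn hx; rewrite -nX_lt.
have -> : \sum_(i < n) (x i.+1 - x i)%:C *: ((f (s i))%:C *: v) =
    (\sum_(i < n) (x i.+1 - x i) * f (s i))%:C *: v.
  by rewrite rmorph_sum scaler_suml; apply: eq_bigr => i _; rewrite scalerA -rmorphM.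
rewrite -scalerBl -rmorphB nXZr.
have hp : tagged_partition a b d n x s by [].
have := hd n x s hp; have := nX_ge0 v; rewrite ler_pdivlMr ?ltr_wpDl ?nX_ge0//.
set A := `|_|; have : 0 <= A by exact: normr_ge0.
rewrite le_eqVlt => /predU1P[<-|A0] _; rewrite ?mul0r//; nra.
Qed.

(** For a bump psi of integral 1 near x0, F x0 - G x0 is the psi-average of its deviation from F -
    G, since the average of F - G itself vanishes; continuity makes this deviation small. *)
Lemma test_unique c (F G : R -> X) : M 0%N = 1 -> cond_M3' M -> continuous F -> continuous G ->
  (forall psi, ET M c psi -> vint (fun x => (psi x)%:C *: F x) = vint (fun x => (psi x)%:C *: G x)) ->
  F = G.
Proof.
move=> M0 hM3 cF cG H; apply/funext => x0.
pose K x := F x - G x.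
have cK : continuous K by move=> x; apply: cvgB; [exact: cF|exact: cG].
apply/subr0_eq/nX_eq0/le_anti; rewrite nX_ge0 andbT -/(K x0).
apply/ler_addgt0Pr => e e0; rewrite add0r.
have /contX/(_ x0 e e0)[d d0 hd] := cK.
have d20 : 0 < d / 2 by rewrite divr_gt0.
have [rho [Trho srho prho]] := ultra_bump M_gt0 M0 hM3 d20.
pose psi x := rho (x0 - x).
have TB : ET M Beurling psi by exact: ET_refl.
(* A bump of the Beurling class also belongs to the Roumieu class: its bound at h = 1 is a
   witness. *)
have Tpsi : ET M c psi.
  case: c {H} => //; have [s1 s2 s3] := TB; split => //; exists 1; split => //; exact: s3.
have [ipsi psi0 psi1] : prob_density psi by exact: prob_refl.
have [spsi _ _] := Tpsi; have cpsi := rsmooth_cont (p := 0) spsi.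
have vpsi t : t < x0 - d / 2 \/ x0 + d / 2 < t -> psi t = 0.
  by move=> ht; apply: srho; rewrite ltr_normr; apply/orP; case: ht => ?; [left|right]; lra.
have ab : x0 - d / 2 <= x0 + d / 2 by lra.
have cc : continuous (fun _ : R => K x0) by move=> t; exact: cvg_cst.
have van (L : R -> X) : vanish (fun x => (psi x)%:C *: L x) (x0 - d / 2) (x0 + d / 2).
  by move=> t ht; rewrite vpsi// scale0r.
have cs (L : R -> X) : continuous L -> continuous (fun x => (psi x)%:C *: L x).
  by move=> cL; exact: continuous_rscale.
have E1 : K x0 = vint (fun x => (psi x)%:C *: K x0).
  by rewrite (vint_scale_cst (K x0) cpsi ab vpsi) psi1 scale1r.
have E2 : vint (fun x => (psi x)%:C *: K x) = 0.
  rewrite (_ : (fun x => _) = (fun x => -1 *: ((psi x)%:C *: G x) + (psi x)%:C *: F x)).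
    by rewrite (vint_lin (-1) ab (cs _ cG) (cs _ cF) (van _) (van _)) scaleN1r H// addNr.
  by apply/funext => x; rewrite scaleN1r addrC -scalerBr.
have E3 : K x0 = vint (fun x => -1 *: ((psi x)%:C *: K x) + (psi x)%:C *: K x0).
  by rewrite (vint_lin (-1) ab (cs _ cK) (cs _ cc) (van _) (van _)) E2 scaler0 add0r -E1.
have cH : continuous (fun x => -1 *: ((psi x)%:C *: K x) + (psi x)%:C *: K x0).
  by apply: (@continuous_lin _ _ (-1) (fun x => (psi x)%:C *: K x) (fun x => (psi x)%:C *: K x0)); exact: cs.
rewrite E3; apply: (le_trans (nX_vint ab cH _)).
  by move=> t ht; rewrite vpsi// !scale0r scaler0 addr0.
apply: (@le_trans _ _ (\int[mu]_(t in `[x0 - d / 2, x0 + d / 2]) (psi t * e))).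
  apply: le_Rintegral => //.
  - by apply: continuous_integrable_itv; exact: continuous_nX.
  - apply: continuous_integrable_itv => t.
    by apply: cvgM; [exact: cpsi|exact: cvg_cst].
  - move=> t /=; rewrite in_itv/= => /andP[h1 h2].
    rewrite scaleN1r addrC -scalerBr nXZr ger0_norm// ler_wpM2l//.
    rewrite nX_dist; apply/ltW/hd.
    by rewrite ltr_norml; apply/andP; split; lra.
rewrite RintegralZr//; last exact: continuous_integrable_itv.
by rewrite Rintegral_vanish// psi1 mul1r.
Qed.

(** A test function has a finite norm for the h given by (iv), which represents T * phi by an almost
    automorphic F. The function T * phi is continuous and represents the same ultradistribution, so
    [test_unique] identifies it with F. *)
Lemma iv_to_iii c (T : (R -> R[i]) -> X) :
  M 0%N = 1 -> cond_M3' M -> continuous_linear (DL1 M c) T ->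
  assertion_iv c M T -> assertion_iii c M T.
Proof.
move=> M0 hM3 hT hiv phi /(carrier_DtestP M_gt0)[hp1 hp2].
have real u : ET M c u -> almost_automorphic (Defs.conv T (rc u)).
  move=> hu; have [su [r [r0 cu]] hcu] := hu.
  have [F FA hF] : AA_distr c M (conv_distr T (rc u)).
    have [h [h0 hh [N [N0 hN]]]] : exists h, [/\ 0 < h, AA_conv_at c M T h & exists N, 0 < N /\ supb M h N u].
      case: c hiv hcu {hT hp1 hp2 hu} => /=.
        by move=> [h [h0 hh]] /(_ h h0) ?; exists h.
      by move=> hh [h [h0 ?]]; exists h; split => //; exact: hh.
    apply: (hh `[- r, r]%classic); first exact: segment_compact.
    apply: (carrier_DKh_of M_gt0 (N := N) h0 r0) => //.
    - exact: smooth_rc.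
    - by move=> t /cu; rewrite /rc => ->.
    - by move=> p t; rewrite modc_rc.
  have [cG hG] := conv_represented M_gt0 hT (ET_EL1 hu).
  suff <- : F = Defs.conv T (rc u) by [].
  apply: (@test_unique c _ _ M0 hM3 FA.1 cG) => psi hpsi.
  rewrite -hG//.
  have : carrier (Dtest M c) (rc psi).
    by apply/(carrier_DtestP M_gt0); split; [exact: hpsi|exact: (ET_0 M_gt0)].
  move=> /hF; rewrite /regular => <-; congr T; apply/funext => t.
  rewrite /cint /rc /corr/=; congr (_ +i* _).
    by apply: eq_Rintegral => s _; rewrite mulr0 subr0.
  rewrite -[RHS](_ : \int[mu]_s 0 = 0); last by rewrite Rintegral_cst//= mul0r.
  by apply: eq_Rintegral => s _; rewrite mulr0 mul0r addr0.
have -> : Defs.conv T phi = (fun x => 'i%C *: Defs.conv T (rc (fun t => complex.Im (phi t))) x +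
    Defs.conv T (rc (fun t => complex.Re (phi t))) x).
  apply/funext => x; rewrite /Defs.conv.
  exact: (@T_complex _ _ M_gt0 _ _ _ hT (fun t => phi (x - t))
    (EL1_refl x (ET_EL1 hp1)) (EL1_refl x (ET_EL1 hp2))).
by apply: AA_lin; exact: real.
Qed.

End vector.
End testing.

(** * Ultradifferential operators: (ii) implies (iii) *)

Section complex_series.
Variable R : realType.
Implicit Types (u : nat -> R[i]) (l : R[i]).

Lemma cvg_modc u l : (forall e : R, 0 < e -> exists N, forall n, (N <= n)%N -> modc (u n - l) < e) ->
  (u : nat -> R[i]^o) @ \oo --> (l : R[i]^o).
Proof.
move=> h; apply/cvgrPdist_lt => e /posC[r r0 ->].
have [N hN] := h r r0; exists N => // n /= /hN.
by rewrite -ltcR -[(modc _)%:C]/(`|(u n - l : R[i])|) distrC.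
Qed.

Lemma modcN (z : R[i]) : modc (- z) = modc z.
Proof. by case: z => a b /=; rewrite !sqrrN. Qed.

Lemma modc_dist (a b : R[i]) : modc (a - b) = modc (b - a).
Proof. by rewrite -modcN opprB. Qed.

Lemma half_pow_small (C e : R) : 0 < e -> exists N : nat, forall n, (N <= n)%N -> C * 2^-1 ^+ n < e.
Proof.
move=> e0; have e2 : 0 < e / 2 by rewrite divr_gt0.
have h1 : (0 : R) <= 2^-1 by rewrite invr_ge0.
have h2 : (2^-1 : R) < 1 by lra.
have [N hN] := pow_small h1 h2 (normr_ge0 C) e2.
exists N => n /hN h; have : C * 2^-1 ^+ n <= `|C| * 2^-1 ^+ n.
  by rewrite ler_wpM2r ?exprn_ge0// ler_norm.
lra.
Qed.

(** Completeness is used for real and imaginary parts separately. The explicit tail is kept because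
    it is uniform in any parameter on which u depends, unlike bare convergence. *)
Lemma geometric_tail u (C : R) : 0 <= C -> (forall p, modc (u p) <= C * 2^-1 ^+ p) ->
  exists l, forall n, modc (l - \sum_(i < n) u i) <= 2 * C * 2^-1 ^+ n.
Proof.
move=> C0 hu; pose S n := \sum_(i < n) u i.
have D n k : modc (S (n + k)%N - S n) <= 2 * C * (2^-1 ^+ n - 2^-1 ^+ (n + k)).
  elim: k => [|k IH]; first by rewrite addn0 !subrr mulr0 modcR normr0.
  rewrite addnS /S big_ord_recr/= -/(S _) addrAC.
  apply: le_trans (modcD _ _) _; apply: le_trans (lerD IH (hu _)) _.
  by rewrite exprS; lra.
have D2 n k : modc (S (n + k)%N - S n) <= 2 * C * 2^-1 ^+ n.
  apply: le_trans (D n k) _; rewrite ler_wpM2l ?mulr_ge0//.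
  by rewrite lerBlDr lerDl exprn_ge0.
have part (f : R[i] -> R) : (forall a b, f a - f b = f (a - b)) -> (forall z, `|f z| <= modc z) ->
    exists x : R, (fun n => f (S n)) @ \oo --> x.
  move=> fB fle; apply/cvg_ex; apply/cauchy_cvgP; apply: cauchy_exP => e e0.
  have [N hN] := half_pow_small (2 * C) e0.
  exists (f (S N)); exists N => // n /= Nn; rewrite -ball_normE/= fB.
  apply: le_lt_trans (fle _) _; rewrite modc_dist -(subnKC Nn).
  by apply: le_lt_trans (D2 _ _) _; exact: hN.
have [x hx] : exists x : R, (fun n => complex.Re (S n)) @ \oo --> x.
  by apply: (part (@complex.Re R)) (@modc_re R) => -[a b] [c d].
have [y hy] : exists x : R, (fun n => complex.Im (S n)) @ \oo --> x.
  by apply: (part (@complex.Im R)) (@modc_im R) => -[a b] [c d].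
exists (x +i* y) => n; apply/ler_addgt0Pr => e e0.
have e2 : 0 < e / 2 by rewrite divr_gt0.
move/cvgrPdist_lt: hx => /(_ _ e2)[N1 _ h1]; move/cvgrPdist_lt: hy => /(_ _ e2)[N2 _ h2].
pose k := maxn N1 N2; have := h1 (n + k)%N (leq_trans (leq_maxl _ _) (leq_addl _ _)).
have := h2 (n + k)%N (leq_trans (leq_maxr _ _) (leq_addl _ _)) => /= h4 h3.
have h5 : modc (x +i* y - S (n + k)%N) <= e.
  apply: le_trans (modc_le _) _; move: h3 h4; case: (S _) => a b /=; lra.
have := modcD (x +i* y - S (n + k)%N) (S (n + k)%N - S n); rewrite addrA subrK.
have := D2 n k; rewrite /S; lra.
Qed.

Lemma geometric_cvg u (C : R) l : (forall n, modc (l - \sum_(i < n) u i) <= C * 2^-1 ^+ n) ->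
  limn (series u : nat -> R[i]^o) = l.
Proof.
move=> h; apply/(@cvg_lim (R[i]^o)); first exact: norm_hausdorff.
apply: cvg_modc => e e0; have [N hN] := half_pow_small C e0.
exists N => n /hN; apply: le_lt_trans; rewrite modc_dist /series/= big_mkord; exact: h.
Qed.

End complex_series.
Section operators.
Variables (R : realType) (M : nat -> R).
Hypothesis M_gt0 : forall p, 0 < M p.
Implicit Types (u v : R -> R) (h N r : R) (c : ultra_class).

Lemma of_class_imply c (a b : nat -> R[i]) : (forall p, modc (b p) = modc (a p)) ->
  of_class c M a -> of_class c M b.
Proof.
case: c => /= E.
  by move=> [l [C [l0 C0 hC]]]; exists l, C; split => // p p0; rewrite E; exact: hC.
by move=> H l /H[C [C0 hC]]; exists C; split => // p p0; rewrite E; exact: hC.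
Qed.

Lemma Dtest_support c (phi : R -> R[i]) : carrier (Dtest M c) phi -> exists r N : R,
  [/\ 0 < r, 0 < N, smooth phi, (forall p t, r < `|t| -> cderiv p phi t = 0) &
   forall t, modc (phi t) <= N].
Proof.
move=> /(carrier_DtestP M_gt0)[h1 h2].
have [B1 hB1] := EL1_bounded 0 (ET_EL1 h1); have [B2 hB2] := EL1_bounded 0 (ET_EL1 h2).
have [s1 [r1 [r10 c1]] _] := h1; have [s2 [r2 [r20 c2]] _] := h2.
have r0 : 0 < Num.max r1 r2 by rewrite lt_max r10.
exists (Num.max r1 r2), (`|B1| + `|B2| + 1); split => //.
- move=> p t; rewrite gt_max => /andP[t1 t2].
  by rewrite /cderiv (csupp_derive p c1)// (csupp_derive p c2).
- move=> t; apply: le_trans (modc_le _) _.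
  have := hB1 t; have := hB2 t => /=; have := ler_norm B1; have := ler_norm B2; lra.
Qed.

(** The class of a gives C l^p / M_p, the class of phi gives N M_p / h^p, and h = 2 l leaves 2^(-p).
    In the Beurling case l comes from a and every h is available for phi; in the Roumieu case h
    comes from phi and every l is available for a. *)
Lemma class_symbol_bound c (a : nat -> R[i]) (phi : R -> R[i]) :
  of_class c M a -> carrier (Dtest M c) phi -> exists2 C : R,
  0 < C & forall p t, modc (a p) * modc (cderiv p phi t) <= C * 2^-1 ^+ p.
Proof.
move=> ha /(carrier_DtestP M_gt0)[[_ _ h1] [_ _ h2]].
have [h [C [N1 [N2 [h0 C0 hC [N10 b1] [N20 b2]]]]]] : exists h C N1 N2 : R,
   [/\ 0 < h, 0 < C, forall p, (0 < p)%N -> modc (a p) <= C * (h / 2) ^+ p / M p,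
     0 < N1 /\ supb M h N1 (fun t => complex.Re (phi t)) &
     0 < N2 /\ supb M h N2 (fun t => complex.Im (phi t))].
  case: c ha h1 h2 => /=.
    move=> [l [C [l0 C0 hC]]] h1 h2; have l2 : 0 < 2 * l by rewrite mulr_gt0.
    have [N1 ?] := h1 _ l2; have [N2 ?] := h2 _ l2.
    by exists (2 * l), C, N1, N2; split => //; rewrite (mulrC 2) mulfK.
  move=> ha [k1 [k10 [N1 [N10 b1]]]] [k2 [k20 [N2 [N20 b2]]]].
  have h0 : 0 < Num.min k1 k2 by rewrite lt_min k10.
  have [C [C0 hC]] := ha (Num.min k1 k2 / 2) (divr_gt0 h0 (ltr0Sn _ 1)).
  exists (Num.min k1 k2), C, N1, N2; split => //; split => //.
    by apply: (supbW M_gt0 h0 _ (ltW N10) (lexx _) b1); rewrite ge_min lexx.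
  by apply: (supbW M_gt0 h0 _ (ltW N20) (lexx _) b2); rewrite ge_min lexx orbT.
(* [of_class] says nothing about p = 0; that term contributes its own constant modc (a 0) * M 0. *)
have a0 := modc_ge0 (a 0%N).
have aM : 0 <= modc (a 0%N) * M 0%N by rewrite mulr_ge0// ltW.
have D p t : modc (cderiv p phi t) <= (N1 + N2) * M p / h ^+ p.
  by apply: le_trans (modc_le _) _; rewrite !mulrDl; apply: lerD; [exact: b1|exact: b2].
exists ((C + modc (a 0%N) * M 0%N) * (N1 + N2)).
  by apply: mulr_gt0; [exact: ltr_wpDr|exact: addr_gt0].
move=> [|p] t.
  have := D 0%N t; rewrite !expr0 divr1 mulr1 => D0.
  apply: le_trans (ler_wpM2l a0 D0) _; nra.
apply: le_trans (ler_pM (modc_ge0 _) (modc_ge0 _) (hC p.+1 isT) (D p.+1 t)) _.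
have -> : C * (h / 2) ^+ p.+1 / M p.+1 * ((N1 + N2) * M p.+1 / h ^+ p.+1) =
   C * (N1 + N2) * 2^-1 ^+ p.+1.
  rewrite expr_div_n -exprVn; field.
  by rewrite expf_neq0 ?(lt0r_neq0 h0)//= (lt0r_neq0 (M_gt0 _)).
rewrite ler_wpM2r ?exprn_ge0 ?invr_ge0//.
have : 0 <= modc (a 0%N) * M 0%N * (N1 + N2) by rewrite mulr_ge0// addr_ge0 ?(ltW N10) ?(ltW N20).
rewrite mulrDl; lra.
Qed.

Lemma cderiv_uc (phi : R -> R[i]) r p : smooth phi -> (forall t, r < `|t| -> cderiv p phi t = 0) ->
  forall e : R, 0 < e -> exists2 d : R, 0 < d &
    forall x y, `|x - y| < d -> modc (cderiv p phi x - cderiv p phi y) <= e.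
Proof.
move=> /smoothP[s1 s2] van e e0.
apply: (@heine R (fun x y => modc (cderiv p phi x - cderiv p phi y)) (- r) r) => //.
- by move=> x y; exact: modc_dist.
- by move=> x y z; apply: le_trans (modcD _ _); rewrite addrA subrK.
- move=> t e' e'0; have e2 : 0 < e' / 2 by rewrite divr_gt0.
  have c1 := rsmooth_cont (p := p) s1; have c2 := rsmooth_cont (p := p) s2.
  have := c1 t; move=> /cvgrPdist_lt /(_ _ e2) /nbhs_ballP[d1 /= d10 h1].
  have := c2 t; move=> /cvgrPdist_lt /(_ _ e2) /nbhs_ballP[d2 /= d20 h2].
  exists (Num.min d1 d2); first by rewrite lt_min d10.
  move=> s; rewrite lt_min => /andP[/h1 ts1 /h2 ts2].
  apply: (@le_lt_trans _ _ _ _ _ (modc_le (cderiv p phi s - cderiv p phi t))).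
  rewrite /cderiv/= distrC [X in _ + X]distrC; lra.
- move=> x y hx hy; have av z : z < - r \/ r < z -> r < `|z|.
    by move=> hz; rewrite ltr_normr; apply/orP; case: hz => ?; [right|left]; lra.
  by rewrite (van _ (av _ hx)) (van _ (av _ hy)) subrr modcR normr0.
Qed.

Lemma modcX p (w : R[i]) : modc (w ^+ p) = modc w ^+ p.
Proof.
by elim: p => [|p IH]; [rewrite !expr0 modcR normr1|rewrite !exprS modcM IH].
Qed.

Lemma modc_sign1 p : modc ((-1 : R[i]) ^+ p) = 1.
Proof. by rewrite modcX modcN modcR normr1 expr1n. Qed.

Lemma modc_sign p (a z : R[i]) : modc ((-1) ^+ p * a * ((- 'i%C) ^+ p * z)) = modc a * modc z.
Proof.
have e2 : modc (- 'i%C : R[i]) = 1.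
  by rewrite modcN /ComplexField.Normc.normc expr0n/= expr1n add0r sqrtr1.
by rewrite !modcM modc_sign1 modcX e2 expr1n !mul1r.
Qed.

Lemma transpose_op_tail c (a : nat -> R[i]) (phi : R -> R[i]) :
  of_class c M a -> carrier (Dtest M c) phi -> exists2 C : R, 0 < C & forall t n,
  modc (transpose_op a phi t - \sum_(p < n) (-1) ^+ p * a p * ((- 'i%C) ^+ p * cderiv p phi t)) <=
  2 * C * 2^-1 ^+ n.
Proof.
move=> ha hphi; have [C C0 hC] := class_symbol_bound ha hphi.
exists C => // t n; have [|l hl] := @geometric_tail R
  (fun p => (-1) ^+ p * a p * ((- 'i%C) ^+ p * cderiv p phi t)) C (ltW C0).
  by move=> p; rewrite modc_sign.
by rewrite /transpose_op (geometric_cvg hl).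
Qed.

(** The partial sums are uniformly continuous and [transpose_op_tail] is uniform in t, so the limit
    has the properties that [AA_conv] asks of a kernel. *)
Lemma transpose_op_kernel c (a : nat -> R[i]) (phi : R -> R[i]) :
  of_class c M a -> carrier (Dtest M c) phi -> exists r K, conv_kernel (transpose_op a phi) r K.
Proof.
move=> ha hphi; have [C C0 hC] := transpose_op_tail ha hphi.
have [r [N [r0 N0 sphi van _]]] := Dtest_support hphi.
exists r, (2 * C); split => //; first by rewrite mulr_gt0.
- move=> t rt; apply: (@geometric_cvg _ _ 0) => n.
  by rewrite big1 ?subrr ?modcR ?normr0 ?mul0r// => p _; rewrite van// !mulr0.
- by move=> t; have := hC t 0%N; rewrite big_ord0 subr0 expr0 mulr1.
move=> e e0; have e4 : 0 < e / 4 by rewrite divr_gt0.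
have [n hn] := half_pow_small (2 * C) e4.
have {}hn := hn n (leqnn n).
pose S n t := \sum_(p < n) (-1) ^+ p * a p * ((- 'i%C) ^+ p * cderiv p phi t).
have uS m (e' : R) : 0 < e' -> exists2 d : R, 0 < d & forall x y, `|x - y| < d -> modc (S m x - S m y) <= e'.
  elim: m e' => [|m IH] e' e'0.
    by exists 1 => // x y _; rewrite /S !big_ord0 subrr modcR normr0 ltW.
  have [|d1 d10 h1] := IH (e' / 2); first by rewrite divr_gt0.
  have a1 : 0 < modc (a m) + 1 by rewrite ltr_wpDl ?modc_ge0.
  have [|d2 d20 h2] := cderiv_uc sphi (van m) (e := e' / 2 / (modc (a m) + 1)).
    by rewrite !divr_gt0.
  exists (Num.min d1 d2); first by rewrite lt_min d10.
  move=> x y; rewrite lt_min => /andP[/h1 xy1 /h2 xy2].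
  rewrite /S !big_ord_recr/= -/(S m x) -/(S m y) opprD addrACA -!mulrBr.
  apply: le_trans (modcD _ _) _; rewrite modc_sign.
  rewrite (splitr e'); apply: lerD => //; rewrite ler_pdivlMr// in xy2.
  by have := modc_ge0 (cderiv m phi x - cderiv m phi y); nra.
have e2 : 0 < e / 2 by rewrite divr_gt0.
have [d d0 hd] := uS n _ e2; exists d => // x y /hd.
have := hC x n; have := hC y n; rewrite -!/(S _ _) (modc_dist _ (S n y)).
have := modcD (transpose_op a phi x - S n x) (S n x - S n y); rewrite addrA subrK.
have := modcD (transpose_op a phi x - S n y) (S n y - transpose_op a phi y); rewrite addrA subrK.
lra.
Qed.

Lemma Dtest_kernel c (phi : R -> R[i]) : carrier (Dtest M c) phi -> exists r K, conv_kernel phi r K.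
Proof.
move=> hphi; have [r [N [r0 N0 sphi van hN]]] := Dtest_support hphi.
have E t : cderiv 0 phi t = phi t by rewrite /cderiv /=; case: (phi t).
exists r, N; split => //.
- by move=> t rt; rewrite -E van.
- by move=> e /(cderiv_uc sphi (van 0%N))[d d0 hd]; exists d => // x y /hd; rewrite !E.
Qed.

Lemma cderiv_refl p (phi : R -> R[i]) (x t : R) : smooth phi ->
  cderiv p (fun s => phi (x - s)) t = (-1) ^+ p * cderiv p phi (x - t).
Proof.
move=> /smoothP[s1 s2]; rewrite /cderiv.
have [_ ->] := rsmooth_refl x s1; have [_ ->] := rsmooth_refl x s2.
have -> : (-1) ^+ p = ((-1) ^+ p : R)%:C :> R[i] by rewrite rmorphXn/= rmorphN1.
by apply/eqP; rewrite eq_complex/=; apply/andP; split; apply/eqP; ring.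
Qed.

Lemma transpose_op_refl (a b : nat -> R[i]) (phi : R -> R[i]) (x t : R) : smooth phi ->
  (forall p, b p = (-1) ^+ p * a p) ->
  transpose_op a (fun s => phi (x - s)) t = transpose_op b phi (x - t).
Proof.
move=> sphi hb; rewrite /transpose_op (_ : (fun p => _) = (fun p : nat =>
  (-1) ^+ p * b p * ((- 'i%C) ^+ p * cderiv p phi (x - t))))//.
by apply/funext => p; rewrite cderiv_refl// hb; ring.
Qed.

(** Reflection turns a_p into (-1)^p a_p, of the same class, so T * phi is the sum of the
    convolutions of f with [transpose_op b phi] and of g with phi. *)
Lemma ii_to_iii (X : completeNormedModType R[i]) c (T : (R -> R[i]) -> X) :
  assertion_ii c M T -> assertion_iii c M T.
Proof.
move=> [a [ha [f [g [Af Ag hT]]]]] phi hphi.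
have [_ [_ [_ _ sphi _ _]]] := Dtest_support hphi.
pose b p : R[i] := (-1) ^+ p * a p.
have hb : of_class c M b.
  by apply: of_class_imply ha => p; rewrite modcM modc_sign1 mul1r.
have [r [K hk]] := transpose_op_kernel hb hphi.
have [r' [K' hk']] := Dtest_kernel hphi.
have -> : Defs.conv T phi = (fun x =>
    1 *: vint (fun t => transpose_op b phi (x - t) *: f t) +
    vint (fun t => phi (x - t) *: g t)).
  apply/funext => x; rewrite /Defs.conv hT.
    have E : transpose_op a (fun t => phi (x - t)) = (fun t => transpose_op b phi (x - t)).
      by apply/funext => t; exact: transpose_op_refl.
    by rewrite /apply_op /regular E scale1r.
  move/(carrier_DtestP M_gt0): hphi => [h1 h2].
  exact: ((carrier_DtestP M_gt0 c (fun t => phi (x - t))).2 (conj (ET_refl x h1) (ET_refl x h2))).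
by apply: AA_lin; [exact: AA_conv hk Af|exact: AA_conv hk' Ag].
Qed.

End operators.

(** * The fundamental solution of the product operator *)

Section exponential_kernels.
Variable R : realType.
Implicit Types (u w : R -> R) (g B L : R).
Notation mu := (@lebesgue_measure R).

(** Correlation with [kplus g], resp. [kminus g], inverts 1 - (d/dx) / g, resp. 1 + (d/dx) / g; see
    [corr_kplus_derive] and [corr_kminus_derive]. *)
Definition kplus g : R -> R := exponential_pdf g.

Definition kminus g : R -> R := fun s => kplus g (0 - s).

Lemma kplus_prob g : 0 < g -> prob_density (kplus g).
Proof.
move=> g0; split; first exact: integrable_exponential_pdf.
- by move=> x; apply: exponential_pdf_ge0; exact: ltW.
- by rewrite /Rintegral integral_exponential_pdf.
Qed.

Lemma kminus_prob g : 0 < g -> prob_density (kminus g).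
Proof. by move=> g0; exact/prob_refl/kplus_prob. Qed.

Lemma kplusE g (s : R) : 0 <= s -> kplus g s = g * expR (- g * s).
Proof. by move=> s0; rewrite /kplus exponential_pdfE. Qed.

Lemma kplus_lt0 g (s : R) : s < 0 -> kplus g s = 0.
Proof. exact: lt0_exponential_pdf. Qed.

(** On the ray up to b, exp (g x) is a constant multiple of the density x -> kplus g (b - x). *)
Lemma exp_integrable_ray g w (b : R) : 0 < g -> continuous w -> (exists B, forall x, `|w x| <= B) ->
  mu.-integrable `]-oo, b] (EFin \o (fun x => expR (g * x) * w x)).
Proof.
move=> g0 cw [B wB]; have mw := continuous_measurable_fun cw.
have [i1 _ _] := prob_refl b (kplus_prob g0).
have i2 := integrable_scale (expR (g * b) / g) (integrable_bmul i1 mw wB).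
apply: (@eq_integrable _ _ _ mu _ _ (EFin \o (fun x => expR (g * b) / g * (kplus g (b - x) * w x)))).
- exact: measurable_itv.
- move=> x; rewrite inE/= in_itv/= => xb; congr EFin; rewrite kplusE ?subr_ge0// mulrA; congr (_ * _).
  rewrite mulrA divfK ?(lt0r_neq0 g0)// -expRD; congr expR; ring.
- by apply: (@integrableS _ _ _ mu setT).
Qed.

(** In this form the variable t appears in an exponential and in the upper limit of an integral, so
    the product rule yields the differential equation. *)
Lemma corr_kminusE g w (t : R) : 0 < g -> continuous w -> (exists B, forall x, `|w x| <= B) ->
  corr (kminus g) w t = g * expR (- g * t) * \int[mu]_(x in `]-oo, t]) (expR (g * x) * w x).
Proof.
move=> g0 cw wB; have mw := continuous_measurable_fun cw.
have [i1 _ _] := kminus_prob g0; have [m1 _] := n1_integrable i1.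
rewrite corrE// -RintegralZl//; last exact: exp_integrable_ray.
rewrite [RHS]Rintegral_mkcond; apply: eq_Rintegral => x _; rewrite patchE.
have E : 0 - (x - t) = t - x by ring.
rewrite /kminus E; case: ifPn; rewrite mem_setE in_itv/=.
  move=> xt; rewrite kplusE ?subr_ge0// mulrA; congr (_ * _).
  by rewrite -mulrA -expRD; congr (_ * expR _); ring.
by rewrite -ltNge => tx; rewrite kplus_lt0 ?mul0r// subr_lt0.
Qed.

Lemma corr_kminus_derive g w (t : R) : 0 < g -> continuous w -> (exists B, forall x, `|w x| <= B) ->
  is_derive t 1 (corr (kminus g) w) (g * (w t - corr (kminus g) w t)).
Proof.
move=> g0 cw wB.
have -> : corr (kminus g) w = (fun t => g * expR (- g * t) * \int[mu]_(x in `]-oo, t]) (expR (g * x) * w x)).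
  by apply/funext => s; exact: corr_kminusE.
have ce : continuous (fun x : R => expR (g * x)).
  move=> x; apply: (@continuous_comp _ _ _ (fun x : R => g * x) expR); last exact: continuous_expR.
  by apply: cvgM; [exact: cvg_cst|exact: cvg_id].
have ci : continuous (fun x : R => expR (g * x) * w x).
  by move=> x; apply: cvgM; [exact: ce|exact: cw].
have d1 := antiderivative_ray t ci (fun b => exp_integrable_ray b g0 cw wB).
set I := fun y => _ in d1.
have d2 : is_derive t 1 (fun t : R => g * expR (- g * t)) (- g * (g * expR (- g * t))).
  by apply: is_derive_eq; rewrite /GRing.scale/=; ring.
have d3 : is_derive t 1 (fun t : R => g * expR (- g * t) * I t)
  (g * expR (- g * t) *: (expR (g * t) * w t) + I t *: (- g * (g * expR (- g * t)))) by exact: is_deriveM.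
apply: is_derive_eq; rewrite /GRing.scale/= -/(I t).
have : expR (- g * t) * expR (g * t) = 1 by rewrite -expRD mulNr addNr expR0.
set a := expR (- g * t); set b := expR (g * t) => ab.
have -> : g * a * (b * w t) = (a * b) * (g * w t) by ring.
by rewrite ab; ring.
Qed.

Lemma Rintegral_opp w : measurable_fun setT w -> \int[mu]_x w (- x) = \int[mu]_x w x.
Proof.
move=> mw; rewrite /Rintegral; congr fine.
have mE : measurable_fun setT (EFin \o w) by exact/measurable_EFinP.
rewrite integralE [RHS]integralE; congr (_ - _)%E.
  rewrite -[RHS]ge0_integral_opp//; last exact: measurable_funepos.
  by apply: eq_integral => x _; rewrite ?funeposE.
rewrite -[RHS]ge0_integral_opp//; last exact: measurable_funeneg.
by apply: eq_integral => x _; rewrite ?funenegE.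
Qed.

Lemma corr_kplus_refl g w (t : R) : 0 < g -> measurable_fun setT w ->
  corr (kplus g) w t = corr (kminus g) (fun x => w (- x)) (- t).
Proof.
move=> g0 mw.
have [i1 _ _] := kminus_prob g0; have [m1 _] := n1_integrable i1.
have [i2 _ _] := kplus_prob g0; have [m2 _] := n1_integrable i2.
have mwN : measurable_fun setT (fun x : R => w (- x)).
  by apply: (measurableT_comp mw); exact: oppr_measurable.
rewrite corrE// corrE// -Rintegral_opp.
  by apply: eq_Rintegral => x _; rewrite /kminus; congr (kplus _ _ * _); ring.
by apply: measurable_funM => //; apply: measurableT_comp => //; exact: measurable_funB.
Qed.

Lemma corr_kplus_derive g w (t : R) : 0 < g -> continuous w -> (exists B, forall x, `|w x| <= B) ->
  is_derive t 1 (corr (kplus g) w) (- g * (w t - corr (kplus g) w t)).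
Proof.
move=> g0 cw [B wB]; have mw := continuous_measurable_fun cw.
have cwN : continuous (fun x => w (- x)).
  by move=> x; apply: (@continuous_comp _ _ _ -%R w); [exact: oppr_continuous|exact: cw].
have wBN : exists B, forall x, `|w (- x)| <= B by exists B.
have E : corr (kplus g) w = (fun t => corr (kminus g) (fun x => w (- x)) (- t)).
  by apply/funext => s; exact: corr_kplus_refl.
have d := corr_kminus_derive (- t) g0 cwN wBN.
rewrite opprK in d.
by rewrite E; apply: is_derive_eq; rewrite /GRing.scale/=; ring.
Qed.

Lemma lip_derive_le u (x d L : R) : is_derive x 1 u d ->
  (forall a b, `|u a - u b| <= L * `|a - b|) -> `|d| <= L.
Proof.
move=> [du <-] hu; apply/ler_addgt0Pr => e e0.
have /cvgrPdist_lt/(_ e e0) H := du; near (0 : R)^' => h.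
have h0 : h != 0 by near: h; exact: nbhs_dnbhs_neq.
have : `|'D_1 u x - h^-1 *: (u (h *: (1 : R) + x) - u x)| < e by near: h; exact: H.
have := hu (h *: (1 : R) + x) x; rewrite addrK /GRing.scale/= mulr1 => h1 h2.
have h3 : `|h^-1 * (u (h + x) - u x)| <= L.
  by rewrite normrM normfV ler_pdivrMl ?normr_gt0// mulrC.
have := ler_normD ('D_1 u x - h^-1 * (u (h + x) - u x)) (h^-1 * (u (h + x) - u x)).
rewrite subrK; lra.
Unshelve. all: by end_near.
Qed.

(** By the differential equation the difference is the derivative of the average divided by g, and
    the average keeps the Lipschitz constant L. *)
Lemma corr_kplus_close g B L w (x : R) : 0 < g -> good B L w -> `|corr (kplus g) w x - w x| <= L * g^-1.
Proof.
move=> g0 gw; have cw := lip_cont gw.2; have wB := good_bound gw.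
have d := corr_kplus_derive x g0 cw (ex_intro _ B wB).
have := lip_derive_le d (corr_good (kplus_prob g0) gw).2.
by rewrite normrM normrN (gtr0_norm g0) distrC mulrC ler_pdivlMr.
Qed.

Lemma corr_kminus_close g B L w (x : R) : 0 < g -> good B L w -> `|corr (kminus g) w x - w x| <= L * g^-1.
Proof.
move=> g0 gw; have cw := lip_cont gw.2; have wB := good_bound gw.
have d := corr_kminus_derive x g0 cw (ex_intro _ B wB).
have := lip_derive_le d (corr_good (kminus_prob g0) gw).2.
by rewrite normrM (gtr0_norm g0) distrC mulrC ler_pdivlMr.
Qed.

(* The fundamental solution of 1 - D ^ 2 (here D = d/dx). *)
Definition laplace : R -> R := fun x => 2^-1 * expR (- `|x|).

Lemma laplace_good : good 2^-1 2^-1 laplace.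
Proof.
have key (a b : R) : 0 <= b -> b <= a -> expR (- b) - expR (- a) <= a - b.
  move=> b0 ba; have -> : expR (- b) - expR (- a) = expR (- b) * (1 - expR (- (a - b))).
    by rewrite mulrBr mulr1 -expRD; congr (_ - expR _); ring.
  have h1 : expR (- b) <= 1 by rewrite -expR0 ler_expR; lra.
  have h2 := expR_ge1Dx (- (a - b)).
  have h3 : expR (- (a - b)) <= 1 by rewrite -expR0 ler_expR; lra.
  have := expR_ge0 (- b); nra.
split => [x|x y]; rewrite /laplace.
  have h1 : expR (- `|x|) <= 1 by rewrite -expR0 ler_expR oppr_le0.
  have := expR_ge0 (- `|x|) => h2; apply/andP; split; lra.
rewrite -mulrBr normrM ger0_norm ?invr_ge0// ler_wpM2l ?invr_ge0//.
apply: le_trans (ler_dist_dist x y).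
have [xy|/ltW xy] := leP `|x| `|y|.
  have h := key _ _ (normr_ge0 x) xy.
  have e0 : 0 <= expR (- `|x|) - expR (- `|y|) by rewrite subr_ge0 ler_expR lerN2.
  by rewrite (ger0_norm e0) distrC; apply: le_trans h (ler_norm _).
have h := key _ _ (normr_ge0 y) xy.
have e0 : 0 <= expR (- `|y|) - expR (- `|x|) by rewrite subr_ge0 ler_expR lerN2.
by rewrite distrC (ger0_norm e0); apply: le_trans h (ler_norm _).
Qed.

(** 0 is excluded: both densities equal 1 there, so the right-hand side would be 1 instead of 1 / 2.
    Integral identities use the formula almost everywhere. *)
Lemma laplaceE (x : R) : x != 0 -> laplace x = 2^-1 * (kplus 1 x + kminus 1 x).
Proof.
move=> x0; rewrite /laplace /kminus sub0r; congr (_ * _).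
have [xn|xp] := ltP x 0.
  by rewrite (ltr0_norm xn) (kplus_lt0 _ xn) add0r kplusE ?oppr_ge0 ?ltW// mul1r mulN1r.
have xp' : 0 < x by rewrite lt_neqAle eq_sym x0.
by rewrite (gtr0_norm xp') (kplusE _ xp) kplus_lt0 ?oppr_lt0// addr0 mul1r mulN1r.
Qed.

Lemma laplace_n1 : (n1 laplace <= 1%:E)%E.
Proof.
have [i1 p1 _] := kplus_prob (@ltr01 R); have [m1 _] := n1_integrable i1.
have [i2 p2 _] := kminus_prob (@ltr01 R); have [m2 _] := n1_integrable i2.
have -> : 1%:E = (`|2^-1|%:E * (n1 (kplus 1) + n1 (kminus 1)))%E :> \bar R.
  rewrite (prob_n1 (kplus_prob (@ltr01 R))) (prob_n1 (kminus_prob (@ltr01 R))) ger0_norm ?invr_ge0//.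
  by rewrite -[X in (_ * X)%E]/((1 + 1)%:E) -EFinM; congr EFin; lra.
have ml := good_meas laplace_good; have ms := measurable_funD m1 m2.
apply: le_trans (lee_wpmul2l _ (n1D m1 m2)); last by rewrite lee_fin.
rewrite -n1Z//; apply: le_n1 => //; first exact: measurable_funM.
move=> x; have [->|x0] := eqVneq x 0; last by rewrite laplaceE.
rewrite /laplace /kminus subrr normr0 oppr0 expR0 kplusE// mulr0 expR0 !mulr1.
rewrite ger0_norm ?invr_ge0// ger0_norm; lra.
Qed.

Lemma corr_kplus_inv g w (w' : R -> R) (t : R) : 0 < g -> (forall x : R, is_derive x 1 w (w' x)) -> continuous w' ->
  (exists B, forall x, `|w x| <= B) -> (exists B, forall x, `|w' x| <= B) ->
  corr (kplus g) w t - g^-1 * corr (kplus g) w' t = w t.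
Proof.
move=> g0 dw cw' wB [B' wB']; have cw := is_derive_cont dw; have [B hB] := wB.
have mw := continuous_measurable_fun cw.
have [i1 _ _] := kplus_prob g0.
have d1 := corr_kplus_derive t g0 cw wB.
have d2 := is_derive_corr t i1 dw mw hB wB'.
have [_ e1] := d1; have [_ e2] := d2.
by rewrite -e2 e1; field; exact: lt0r_neq0.
Qed.

Lemma corr_kminus_inv g w (w' : R -> R) (t : R) : 0 < g -> (forall x : R, is_derive x 1 w (w' x)) -> continuous w' ->
  (exists B, forall x, `|w x| <= B) -> (exists B, forall x, `|w' x| <= B) ->
  corr (kminus g) w t + g^-1 * corr (kminus g) w' t = w t.
Proof.
move=> g0 dw cw' wB [B' wB']; have cw := is_derive_cont dw; have [B hB] := wB.
have mw := continuous_measurable_fun cw.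
have [i1 _ _] := kminus_prob g0.
have d1 := corr_kminus_derive t g0 cw wB.
have d2 := is_derive_corr t i1 dw mw hB wB'.
have [_ e1] := d1; have [_ e2] := d2.
by rewrite -e2 e1; field; exact: lt0r_neq0.
Qed.

(* Partial fractions: 1 / (1 - D ^ 2) = (1 / (1 - D) + 1 / (1 + D)) / 2. *)
Lemma corr_laplace_inv w (t : R) : rsmooth w -> (forall p, exists B, forall x, `|w^[p] x| <= B) ->
  corr laplace w t - corr laplace w^[2] t = w t.
Proof.
move=> sw bw; have o0 := @ltr01 R.
have [i1 _ _] := kplus_prob o0; have [m1 _] := n1_integrable i1.
have [i2 _ _] := kminus_prob o0; have [m2 _] := n1_integrable i2.
have E p : corr laplace w^[p] t = 2^-1 * (corr (kplus 1) w^[p] t + corr (kminus 1) w^[p] t).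
  have mp := rsmooth_meas p sw; have [B hB] := bw p.
  have ii1 := corr_int t i1 mp hB; have ii2 := corr_int t i2 mp hB.
  rewrite /corr -RintegralD// -RintegralZl//; last first.
    exact: (integrableD measurableT ii1 ii2).
  rewrite /Rintegral; congr fine; apply: ae_eq_integral => //.
  - apply/measurable_EFinP; apply: measurable_funM; last exact: measurable_shift.
    exact: (good_meas laplace_good).
  - apply/measurable_EFinP; apply: measurable_funM => //.
    by apply: measurable_funD; [exact: (n1_integrable ii1).1|exact: (n1_integrable ii2).1].
  - exists [set 0]; split; [exact: measurable_set1|exact: lebesgue_measure_set1|].
    move=> x /= h; apply: contrapT => x0; apply: h => _.
    by rewrite laplaceE ?mulrDl -?mulrA ?mulrDl//; exact/eqP.
have D p (x : R) : is_derive x 1 w^[p] (w^[p.+1] x) by exact: rsmooth_is_derive.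
have c p := rsmooth_cont (p := p) sw.
have a0 := corr_kplus_inv t o0 (D 0%N) (c 1%N) (bw 0%N) (bw 1%N).
have a1 := corr_kplus_inv t o0 (D 1%N) (c 2%N) (bw 1%N) (bw 2%N).
have b0 := corr_kminus_inv t o0 (D 0%N) (c 1%N) (bw 0%N) (bw 1%N).
have b1 := corr_kminus_inv t o0 (D 1%N) (c 2%N) (bw 1%N) (bw 2%N).
rewrite -[X in corr _ X t - _]/(w^[0]) -[RHS]/(w^[0] t) !E.
move: a0 a1 b0 b1.
move: (corr (kplus 1) w^[0] t) (corr (kplus 1) w^[1] t) (corr (kplus 1) w^[2] t).
move: (corr (kminus 1) w^[0] t) (corr (kminus 1) w^[1] t) (corr (kminus 1) w^[2] t).
move: (w^[0] t) (w^[1] t) => z0 z1 y0 y1 y2 x0 x1 x2.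
rewrite invr1 !mul1r; lra.
Qed.

End exponential_kernels.

(** * Coefficients of finite and infinite products *)

Section product_coefficients.
Variables (R : realType) (c : nat -> R).
Hypothesis c_gt0 : forall n, 0 < c n.
Implicit Types (n k : nat) (w : nat -> R).

(* [bcoef n k] is the coefficient of y ^ k in (1 + y) prod_(i < n) (1 + c i * y). *)
Fixpoint bcoef n k : R :=
  if n is n'.+1 then bcoef n' k + c n' * (if k is k'.+1 then bcoef n' k' else 0)
  else (k < 2)%:R.

Lemma bcoef_ge0 n k : 0 <= bcoef n k.
Proof.
elim: n k => [|n IH] k /=; first exact: ler0n.
by apply: addr_ge0 => //; apply: mulr_ge0; [exact: ltW|case: k].
Qed.

Lemma bcoef_mono k n m : (n <= m)%N -> bcoef n k <= bcoef m k.
Proof.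
elim: m => [|m IH]; first by rewrite leqn0 => /eqP ->.
rewrite leq_eqVlt => /predU1P[->//|]; rewrite ltnS => /IH h.
apply: le_trans h _; rewrite /= lerDl; apply: mulr_ge0; first exact: ltW.
by case: {IH} k => // k; exact: bcoef_ge0.
Qed.

Lemma bcoef_diag k : 0 < bcoef k k.
Proof.
elim: k => [|k IH] /=; first exact: ltr01.
by apply: ltr_wpDl; [exact: bcoef_ge0|exact: mulr_gt0].
Qed.

Lemma bcoef_high n k : (n.+2 <= k)%N -> bcoef n k = 0.
Proof.
elim: n k => [|n IH] [|k]//= h; first by case: k h.
by rewrite (IH k.+1) ?(IH k) ?mulr0 ?addr0//; exact: ltnW.
Qed.

(** The polynomial of [bcoef], of degree n + 1, with y^k replaced by w k. Powers of a number give
    the product itself; derivatives of even order give the operator. *)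
Definition symb n w : R := \sum_(k < n.+2) bcoef n k * w k.

Lemma symb0 w : symb 0 w = w 0%N + w 1%N.
Proof. by rewrite /symb !big_ord_recr big_ord0/= add0r !mul1r. Qed.

(** Multiplying the polynomial by 1 + c n * y amounts to adding c n times the shift of w to w. *)
Lemma symbS n w : symb n.+1 w = symb n (fun k => w k + c n * w k.+1).
Proof.
rewrite /symb /=.
have -> : \sum_(k < n.+3) (bcoef n k + c n * (if val k is k'.+1 then bcoef n k' else 0)) * w k =
    \sum_(k < n.+3) bcoef n k * w k +
    \sum_(k < n.+3) c n * (if val k is k'.+1 then bcoef n k' else 0) * w k.
  by rewrite -big_split; apply: eq_bigr => k _; rewrite mulrDl.
rewrite big_ord_recr/= bcoef_high// mul0r addr0 [X in _ + X]big_ord_recl/= mulr0 mul0r add0r.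
by rewrite -big_split; apply: eq_bigr => k _; rewrite /= mulrDr; congr (_ + _); rewrite mulrCA mulrA.
Qed.

Lemma symb_scale n (a : R) w : symb n (fun k => a * w k) = a * symb n w.
Proof. by rewrite /symb mulr_sumr; apply: eq_bigr => k _; rewrite mulrCA. Qed.

Lemma symb_prod n (y : R) : symb n (fun k => y ^+ k) = (1 + y) * \prod_(i < n) (1 + c i * y).
Proof.
elim: n => [|n IH]; first by rewrite symb0 big_ord0 mulr1 expr0 expr1.
rewrite symbS big_ord_recr/= mulrA -IH mulrC -symb_scale; congr (symb n _).
by apply/funext => k; rewrite exprS; ring.
Qed.

(** Cauchy's estimate: with nonnegative coefficients, one term is at most the whole polynomial at
    t. *)
Lemma bcoef_le n k (t : R) : 0 < t -> bcoef n k <= (1 + t) * \prod_(i < n) (1 + c i * t) / t ^+ k.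
Proof.
move=> t0; have tk : 0 < t ^+ k by exact: exprn_gt0.
rewrite ler_pdivlMr// -symb_prod.
have s0 : 0 <= symb n (fun k => t ^+ k).
  by apply: sumr_ge0 => i _; apply: mulr_ge0; [exact: bcoef_ge0|exact/exprn_ge0/ltW].
have [kn|nk] := ltnP k n.+2; last by rewrite bcoef_high// mul0r.
rewrite /symb (bigD1 (Ordinal kn))//= lerDl.
by apply: sumr_ge0 => i _; apply: mulr_ge0; [exact: bcoef_ge0|exact/exprn_ge0/ltW].
Qed.

Lemma prod_le_expR n (x : nat -> R) : (forall i, 0 <= x i) ->
  \prod_(i < n) (1 + x i) <= expR (\sum_(i < n) x i).
Proof.
move=> x0; elim: n => [|n IH]; first by rewrite !big_ord0 expR0.
rewrite !big_ord_recr/= expRD; apply: ler_pM => //.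
- by apply: prodr_ge0 => i _; rewrite addr_ge0.
- by rewrite addr_ge0.
- exact: expR_ge1Dx.
Qed.

Variable S : R.
Hypothesis c_sum : forall n, \sum_(i < n) c i <= S.

Lemma prod_bound n (t : R) : 0 < t -> \prod_(i < n) (1 + c i * t) <= expR (S * t).
Proof.
move=> t0; apply: le_trans (prod_le_expR n (x := fun i => c i * t) _) _.
  by move=> i; rewrite mulr_ge0// ltW.
by rewrite ler_expR -mulr_suml ler_wpM2r// ltW.
Qed.

Lemma bcoef_cvg k : exists a : R, (fun n => bcoef n k) @ \oo --> a /\ forall n, bcoef n k <= a.
Proof.
have nd : {homo (fun n => bcoef n k) : n m / (n <= m)%N >-> n <= m}.
  by move=> n m; exact: bcoef_mono.
have ub : has_ubound (range (fun n => bcoef n k)).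
  exists ((1 + 1) * expR (S * 1)) => _ [n _ <-].
  apply: le_trans (bcoef_le n k ltr01) _; rewrite expr1n divr1.
  by rewrite ler_wpM2l// prod_bound.
exists (sup (range (fun n => bcoef n k))); split.
  exact: nondecreasing_cvgn.
by move=> n; apply: ub_le_sup => //; exists n.
Qed.

(** Coefficient of y^k in the infinite product, as a limit of the nondecreasing [bcoef n k]. *)
Definition acoef k : R := projT1 (cid (bcoef_cvg k)).

Lemma acoef_cvg k : (fun n => bcoef n k) @ \oo --> acoef k.
Proof. by rewrite /acoef; case: cid => a []. Qed.

Lemma bcoef_le_acoef n k : bcoef n k <= acoef k.
Proof. by rewrite /acoef; case: cid => a []. Qed.

Lemma acoef_gt0 k : 0 < acoef k.
Proof. exact: lt_le_trans (bcoef_diag k) (bcoef_le_acoef k k). Qed.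

Lemma acoef_le k (t B : R) : 0 < t -> (forall n, (1 + t) * \prod_(i < n) (1 + c i * t) <= B) ->
  acoef k <= B / t ^+ k.
Proof.
move=> t0 hB; apply/ler_addgt0Pr => e e0.
have /cvgrPdist_lt/(_ e e0)[N _ hN] := @acoef_cvg k.
have := hN N (leqnn N) => /=; have := bcoef_le N k t0.
have : (1 + t) * \prod_(i < N) (1 + c i * t) / t ^+ k <= B / t ^+ k.
  by rewrite ler_wpM2r// invr_ge0 exprn_ge0// ltW.
rewrite ltr_norml => h1 h2 /andP[h3 h4]; lra.
Qed.

Lemma acoef_small (x : R) : exists2 C : R, 0 < C & forall k, acoef k * x ^+ k.*2 <= C * 2^-1 ^+ k.
Proof.
(* Cauchy's estimate at t = 2 x^2 + 1 leaves (x^2 / t)^k <= 2^(-k); the 1 keeps t positive at x =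
   0. *)
have t0 : 0 < 2 * x ^+ 2 + 1 by rewrite ltr_wpDl// mulr_ge0// sqr_ge0.
exists ((1 + (2 * x ^+ 2 + 1)) * expR (S * (2 * x ^+ 2 + 1))).
  by rewrite mulr_gt0// ?expR_gt0//; lra.
move=> k; have := @acoef_le k _ ((1 + (2 * x ^+ 2 + 1)) * expR (S * (2 * x ^+ 2 + 1))) t0.
set t := 2 * x ^+ 2 + 1 in t0 *; set B := _ * expR _.
have B0 : 0 <= B by rewrite mulr_ge0 ?expR_ge0//; lra.
have hB n : (1 + t) * \prod_(i < n) (1 + c i * t) <= B.
  by rewrite ler_wpM2l ?prod_bound//; lra.
move=> /(_ hB) h; have x2 : 0 <= x ^+ 2 := sqr_ge0 x.
have xk : 0 <= x ^+ k.*2 by rewrite -muln2 mulnC exprM exprn_ge0.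
apply: le_trans (ler_wpM2r xk h) _.
rewrite -mulrA ler_wpM2l// mulrC -muln2 mulnC exprM -expr_div_n.
by apply: lerXn2r; rewrite ?nnegrE ?divr_ge0 ?invr_ge0 ?(ltW t0)// ler_pdivrMr// /t; lra.
Qed.

Lemma geometric_sum_tail (C : R) K m : 0 <= C ->
  \sum_(K <= k < m) C * 2^-1 ^+ k <= 2 * C * 2^-1 ^+ K.
Proof.
move=> C0; have [mK|Km] := leqP m K.
  by rewrite big_geq// !mulr_ge0// exprn_ge0// invr_ge0.
have : \sum_(K <= k < m) C * 2^-1 ^+ k = 2 * C * (2^-1 ^+ K - 2^-1 ^+ m).
  elim: m Km => // m IH; rewrite ltnS leq_eqVlt => /predU1P[<-|Km].
    by rewrite big_nat1 exprS; lra.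
  by rewrite big_nat_recr ?(ltnW Km)//= IH// exprS; lra.
move=> ->; have : 0 <= (2^-1 : R) ^+ m by rewrite exprn_ge0// invr_ge0.
nra.
Qed.

(** Tannery's theorem: beyond a cut K both sums are geometrically small, and the first K
    coefficients converge. N is chosen before w, which gives uniformity in the point when w is made
    of derivatives at that point. *)
Lemma symb_tannery (C e : R) : 0 < C -> 0 < e -> exists N, forall n, (N <= n)%N -> forall w l,
  (forall k, acoef k * `|w k| <= C * 2^-1 ^+ k) ->
  (forall m, `|l - \sum_(k < m) acoef k * w k| <= 2 * C * 2^-1 ^+ m) ->
  `|symb n w - l| <= e.
Proof.
move=> C0 e0; have e4 : 0 < e / 4 by rewrite divr_gt0.
have [K hK] := half_pow_small (2 * C) e4; have {}hK := hK K (leqnn K).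
(* The largest |w k| that the hypothesis allows; it makes the finite part uniform in w. *)
pose W k := C * 2^-1 ^+ k / acoef k.
have W0 k : 0 <= W k.
  by rewrite divr_ge0 ?(ltW (acoef_gt0 k))// mulr_ge0 ?(ltW C0)// exprn_ge0// invr_ge0.
have [N hN] : exists N, forall n, (N <= n)%N -> \sum_(k < K) (acoef k - bcoef n k) * W k <= e / 4.
  elim: K {hK} (e / 4) e4 => [|k IH] d d0.
    by exists 0%N => n _; rewrite big_ord0 ltW.
  have d2 : 0 < d / 2 by rewrite divr_gt0.
  have [N1 h1] := IH _ d2.
  have d3 : 0 < d / 2 / (W k + 1) by rewrite divr_gt0// ltr_wpDl.
  have /cvgrPdist_lt/(_ _ d3)[N2 _ h2] := @acoef_cvg k.
  exists (maxn N1 N2) => n; rewrite geq_max => /andP[/h1 n1 /h2/= n2].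
  rewrite big_ord_recr/= (splitr d); apply: lerD => //.
  have ab : 0 <= acoef k - bcoef n k by rewrite subr_ge0 bcoef_le_acoef.
  rewrite ger0_norm// ltr_pdivlMr in n2; last by rewrite ltr_wpDl.
  have := W0 k; nra.
exists (maxn N K) => n; rewrite geq_max => /andP[/hN nN nK] w l hw hl.
have wW k : `|w k| <= W k by rewrite /W ler_pdivlMr ?acoef_gt0// mulrC.
have split_sum : symb n w = \sum_(k < K) bcoef n k * w k + \sum_(K <= k < n.+2) bcoef n k * w k.
  rewrite /symb -(big_mkord xpredT (fun k => bcoef n k * w k)).
  by rewrite (@big_cat_nat _ _ _ K)//= ?big_mkord//; exact: leqW (leqW nK).
have h1 : `|\sum_(k < K) bcoef n k * w k - \sum_(k < K) acoef k * w k| <= e / 4.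
  rewrite -sumrB; apply: le_trans (ler_norm_sum _ _ _) _; apply: le_trans nN.
  apply: ler_sum => k _; have ab : 0 <= acoef k - bcoef n k by rewrite subr_ge0 bcoef_le_acoef.
  by rewrite -mulrBl normrM distrC (ger0_norm ab) ler_wpM2l.
have h2 : `|\sum_(K <= k < n.+2) bcoef n k * w k| <= 2 * C * 2^-1 ^+ K.
  apply: le_trans (ler_norm_sum _ _ _) _; apply: le_trans (geometric_sum_tail K n.+2 (ltW C0)).
  apply: ler_sum => k _; apply: le_trans (hw k); rewrite normrM (ger0_norm (bcoef_ge0 n k)).
  by rewrite ler_wpM2r// bcoef_le_acoef.
have h3 := hl K.
rewrite split_sum; set A := \sum_(k < K) bcoef n k * w k in h1 *.
set A' := \sum_(k < K) acoef k * w k in h1 h3; set T := bigop _ _ _ in h2 *.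
have -> : A + T - l = (A - A') + T - (l - A') by ring.
apply: le_trans (ler_normB _ _) _; have := ler_normD (A - A') T; lra.
Qed.

End product_coefficients.

(** * Growth of the coefficients *)

Section symbol_class.
Variables (R : realType) (M : nat -> R).
Hypothesis M_gt0 : forall p, 0 < M p.
Hypothesis M_0 : M 0%N = 1.
Hypothesis hM1 : cond_M1 M.

(* [mq i] is m_(i+1). *)
Definition mq (i : nat) : R := M i.+1 / M i.

Lemma mq_gt0 i : 0 < mq i.
Proof. by rewrite divr_gt0. Qed.

Lemma mq_mono i j : (i <= j)%N -> mq i <= mq j.
Proof.
elim: j => [|j IH]; first by rewrite leqn0 => /eqP ->.
rewrite leq_eqVlt => /predU1P[->//|]; rewrite ltnS => /IH h; apply: le_trans h _.
rewrite /mq ler_pdivrMr// mulrAC ler_pdivlMr//.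
by have := @hM1 j.+1 isT; rewrite expr2.
Qed.

Lemma mq_prod k : \prod_(i < k) mq i = M k.
Proof.
elim: k => [|k IH]; first by rewrite big_ord0 M_0.
by rewrite big_ord_recr/= IH /mq mulrC divfK// lt0r_neq0.
Qed.

(** In terms of the quotients, (M.3) reads m_(p+1) (1 / m_(p+1) + 1 / m_(p+2) + ...) <= A p; the
    index shift comes from [mq i] being m_(i+1). *)
Lemma M3_sum : cond_M3 M -> exists A : R, forall p n, (0 < p)%N ->
  \sum_(i < n) mq p / mq (p + i) <= A * p%:R.
Proof.
move=> hM3; have [A hA] : exists A : R, forall p, (0 < p)%N -> (\sum_(p.+1 <= q <oo)
      (M q.-1 * M p.+1 / (p%:R * M p * M q))%:E <= A%:E)%E.
  have h p : (0 < p)%N -> (\sum_(p.+1 <= q <oo) (M q.-1 * M p.+1 / (p%:R * M p * M q))%:E <=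
      ereal_sup [set (\sum_(p.+1 <= q <oo) (M q.-1 * M p.+1 / (p%:R * M p * M q))%:E)%E
    | p in [set p : nat | (0 < p)%N]])%E.
    by move=> p0; apply: ereal_sup_ubound; exists p.
  move: hM3 h; rewrite /cond_M3; set s := ereal_sup _; case: s => [A| |] hs h.
  - by exists A.
  - by [].
  - exists 0 => p /h; rewrite leeNy_eq => /eqP ->; exact: leNye.
exists A => p n p0; have p0' : (0 : R) < p%:R by rewrite ltr0n.
have pos q : 0 <= M q.-1 * M p.+1 / (p%:R * M p * M q).
  by rewrite divr_ge0// !mulr_ge0// ltW.
have h1 : \sum_(p.+1 <= q < p.+1 + n) M q.-1 * M p.+1 / (p%:R * M p * M q) <= A.
  rewrite -lee_fin -sumEFin; apply: le_trans (hA p p0).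
  by apply: nneseries_lim_ge => i _ _; rewrite lee_fin.
have -> : \sum_(i < n) mq p / mq (p + i) = p%:R * \sum_(p.+1 <= q < p.+1 + n) M q.-1 * M p.+1 / (p%:R * M p * M q).
  rewrite -{1}(add0n p.+1) big_addn addKn big_mkord mulr_sumr.
  apply: eq_bigr => i _; rewrite /mq addnS/= addnC.
  by field; rewrite !lt0r_neq0//= !lt0r_neq0.
by rewrite mulrC ler_wpM2r// ltW.
Qed.

Variable l : R.
Hypothesis l_gt0 : 0 < l.

Definition csym (i : nat) : R := ((l * mq i) ^+ 2)^-1.

Lemma csym_gt0 i : 0 < csym i.
Proof. by rewrite invr_gt0 exprn_gt0// mulr_gt0// mq_gt0. Qed.

Lemma csym_sum : cond_M3' M -> exists S : R, forall n, \sum_(i < n) csym i <= S.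
Proof.
move=> /(M3'_sum M_gt0)[S hS].
have mi i : 0 <= (mq i)^-1 by rewrite invr_ge0 ltW// mq_gt0.
have hS' n : \sum_(i < n) (mq i)^-1 <= S.
  by apply: le_trans (hS n); apply: ler_sum => i _; rewrite /mq invf_div.
have S0 : 0 <= S by have := hS 0%N; rewrite big_ord0.
have le1 i : (mq i)^-1 <= S.
  by apply: le_trans (hS' i.+1); rewrite big_ord_recr/= lerDr; apply: sumr_ge0.
exists (l ^- 2 * (S * S)) => n.
apply: (@le_trans _ _ (\sum_(i < n) l ^- 2 * (S * (mq i)^-1))).
  apply: ler_sum => i _; rewrite /csym exprMn invfM ler_wpM2l ?invr_ge0 ?exprn_ge0 ?(ltW l_gt0)//.
  by rewrite -exprVn expr2 ler_wpM2r.
by rewrite -mulr_sumr -mulr_sumr ler_wpM2l ?invr_ge0 ?exprn_ge0 ?(ltW l_gt0)// ler_wpM2l.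
Qed.

Lemma csym_ratio k i : csym i * (l * mq k) ^+ 2 = (mq k / mq i) ^+ 2.
Proof.
rewrite /csym; have := mq_gt0 i; have := mq_gt0 k => h1 h2.
by field; rewrite !lt0r_neq0.
Qed.

Lemma prod_weaken (F : nat -> R) k n : (forall i, 1 <= F i) ->
  \prod_(i < n) F i <= \prod_(i < k + n) F i.
Proof.
move=> F1; have F0 i : 0 <= F i by exact: le_trans (F1 i).
rewrite addnC; elim: k => [|k IH]; first by rewrite addn0.
rewrite addnS big_ord_recr/=; apply: le_trans IH _.
by rewrite ler_peMr//; apply: prodr_ge0.
Qed.

(** The factors are 1 + r^2 with r = mq k / mq i. The first k + 1 have r >= 1 and are at most 2 r^2,
    whose product is explicit; the others have r <= 1, hence r^2 <= r, and the exponential of their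
    sum is bounded by (M.3) at p = k + 1. The product is first lengthened by k + 1 factors so that
    it always splits this way. *)
Lemma csym_prod_bound (A : R) : (forall p n, (0 < p)%N -> \sum_(i < n) mq p / mq (p + i) <= A * p%:R) ->
  forall k n, \prod_(i < n) (1 + csym i * (l * mq k) ^+ 2) <=
    (2 * expR A) ^+ k.+1 * mq k ^+ k.+1.*2 / M k.+1 ^+ 2.
Proof.
move=> hA k n.
under eq_bigr do rewrite csym_ratio.
pose F i : R := 1 + (mq k / mq i) ^+ 2.
have F1 i : 1 <= F i by rewrite lerDl sqr_ge0.
apply: le_trans (@prod_weaken F k.+1 n F1) _; rewrite big_split_ord/=.
have -> : (2 * expR A) ^+ k.+1 * mq k ^+ k.+1.*2 / M k.+1 ^+ 2 =
    (2 ^+ k.+1 * mq k ^+ k.+1.*2 / M k.+1 ^+ 2) * expR A ^+ k.+1 by rewrite exprMn; ring.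
have F0 i : 0 <= F i by exact: le_trans (F1 i).
apply: ler_pM; [exact: prodr_ge0|exact: prodr_ge0| |].
  have -> : 2 ^+ k.+1 * mq k ^+ k.+1.*2 / M k.+1 ^+ 2 = \prod_(i < k.+1) (2 * (mq k / mq i) ^+ 2).
    rewrite big_split/= prodr_const card_ord -mulrA; congr (_ * _).
    under [RHS]eq_bigr do rewrite expr_div_n.
    rewrite prodf_div prodr_const card_ord -exprM mul2n; congr (_ / _).
    by rewrite -(mq_prod k.+1) prodrXl.
  apply: ler_prod => i _; rewrite F0/= /F.
  have : 1 <= (mq k / mq i) ^+ 2.
    by rewrite exprn_ege1// ler_pdivlMr ?mq_gt0// mul1r mq_mono// -ltnS.
  lra.
apply: le_trans (prod_le_expR n (x := fun i => (mq k / mq (k.+1 + i)) ^+ 2) _) _.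
  by move=> i; exact: sqr_ge0.
rewrite -expRM_natr ler_expR; apply: le_trans (hA k.+1 n isT); apply: ler_sum => i _.
have r0 j : 0 <= mq k / mq j by rewrite divr_ge0 ?(ltW (mq_gt0 _)).
have r1 : mq k / mq (k.+1 + i) <= 1.
  by rewrite ler_pdivrMr ?mq_gt0// mul1r mq_mono// addSn leqW// leq_addr.
apply: (@le_trans _ _ (mq k / mq (k.+1 + i))).
  by rewrite expr2 ler_piMr.
by rewrite ler_wpM2r ?invr_ge0 ?(ltW (mq_gt0 _))// mq_mono.
Qed.

(* Cauchy's estimate [acoef_le] is used at t = (l m_k)^2, where (M.3) bounds the
   factors of index larger than k by exp (B k). *)
Lemma acoef_class (S : R) (hS : forall n, \sum_(i < n) csym i <= S) :
  cond_M2_inf M -> cond_M3 M -> exists C Q : R, [/\ 0 < C, 0 < Q &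
    forall k, (0 < k)%N -> acoef csym_gt0 hS k <= C * Q ^+ k.*2 / M k.*2].
Proof.
move=> [A [H [A1 H1 hM2]]] /M3_sum[B hB].
have A0 : 0 < A by lra.
have H0 : 0 < H by lra.
have l2 : 0 < l ^+ 2 by exact: exprn_gt0.
have eB : 0 < expR B := expR_gt0 B.
pose Q := 2 * expR B * H ^+ 4 / l ^+ 2.
have Q0 : 0 < Q by rewrite divr_gt0// mulr_gt0 ?mulr_gt0 ?exprn_gt0.
pose C := A * (1 + (l * A * M 1%N) ^+ 2).
have C0 : 0 < C by rewrite mulr_gt0// ltr_wpDr// sqr_ge0.
(* The class is tested at order 2k, so Q^k has to be bounded by a power of exponent 2k; Q <= (1 +
   Q)^2 achieves this. *)
exists C, (1 + Q); split => //; first by lra.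
case=> // k _; have m0 := mq_gt0 k; have Mk := M_gt0 k.+1.
have t0 : 0 < (l * mq k) ^+ 2 by rewrite exprn_gt0// mulr_gt0.
have := @acoef_le _ csym csym_gt0 S hS k.+1 _ ((1 + (l * mq k) ^+ 2) *
   ((2 * expR B) ^+ k.+1 * mq k ^+ k.+1.*2 / M k.+1 ^+ 2)) t0 => h.
apply: le_trans (h _) _ => {h}.
  by move=> n; rewrite ler_wpM2l// ?addr_ge0 ?(ltW t0)//; exact: csym_prod_bound.
have -> : (1 + (l * mq k) ^+ 2) * ((2 * expR B) ^+ k.+1 * mq k ^+ k.+1.*2 / M k.+1 ^+ 2) /
   (l * mq k) ^+ 2 ^+ k.+1 = (1 + (l * mq k) ^+ 2) * ((2 * expR B / l ^+ 2) ^+ k.+1 / M k.+1 ^+ 2).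
  rewrite (expr_div_n (2 * expR B)) [(l * mq k) ^+ 2]exprMn [in X in _ / X](exprMn _ (l ^+ 2)) -(exprM (mq k)) mul2n.
  by field; rewrite !expf_neq0 ?lt0r_neq0.
(* The stability condition with i = 1 bounds [mq k] by a geometric sequence, which absorbs the
   factor 1 + t of the product. *)
have E1 : 1 + (l * mq k) ^+ 2 <= (1 + (l * A * M 1%N) ^+ 2) * (H ^+ k.+1) ^+ 2.
  have hm : mq k <= A * M 1%N * H ^+ k.+1.
    rewrite /mq ler_pdivrMr//; apply: le_trans (hM2 k.+1 isT 1%N isT) _.
    by rewrite subn1/= le_eqVlt; apply/orP; left; apply/eqP; ring.
  have hH : 1 <= (H ^+ k.+1) ^+ 2 by rewrite -exprM exprn_ege1// ltW.
  have : (l * mq k) ^+ 2 <= (l * A * M 1%N) ^+ 2 * (H ^+ k.+1) ^+ 2.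
    rewrite -exprMn -!mulrA; apply: lerXn2r; rewrite ?nnegrE.
    - by apply: mulr_ge0; exact: ltW.
    - by rewrite mulr_ge0 ?(ltW l_gt0)// mulr_ge0 ?(ltW A0)// mulr_ge0 ?(ltW (M_gt0 _))// exprn_ge0// ltW.
    - by rewrite ler_wpM2l ?(ltW l_gt0)// mulrA.
  by rewrite mulrDl mul1r; lra.
(* The stability condition split in the middle compares M_(2k+2) with M_(k+1)^2. *)
have E2 : (M k.+1 ^+ 2)^-1 <= A * (H ^+ k.+1) ^+ 2 / M k.+1.*2.
  rewrite ler_pdivlMr// mulrC ler_pdivrMr ?exprn_gt0//.
  have := hM2 k.+1.*2 isT k.+1; rewrite -addnn leq_addr addnK => /(_ isT).
  by rewrite -expr2 -exprM muln2 addnn.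
have X0 : 0 <= (2 * expR B / l ^+ 2) ^+ k.+1.
  by rewrite exprn_ge0// divr_ge0 ?(ltW l2)// mulr_ge0// ltW.
apply: (@le_trans _ _ ((1 + (l * A * M 1%N) ^+ 2) * (H ^+ k.+1) ^+ 2 *
    ((2 * expR B / l ^+ 2) ^+ k.+1 * (A * (H ^+ k.+1) ^+ 2 / M k.+1.*2)))).
  apply: ler_pM => //.
  - by rewrite addr_ge0 ?(ltW t0).
  - by rewrite mulr_ge0// invr_ge0 exprn_ge0// ltW.
  - by rewrite ler_wpM2l.
have -> : (1 + (l * A * M 1%N) ^+ 2) * (H ^+ k.+1) ^+ 2 *
    ((2 * expR B / l ^+ 2) ^+ k.+1 * (A * (H ^+ k.+1) ^+ 2 / M k.+1.*2)) =
    C * Q ^+ k.+1 / M k.+1.*2.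
  have -> : Q ^+ k.+1 = (2 * expR B / l ^+ 2) ^+ k.+1 * ((H ^+ k.+1) ^+ 2 * (H ^+ k.+1) ^+ 2).
    rewrite -exprD -exprM mulnC exprM -exprMn; congr (_ ^+ _); rewrite /Q; ring.
  by rewrite /C; ring.
rewrite ler_wpM2r ?invr_ge0 ?(ltW (M_gt0 _))// ler_wpM2l ?(ltW C0)//.
rewrite -mul2n exprM; apply: lerXn2r; rewrite ?nnegrE ?(ltW Q0) ?sqr_ge0//.
by rewrite expr2; nra.
Qed.

End symbol_class.

(** * The chain of exponential kernels *)

Section resolvent_chain.
Variables (R : realType) (M : nat -> R).
Hypothesis M_gt0 : forall p, 0 < M p.
Hypothesis M_0 : M 0%N = 1.
Hypothesis hM1 : cond_M1 M.
Hypothesis hM3' : cond_M3' M.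
Variable l : R.
Hypothesis l_gt0 : 0 < l.
Notation mu := (@lebesgue_measure R).
Implicit Types (psi : R -> R).

Definition rate (j : nat) : R := l * mq M j./2.

(* The two kernels of rate l m_i together invert 1 - (d/dx)^2 / (l m_i)^2. *)
Definition rker (j : nat) : R -> R := if odd j then kminus (rate j) else kplus (rate j).

Definition rsign (j : nat) : R := if odd j then rate j else - rate j.

Lemma rate_gt0 j : 0 < rate j.
Proof. by rewrite mulr_gt0// mq_gt0. Qed.

Lemma rker_prob j : prob_density (rker j).
Proof.
by rewrite /rker; case: ifP => _; [exact: kminus_prob (rate_gt0 j)|exact: kplus_prob (rate_gt0 j)].
Qed.

Lemma rker_close B L j w : good B L w -> forall x, `|corr (rker j) w x - w x| <= L * (rate j)^-1.
Proof.
move=> gw x; rewrite /rker; case: ifP => _.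
  exact: corr_kminus_close (rate_gt0 j) gw.
exact: corr_kplus_close (rate_gt0 j) gw.
Qed.

Lemma rate_sum : exists S : R, forall n, \sum_(j < n) (rate j)^-1 <= S.
Proof.
have [S hS] := M3'_sum M_gt0 hM3'.
have r0 j : 0 <= (rate j)^-1 by rewrite invr_ge0 ltW// rate_gt0.
have half n : \sum_(j < n.*2) (rate j)^-1 = 2 * l^-1 * \sum_(i < n) M i / M i.+1.
  elim: n => [|n IH]; first by rewrite !big_ord0 mulr0.
  rewrite doubleS !big_ord_recr/= IH /rate/= uphalf_double doubleK mulrDr -addrA; congr (_ + _).
  by rewrite invfM /mq invf_div; ring.
exists (2 * l^-1 * S) => n; apply: (@le_trans _ _ (\sum_(j < n.*2) (rate j)^-1)).
  rewrite -addnn; elim: (X in (n + X)%N) => [|m IH]; first by rewrite addn0.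
  by rewrite addnS big_ord_recr/=; apply: le_trans IH _; rewrite lerDl.
rewrite half ler_wpM2l//; apply: mulr_ge0 => //.
by rewrite invr_ge0 ltW.
Qed.

(** Fatou's lemma, the convergence being only pointwise. *)
Lemma n1_limit (f : nat -> R -> R) (g : R -> R) (B : R) : (forall n, measurable_fun setT (f n)) ->
  (forall x, (fun n => f n x) @ \oo --> g x) -> (forall n, (n1 (f n) <= B%:E)%E) -> (n1 g <= B%:E)%E.
Proof.
move=> mf fg hB.
have := @fatou _ _ _ mu _ measurableT (fun n x => (`|f n x|)%:E) (fun n => measurable_norm (mf n)).
have f0 n x : [set: R] x -> (0 <= (`|f n x|)%:E)%E by rewrite lee_fin.
move=> /(_ f0) H; rewrite /n1.
have -> : (\int[mu]_x (`|g x|)%:E = \int[mu]_x limn_einf (fun n => (`|f n x|)%:E))%E.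
  apply: eq_integral => x _.
  have h : (fun n => (`|f n x|)%:E) @ \oo --> (`|g x|)%:E.
    by apply: cvg_EFin; [exact: nearW|exact: cvg_norm].
  have h' : cvgn (fun n => (`|f n x|)%:E) by apply/cvg_ex; exists (`|g x|)%:E.
  by rewrite (is_cvg_limn_einfE h') (cvg_lim _ h).
apply: le_trans H _.
rewrite limn_einf_lim; apply: lime_le; first exact: is_cvg_einfs.
apply: nearW => n; apply: (@le_trans _ _ (n1 (f n))); last exact: hB.
by apply: ereal_inf_lbound; exists n => /=.
Qed.

(** v_p is the fundamental solution of 1 - (d/dx)^2 times the first-order factors inverted by the
    kernels of index at least p; so v_0 is G, and v_p tends to [laplace]. The terms + 0 put the
    relation in the form of [chain_smooth], with zero shift and e = 0. *)
Definition resolvent_chain (v : nat -> R -> R) :=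
  [/\ forall p, good 2^-1 2^-1 (v p),
      forall p (x : R), is_derive x 1 (v p) (rsign p * (v p.+1 (x + 0) - v (p + 0)%N x)),
      forall p, (n1 (v p) <= 1%:E)%E &
      forall e : R, 0 < e -> exists N, forall p, (N <= p)%N -> forall x, `|v p x - @laplace R x| <= e].

Lemma resolvent_chain_exists : exists v, resolvent_chain v.
Proof.
have [S hS] := rate_sum.
have r0 j : 0 <= (rate j)^-1 by rewrite invr_ge0 ltW// rate_gt0.
have h2 : 0 <= 2^-1 :> R by rewrite invr_ge0.
have [v [tau [gv vE vc vu [tau0 _ _]]]] := chain_limit rker_prob (laplace_good R) h2 r0 hS
  (fun j w gw x => rker_close j gw x).
exists v; split => //.
- move=> p x; rewrite addr0 addn0 (vE p).
  have cw := lip_cont (gv p.+1).2; have wB := good_bound (gv p.+1).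
  rewrite /rker /rsign; case: ifP => _.
    exact: corr_kminus_derive (rate_gt0 p) cw (ex_intro _ _ wB).
  exact: corr_kplus_derive (rate_gt0 p) cw (ex_intro _ _ wB).
- move=> p; have gc n := chain_good p n rker_prob (laplace_good R).
  apply: (n1_limit (fun n => good_meas (gc n)) (vc p)) => n.
  elim: n p {gc} => [|n IH] p; first exact: laplace_n1.
  have gc := chain_good p.+1 n rker_prob (laplace_good R).
  have [i1 _ _] := rker_prob p; have [m1 _] := n1_integrable i1.
  apply: le_trans (corr_n1 m1 (good_meas gc)) _.
  by rewrite (prob_n1 (rker_prob p)) mul1e.
- move=> e e0; move/cvgrPdist_lt: tau0 => /(_ e e0)[N _ hN]; exists N => p /hN/=.
  rewrite sub0r normrN => h x; apply: le_trans (vu p x) _.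
  have := ler_norm (tau p); lra.
Qed.

Section chain.
Variable v : nat -> R -> R.
Hypothesis hv : resolvent_chain v.

Let dv := let: And4 _ h _ _ := hv in h.

Lemma rsign_norm p : `|rsign p| = rate p.
Proof. by rewrite /rsign; case: ifP => _; rewrite ?normrN gtr0_norm// rate_gt0. Qed.

Lemma chain_L1 q p : (n1 (v p)^[q] <= (1 * \prod_(i < q) (2 * `|rsign (p + i)%N|))%:E)%E.
Proof.
have [_ _ hn _] := hv; have [_ ->] := chain_smooth dv p.
apply: (chain_der_n1 dv (erefl 0%N) hn ler01) => j.
rewrite !rsign_norm; apply: ler_wpM2l; first exact: ltW.
by apply: (mq_mono M_gt0 hM1); apply: half_leq; exact: leqnSn.
Qed.

(** Each derivative costs twice a rate. The i-th rate is l times [mq] at i / 2, at most l times [mq]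
    at i, and the product of the latter gives (2 l)^q M_q. *)
Lemma chain_L1b : L1b M (2 * l)^-1 1 (v 0%N).
Proof.
move=> q; apply: le_trans (chain_L1 q 0) _; rewrite lee_fin.
have -> : 1 * M q / (2 * l)^-1 ^+ q = 1 * \prod_(i < q) (2 * l * mq M i).
  by rewrite big_split/= prodr_const card_ord mq_prod// exprVn invrK; ring.
rewrite !mul1r; apply: ler_prod => i _; rewrite mulr_ge0//= add0n rsign_norm /rate -mulrA.
rewrite ler_wpM2l// ler_wpM2l ?(ltW l_gt0)//; apply: mq_mono => //.
by rewrite -[leqRHS]doubleK half_leq// -addnn leq_addr.
Qed.

Lemma chain_tame p : [/\ rsmooth (v p), mu.-integrable setT (EFin \o v p) &
  forall q, exists B : R, forall x, `|(v p)^[q] x| <= B].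
Proof.
have [sv _] := chain_smooth dv p.
have f q : (n1 (v p)^[q] < +oo)%E by apply: le_lt_trans (chain_L1 q p) _; rewrite ltry.
split => //; first by apply: integrable_n1; [exact: (rsmooth_meas 0 sv)|exact: (f 0%N)].
move=> q; exists (fine (n1 (v p)^[q]) + fine (n1 (v p)^[q.+1])); apply: n1_bounded.
- by move=> x; exact: rsmooth_is_derive.
- exact: rsmooth_cont.
- exact: f.
- exact: f.
Qed.

Definition tame psi := rsmooth psi /\ exists2 r : R, 0 < r & csupp r psi.

Lemma tame_props psi : tame psi -> [/\ forall q, mu.-integrable setT (EFin \o psi^[q]) &
  forall q, exists B : R, forall x, `|psi^[q] x| <= B].
Proof.
move=> [s [r r0 cs]]; split => q.
  exact: (csupp_integrable (rsmooth_cont (p := q) s) r0 (csupp_derive q cs)).2.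
exact: (csupp_integrable (rsmooth_cont (p := q) s) r0 (csupp_derive q cs)).1.
Qed.

Lemma derive1n_add q k (u : R -> R) : (u^[k])^[q] = u^[(q + k)%N].
Proof. by elim: q => [//|q IH]; rewrite derive1nS IH addSn -derive1nS. Qed.

Lemma tame_derive psi k : tame psi -> tame psi^[k].
Proof.
move=> [s [r r0 cs]]; split; last by exists r => //; exact: csupp_derive.
by move=> p x; rewrite derive1n_add; exact: s.
Qed.

Lemma corr_lin k (a : R) (f g : R -> R) (t : R) : mu.-integrable setT (EFin \o k) -> tame f -> tame g ->
  corr k (fun x => a * f x + g x) t = a * corr k f t + corr k g t.
Proof.
move=> ik tf tg; have [_ bf] := tame_props tf; have [_ bg] := tame_props tg.
have [B hB] := bf 0%N; have [B' hB'] := bg 0%N.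
have i1 := corr_int t ik (rsmooth_meas 0 tf.1) hB.
have i2 := corr_int t ik (rsmooth_meas 0 tg.1) hB'.
rewrite /corr -RintegralZl// -RintegralD//; last exact: integrable_scale.
by apply: eq_Rintegral => s _; ring.
Qed.

(** The relations at 2i and 2i + 1 have the same rate and opposite signs, so v_(2i+2) = v_(2i) - c_i
    v_(2i)''; inside the correlation the two derivatives are moved onto psi. *)
Lemma chain_step i psi (t : R) : tame psi ->
  corr (v i.*2.+2) psi t = - csym M l i * corr (v i.*2) psi^[2] t + corr (v i.*2) psi t.
Proof.
move=> tp; have [ip bp] := tame_props tp; have [sv iv bv] := chain_tame i.*2.
have [_ E] := chain_smooth dv i.*2.
have ig : csym M l i = (rate i.*2 ^+ 2)^-1 by rewrite /rate doubleK.
have r0 := rate_gt0 i.*2.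
have E2 x : v i.*2.+2 x = - csym M l i * (v i.*2)^[2] x + v i.*2 x.
  rewrite E /= !addr0 !addn0 /rsign/= odd_double/=.
  have -> : rate i.*2.+1 = rate i.*2 by rewrite /rate/= uphalf_double doubleK.
  by rewrite ig; field; exact: lt0r_neq0.
have E3 : corr (v i.*2) psi^[2] t = corr (v i.*2)^[2] psi t.
  have [_ <-] := rsmooth_corr iv tp.1 bp.
  by have [_ ->] := rsmooth_corr2 (ip 0%N) sv bv; rewrite sqrrN expr1n mul1r.
have [mp _] := n1_integrable (ip 0%N).
have [sv2 iv2 _] := chain_tame i.*2.+2.
have [B2 hB2] := bv 2%N; have [B0 hB0] := bv 0%N.
rewrite E3 !corrE//; try exact: (rsmooth_meas 0 sv); try exact: (rsmooth_meas 0 sv2); try exact: (rsmooth_meas 2 sv).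
have m2 : measurable_fun setT (fun x : R => (v i.*2)^[2] (x - t)).
  by apply: (measurableT_comp (rsmooth_meas 2 sv)); exact: measurable_funB.
have m0 : measurable_fun setT (fun x : R => v i.*2 (x - t)).
  by apply: (measurableT_comp (rsmooth_meas 0 sv)); exact: measurable_funB.
have j2 : mu.-integrable setT (EFin \o (fun x => (v i.*2)^[2] (x - t) * psi x)).
  under eq_fun do rewrite mulrC.
  exact: integrable_bmul (ip 0%N) m2 (fun x => hB2 (x - t)).
have j0 : mu.-integrable setT (EFin \o (fun x => v i.*2 (x - t) * psi x)).
  under eq_fun do rewrite mulrC.
  exact: integrable_bmul (ip 0%N) m0 (fun x => hB0 (x - t)).
rewrite -RintegralZl// -RintegralD//; last exact: integrable_scale.
by apply: eq_Rintegral => x _; rewrite E2; ring.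
Qed.

(** Partial product of the operator: y = x^2 stands for -(d/dx)^2, so y^k acts as (-1)^k times the
    derivative of order 2k. *)
Definition prod_op n psi (t : R) : R := symb (csym M l) n (fun k => (-1) ^+ k * psi^[k.*2] t).

(** Each factor applied to psi removes two kernels of the chain, by [chain_step]; the factor 1 + y
    remains and gives psi - psi''. *)
Lemma chain_op n psi (t : R) : tame psi ->
  corr (v 0%N) (prod_op n psi) t = corr (v n.*2) psi t - corr (v n.*2) psi^[2] t.
Proof.
elim: n psi => [|n IH] psi tp.
  have -> : prod_op 0 psi = (fun x => -1 * psi^[2] x + psi x).
    by apply/funext => x; rewrite /prod_op symb0 expr0 expr1 mul1r addrC.
  have [_ iv _] := chain_tame 0.
  by rewrite (corr_lin _ _ iv (tame_derive 2 tp) tp) mulN1r addrC.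
pose chi x : R := - csym M l n * psi^[2] x + psi x.
have t2 := tame_derive 2 tp.
have [schi Dchi] := rsmooth_lin (- csym M l n) t2.1 tp.1.
have tchi : tame chi.
  split => //; have [_ [r r0 cs]] := tp; exists r => // x hx.
  by rewrite /chi (csupp_derive 2 cs hx) (cs _ hx) mulr0 addr0.
have -> : prod_op n.+1 psi = prod_op n chi.
  apply/funext => x; rewrite /prod_op symbS; congr (symb _ _ _); apply/funext => k.
  rewrite Dchi derive1n_add addn2 doubleS exprS; ring.
rewrite (IH _ tchi) Dchi derive1n_add.
have [_ iv _] := chain_tame n.*2.
have E1 : corr (v n.*2) chi t = corr (v n.+1.*2) psi t.
  by rewrite doubleS (chain_step n t tp) (corr_lin _ t iv t2 tp).
have E2 : corr (v n.*2) (fun x => - csym M l n * psi^[4] x + psi^[2] x) t = corr (v n.+1.*2) psi^[2] t.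
  by rewrite doubleS (chain_step n t t2) derive1n_add (corr_lin _ t iv (tame_derive 4 tp) t2).
by rewrite E1 -E2.
Qed.

(** Let n tend to infinity in [chain_op]: the left side tends to corr v_0 P, and on the right v_(2n)
    tends uniformly to [laplace], which [corr_laplace_inv] inverts. *)
Lemma chain_inverse (P psi : R -> R) (B t : R) : tame psi ->
  measurable_fun setT P -> (forall x, `|P x| <= B) ->
  (forall e : R, 0 < e -> exists N, forall n, (N <= n)%N -> forall x, `|prod_op n psi x - P x| <= e) ->
  corr (v 0%N) P t = psi t.
Proof.
move=> tp mP PB hP; have [ip bp] := tame_props tp.
have [_ iv _] := chain_tame 0; have fv := (n1_integrable iv).2.
apply/eqP; rewrite -subr_eq0 -normr_le0; apply/ler_addgt0Pr => e e0; rewrite add0r.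
(* The three L^1 norms are the factors multiplying the three uniform errors; the 1 makes K
   positive. *)
pose K := fine (n1 (v 0%N)) + fine (n1 psi) + fine (n1 psi^[2]) + 1.
have n0 (f : R -> R) : 0 <= fine (n1 f) by apply: fine_ge0; exact: n1_ge0.
have K0 : 0 < K by rewrite /K; have := n0 (v 0%N); have := n0 psi; have := n0 psi^[2]; lra.
have eK : 0 < e / K by exact: divr_gt0.
have [N1 h1] := hP _ eK.
have [_ _ _ hlap] := hv; have [N2 h2] := hlap _ eK.
pose n := maxn N1 N2.
have {}h1 := h1 n (leq_maxl _ _).
have n2 : (N2 <= n.*2)%N by rewrite -addnn; apply: leq_trans (leq_addr _ _); exact: leq_maxr.
have {}h2 := h2 _ n2.
have mO : measurable_fun setT (prod_op n psi).
  rewrite /prod_op /symb; apply: measurable_sum => k.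
  apply: measurable_funM => //; apply: measurable_funM => //.
  exact: (rsmooth_meas _ tp.1).
have OB x : `|prod_op n psi x| <= B + e / K.
  by have := ler_normD (prod_op n psi x - P x) (P x); rewrite subrK; have := h1 x; have := PB x; lra.
have d1 : `|corr (v 0%N) P t - corr (v 0%N) (prod_op n psi) t| <= e / K * fine (n1 (v 0%N)).
  rewrite /corr -RintegralB//; [|exact: (corr_int t iv mP PB)|exact: (corr_int t iv mO OB)].
  under eq_Rintegral do rewrite -mulrBr.
  apply: (Rint_le (u := fun s => P (t + s) - prod_op n psi (t + s)) iv).
    by apply: measurable_funB; exact: measurable_shift.
  by move=> x; rewrite distrC.
have d2 q : `|corr (v n.*2) psi^[q] t - corr (@laplace R) psi^[q] t| <= e / K * fine (n1 psi^[q]).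
  have mpq := rsmooth_meas q tp.1; have [_ iq bvq] := chain_tame n.*2.
  have mv := (n1_integrable iq).1; have ml := good_meas (laplace_good R).
  have [B' hB'] := bvq 0%N; have lB := good_bound (laplace_good R).
  rewrite !corrE//; under eq_Rintegral do rewrite mulrC.
  under [X in _ - X]eq_Rintegral do rewrite mulrC.
  rewrite -RintegralB//.
  - under eq_Rintegral do rewrite -mulrBr.
    apply: (Rint_le (u := fun x => v n.*2 (x - t) - @laplace R (x - t)) (ip q)) => //.
    by apply: measurable_funB; exact: measurable_refl.
  - by apply: (integrable_bmul (ip q) (measurable_refl t mv) (fun x => hB' (x - t))).
  - by apply: (integrable_bmul (ip q) (measurable_refl t ml) (fun x => lB (x - t))).
have E := corr_laplace_inv t tp.1 bp.
have E' := chain_op n t tp.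
have d20 := d2 0%N; have d22 := d2 2%N; rewrite -[psi^[0]]/psi in d20.
have -> : corr (v 0%N) P t - psi t = (corr (v 0%N) P t - corr (v 0%N) (prod_op n psi) t) +
   ((corr (v n.*2) psi t - corr (@laplace R) psi t) - (corr (v n.*2) psi^[2] t - corr (@laplace R) psi^[2] t)).
  by rewrite E' -E; ring.
apply: le_trans (ler_normD _ _) _; apply: le_trans (lerD d1 (ler_normB _ _)) _.
apply: (@le_trans _ _ (e / K * fine (n1 (v 0%N)) + (e / K * fine (n1 psi) + e / K * fine (n1 psi^[2])))).
  by rewrite lerD2l; apply: lerD.
rewrite -!mulrDr -[leRHS](divfK (lt0r_neq0 K0)); apply: ler_wpM2l; first exact: ltW.
rewrite /K; lra.
Qed.

End chain.
End resolvent_chain.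

(** * The operator and its transpose on test functions *)

Section product_operator.
Variables (R : realType) (M : nat -> R).
Hypothesis M_gt0 : forall p, 0 < M p.
Hypothesis M_0 : M 0%N = 1.
Hypothesis hM1 : cond_M1 M.
Hypothesis hM3' : cond_M3' M.
Variable l : R.
Hypothesis l_gt0 : 0 < l.
Notation mu := (@lebesgue_measure R).

Lemma sum_even (V : zmodType) (f : nat -> V) n :
  \sum_(p < n) (if odd p then 0 else f p./2) = \sum_(k < uphalf n) f k.
Proof.
elim: n => [|n IH]; first by rewrite !big_ord0.
rewrite big_ord_recr/= IH uphalf_half; case: ifP => on; rewrite ?addr0 ?add0n ?add1n//.
by rewrite big_ord_recr.
Qed.

Variable S : R.
Hypothesis hS : forall n, \sum_(i < n) csym M l i <= S.

Let alpha := acoef (csym_gt0 M_gt0 l_gt0) hS.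

Definition prod_coef (p : nat) : R[i] := if odd p then 0 else (alpha p./2)%:C.

Lemma prod_coef_class : cond_M2_inf M -> cond_M3 M -> of_class Beurling M prod_coef.
Proof.
move=> hM2 hM3; have [C [Q [C0 Q0 hC]]] := acoef_class M_gt0 M_0 hM1 l_gt0 hS hM2 hM3.
exists Q, C; split => // p p0; rewrite /prod_coef; case: ifPn => op.
  by rewrite modcR normr0 divr_ge0 ?(ltW (M_gt0 p))// mulr_ge0 ?(ltW C0)// exprn_ge0// ltW.
rewrite modcR ger0_norm; last exact/ltW/acoef_gt0.
have E : p = (p./2).*2 by rewrite -{1}(odd_double_half p) (negbTE op).
rewrite {2 3}E; apply: hC; case: p p0 op {E} => [//|[//|p]] _ _; exact: isT.
Qed.

Lemma csym_product n (x : R) :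
  (1 + x ^+ 2) * \prod_(1 <= p < n.+1) (1 + x ^+ 2 / (l ^+ 2 * (M p / M p.-1) ^+ 2)) =
  symb (csym M l) n (fun k => x ^+ k.*2).
Proof.
have -> : (fun k => x ^+ k.*2) = (fun k => (x ^+ 2) ^+ k).
  by apply/funext => k; rewrite -exprM mul2n.
rewrite symb_prod big_add1/= big_mkord; congr (_ * _); apply: eq_bigr => i _.
by congr (1 + _); rewrite [RHS]mulrC /csym [in RHS]exprMn.
Qed.

Lemma prod_coef_symbol : is_product_symbol M (fun=> l) prod_coef.
Proof.
move=> x; have [C C0 hC] := acoef_small (csym_gt0 M_gt0 l_gt0) hS x.
have ha k : 0 <= alpha k := ltW (acoef_gt0 _ _ k).
have xe k : 0 <= x ^+ k.*2 by rewrite -mul2n exprM exprn_ge0// sqr_ge0.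
have hu k : modc ((alpha k * x ^+ k.*2)%:C : R[i]) <= C * 2^-1 ^+ k.
  by rewrite modcR ger0_norm; [exact: hC|exact: mulr_ge0].
have [z hz] := geometric_tail (ltW C0) hu.
have E m : \sum_(k < m) ((alpha k * x ^+ k.*2)%:C : R[i]) = (\sum_(k < m) alpha k * x ^+ k.*2)%:C.
  by rewrite rmorph_sum.
have hr m : `|complex.Re z - \sum_(k < m) alpha k * x ^+ k.*2| <= 2 * C * 2^-1 ^+ m.
  apply: le_trans (hz m); rewrite E.
  have := modc_re (z - (\sum_(k < m) alpha k * x ^+ k.*2)%:C).
  by case: (z) => a b.
exists (complex.Re z); split.
  under eq_fun do rewrite csym_product.
  apply/cvgrPdist_le => e e0.
  have [N hN] := symb_tannery (csym_gt0 M_gt0 l_gt0) hS C0 e0.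
  exists N => // n /= Nn; rewrite distrC; apply: (hN n Nn) => // k.
  by rewrite ger0_norm; [exact: hC|exact: xe].
apply: cvg_modc => e e0; have [N hN] := half_pow_small (2 * C) e0.
(* Odd coefficients vanish: n terms of the series in x hold [uphalf n] terms of the series in
   x^2. *)
exists N.*2 => n Nn; rewrite /series/= big_mkord.
have -> : \sum_(k < n) prod_coef k * x%:C ^+ k = \sum_(k < uphalf n) ((alpha k * x ^+ k.*2)%:C : R[i]).
  rewrite -(sum_even (fun k => (alpha k * x ^+ k.*2)%:C : R[i])).
  apply: eq_bigr => p _; rewrite /prod_coef; case: ifPn => op; first by rewrite mul0r.
  by rewrite rmorphM rmorphXn/= halfK (negbTE op) subn0.
rewrite E -rmorphB modcR distrC; apply: le_lt_trans (hr _) _; apply: hN.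
by have := uphalf_leq Nn; rewrite uphalf_double.
Qed.

Lemma transpose_partial (phi : R -> R[i]) (t : R) m :
  \sum_(p < m.*2) (-1) ^+ p * prod_coef p * ((- 'i%C) ^+ p * cderiv p phi t) =
  \sum_(k < m) (alpha k * (-1) ^+ k)%:C * cderiv k.*2 phi t.
Proof.
have -> : \sum_(k < m) (alpha k * (-1) ^+ k)%:C * cderiv k.*2 phi t =
   \sum_(k < uphalf m.*2) (alpha k * (-1) ^+ k)%:C * cderiv k.*2 phi t by rewrite uphalf_double.
rewrite -(sum_even (fun k => (alpha k * (-1) ^+ k)%:C * cderiv k.*2 phi t)).
apply: eq_bigr => p _; rewrite /prod_coef; case: ifPn => op.
  by rewrite mulr0 mul0r.
have E : (p : nat) = (p./2).*2 by rewrite -{1}(odd_double_half p) (negbTE op).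
have i2 : (- 'i%C : R[i]) ^+ 2 = -1 by rewrite sqrrN sqr_i.
rewrite {1 3 4}E -mul2n !exprM sqrrN expr1n expr1n mul1r i2 mulrA mul2n -E.
by rewrite rmorphM rmorphXn/= rmorphN1.
Qed.

Lemma Re_real_sum (m : nat) (w : nat -> R) (z : nat -> R[i]) :
  complex.Re (\sum_(k < m) (w k)%:C * z k) = \sum_(k < m) w k * complex.Re (z k) /\
  complex.Im (\sum_(k < m) (w k)%:C * z k) = \sum_(k < m) w k * complex.Im (z k).
Proof.
elim: m => [|m [IH1 IH2]]; first by rewrite !big_ord0.
rewrite !big_ord_recr/= -IH1 -IH2; case: (bigop _ _ _) => a b; case: (z m) => a' b' /=.
by split; ring.
Qed.

(** The coefficients and the kernel v_0 are real, so real and imaginary parts are treated alike, [f]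
    being one or the other. The uniform convergence asked by [chain_inverse] comes from
    [symb_tannery]. *)
Lemma transpose_inverse (phi : R -> R[i]) v : cond_M2_inf M -> cond_M3 M -> resolvent_chain M l v ->
  carrier (Dtest M Beurling) phi ->
  (forall t, corr (v 0%N) (fun s => complex.Re (transpose_op prod_coef phi s)) t = complex.Re (phi t)) /\
  (forall t, corr (v 0%N) (fun s => complex.Im (transpose_op prod_coef phi s)) t = complex.Im (phi t)).
Proof.
move=> hM2 hM3 hv hphi; have ha := prod_coef_class hM2 hM3.
have [C1 C10 h1] := class_symbol_bound M_gt0 ha hphi.
have [C2 C20 h2] := transpose_op_tail M_gt0 ha hphi.
have [r [K [r0 K0 kv kB kc]]] := transpose_op_kernel M_gt0 ha hphi.
have C0 : 0 < C1 + C2 by exact: addr_gt0.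
have /(carrier_DtestP M_gt0)[[s1 [r1 [r10 cs1]] _] [s2 [r2 [r20 cs2]] _]] := hphi.
have half0 n : 0 <= (2^-1 : R) ^+ n by rewrite exprn_ge0// invr_ge0.
have key (f : R[i] -> R) (psi : R -> R) : tame psi -> (forall a b, f a - f b = f (a - b)) ->
    (forall z, `|f z| <= modc z) -> (forall p t, psi^[p] t = f (cderiv p phi t)) ->
    (forall m (w : nat -> R) (z : nat -> R[i]), f (\sum_(k < m) (w k)%:C * z k) = \sum_(k < m) w k * f (z k)) ->
    forall t, corr (v 0%N) (fun s => f (transpose_op prod_coef phi s)) t = psi t.
  move=> tp fB fle fd fS t.
  apply: (chain_inverse M_gt0 hM1 l_gt0 hv (B := K) t tp).
  - apply: continuous_measurable_fun => s; apply/cvgrPdist_lt => e e0.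
    have e2 : 0 < e / 2 by rewrite divr_gt0.
    have [d d0 hd] := kc _ e2; apply/nbhs_ballP; exists d => //= s' ss'.
    rewrite fB; apply: le_lt_trans (fle _) _; apply: le_lt_trans (hd _ _ ss') _; lra.
  - by move=> s; apply: le_trans (fle _) (kB s).
  (* One constant C1 + C2 serves both requirements: C1 dominates the terms, C2 the tail. The orders
     being even, the available decay is 2^(-2k), better than the 2^(-k) required. *)
  move=> e e0; have [N hN] := symb_tannery (csym_gt0 M_gt0 l_gt0) hS C0 e0.
  exists N => n Nn s; apply: (hN n Nn) => [k|m].
    rewrite normrM normrX normrN1 expr1n mul1r fd.
    have a0 : 0 <= alpha k := ltW (acoef_gt0 _ _ k).
    have := h1 k.*2 s; rewrite /prod_coef odd_double doubleK modcR (ger0_norm a0).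
    move=> h; apply: (@le_trans _ _ (C1 * 2^-1 ^+ k.*2)).
      by apply: le_trans h; apply: ler_wpM2l (fle _).
    apply: (@le_trans _ _ (C1 * 2^-1 ^+ k)).
      rewrite ler_wpM2l ?(ltW C10)// -addnn exprD ler_piMr// exprn_ile1 ?invr_ge0//; lra.
    by rewrite ler_wpM2r// lerDl ltW.
  have := h2 s m.*2; rewrite transpose_partial => h.
  have -> : \sum_(k < m) acoef (csym_gt0 M_gt0 l_gt0) hS k * ((-1) ^+ k * psi^[k.*2] s) =
     f (\sum_(k < m) (alpha k * (-1) ^+ k)%:C * cderiv k.*2 phi s).
    rewrite (fS m (fun k => alpha k * (-1) ^+ k) (fun k => cderiv k.*2 phi s)).
    by apply: eq_bigr => k _; rewrite fd mulrA.
  rewrite fB; apply: le_trans (fle _) _; apply: le_trans h _.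
  apply: (@le_trans _ _ (2 * C2 * 2^-1 ^+ m)).
    rewrite ler_wpM2l ?mulr_ge0 ?(ltW C20)// -addnn exprD ler_piMr// exprn_ile1 ?invr_ge0//; lra.
  by rewrite ler_wpM2r// ler_wpM2l// lerDr ltW.
split.
  apply: (key (@complex.Re R) (fun t => complex.Re (phi t))) => //.
  - by split => //; exists r1.
  - by move=> [a b] [a' b'].
  - exact: modc_re.
  - by move=> m w z; have [] := Re_real_sum m w z.
apply: (key (@complex.Im R) (fun t => complex.Im (phi t))) => //.
- by split => //; exists r2.
- by move=> [a b] [a' b'].
- exact: modc_im.
- by move=> m w z; have [] := Re_real_sum m w z.
Qed.

End product_operator.

(** G = v_0 is only known to satisfy the bound at h = 2 h0, so T * G is the function F given by
    [AA_density]. The condition attached to F is that corr G psi lie in D_{L^1}; for psi a real or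
    imaginary part of P^t phi this correlation is the same part of phi. *)
Lemma iii_to_i (R : realType) (X : completeNormedModType R[i]) (M : nat -> R) (T : (R -> R[i]) -> X) :
  (forall p, 0 < M p) -> M 0%N = 1 -> cond_M1 M -> cond_M3' M ->
  continuous_linear (DL1 M Beurling) T -> cond_M2_inf M -> cond_M3 M ->
  assertion_iii Beurling M T -> assertion_i Beurling M T.
Proof.
move=> M_gt0 M0 hM1 hM3' hT hM2 hM3 hiii.
have [h0 [C [h00 C0 hC]]] := T_bound_Beurling M_gt0 hT.
pose l := (4 * h0)^-1; have l0 : 0 < l by rewrite invr_gt0 mulr_gt0.
have [S hS] := csym_sum M_gt0 l0 hM3'.
have [v hv] := resolvent_chain_exists M_gt0 hM3' l0.
have [sv iv bv] := chain_tame M_gt0 hM1 l0 hv 0.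
have L := chain_L1b M_gt0 M0 hM1 l0 hv.
have hh : h0 < (2 * l)^-1.
  have -> : (2 * l)^-1 = 2 * h0 by rewrite /l; field; exact: lt0r_neq0.
  lra.
have [F FA hF] := AA_density M_gt0 M0 hM3' hT h00 hh C0 hC sv L
  (fun u => assertion_iii_real M_gt0 hiii).
pose a := prod_coef M_gt0 l0 hS.
have ha : of_class Beurling M a by exact: prod_coef_class.
exists (fun=> l), a; split => //; first by exists l.
  exact: prod_coef_symbol.
exists F, (fun=> 0); split => //; first exact: AA_cst0.
move=> phi hphi; have [i1 i2] := transpose_inverse M_gt0 M0 hM1 l0 hS hM2 hM3 hv hphi.
have [r [K hk]] := transpose_op_kernel M_gt0 ha hphi; have [r0 K0 kv kB kc] := hk.
have /(carrier_DtestP M_gt0)[t1 t2] := hphi.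
set P := transpose_op a phi in kv kB kc hk *.
have part (f : R[i] -> R) u : (forall a b, f a - f b = f (a - b)) -> (forall z, `|f z| <= modc z) ->
    ET M Beurling u -> (forall t, corr (v 0%N) (fun s => f (P s)) t = u t) ->
    [/\ continuous (fun s => f (P s)), csupp r (fun s => f (P s)) &
    T (rc u) = vint (fun x => (f (P x))%:C *: F x)].
  move=> fB fle tu E.
  have cP : continuous (fun s => f (P s)).
    move=> s; apply/cvgrPdist_lt => e e0.
    have e2 : 0 < e / 2 by rewrite divr_gt0.
    have [d d0 hd] := kc _ e2; apply/nbhs_ballP; exists d => //= s' ss'.
    rewrite fB; apply: le_lt_trans (fle _) _; apply: le_lt_trans (hd _ _ ss') _; lra.
  have sP : csupp r (fun s => f (P s)).
    move=> s /kv ->; apply/eqP; rewrite -normr_le0; apply: le_trans (fle _) _.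
    by rewrite modcR normr0.
  split => //; have Eu : corr (v 0%N) (fun s => f (P s)) = u by apply/funext.
  rewrite -{1}Eu; apply: (hF _ r cP r0 sP); rewrite Eu; exact: ET_EL1.
have [c1 s1 E1] : [/\ continuous (fun s => complex.Re (P s)), csupp r (fun s => complex.Re (P s)) &
    T (rc (fun t => complex.Re (phi t))) = vint (fun x => (complex.Re (P x))%:C *: F x)].
  by apply: (part (@complex.Re R)) => //; [case=> ? ? [? ?]|exact: modc_re].
have [c2 s2 E2] : [/\ continuous (fun s => complex.Im (P s)), csupp r (fun s => complex.Im (P s)) &
    T (rc (fun t => complex.Im (phi t))) = vint (fun x => (complex.Im (P x))%:C *: F x)].
  by apply: (part (@complex.Im R)) => //; [case=> ? ? [? ?]|exact: modc_im].
have rr : - r <= r by lra.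
have g0 : regular (fun=> 0 : X) phi = 0.
  have c0 : continuous (fun _ : R => 0 : R) by move=> x; exact: cvg_cst.
  have E0 := vint_scale_cst (0 : X) c0 rr (fun _ _ => erefl).
  apply: (etrans _ (etrans E0 (scaler0 _ _))).
  by rewrite /regular; congr vint; apply/funext => x; rewrite !scaler0.
rewrite g0 addr0 (T_complex M_gt0 hT (ET_EL1 t1) (ET_EL1 t2)) E1 E2.
rewrite /apply_op /regular -/P.
have cF := FA.1.
have cc1 : continuous (fun x => (complex.Re (P x))%:C *: F x) by exact: continuous_rscale.
have cc2 : continuous (fun x => (complex.Im (P x))%:C *: F x) by exact: continuous_rscale.
rewrite -(vint_lin 'i%C rr cc2 cc1 (csupp_vanish F s2) (csupp_vanish F s1)).
congr vint; apply/funext => x; rewrite scalerA -scalerDl; congr (_ *: _).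
by case: (P x) => p q; apply/eqP; rewrite eq_complex/=; apply/andP; split; apply/eqP; ring.
Qed.

Theorem corollary3p2 (R : realType) (X : completeNormedModType R[i])
    (M : nat -> R) (M_gt0 : forall p : nat, 0 < M p) (M_0 : M 0%N = 1)
    (hM1 : cond_M1 M) (hM2 : cond_M2 M) (hM3' : cond_M3' M)
    (c : ultra_class) (T : (R -> R[i]) -> X)
    (hT : continuous_linear (DL1 M c) T) :
  [/\ assertion_i c M T -> assertion_ii c M T,
      assertion_ii c M T -> assertion_iii c M T
    & assertion_iii c M T <-> assertion_iv c M T] /\
  (c = Beurling -> cond_M2_inf M -> cond_M3 M ->
   [/\ assertion_i c M T <-> assertion_ii c M T,
       assertion_ii c M T <-> assertion_iii c M T
     & assertion_iii c M T <-> assertion_iv c M T]).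
Proof.
have i_ii : assertion_i c M T -> assertion_ii c M T.
  by move=> [r [a [_ _ ha hrep]]]; exists a.
have ii_iii : assertion_ii c M T -> assertion_iii c M T by exact: ii_to_iii.
have iii_iv : assertion_iii c M T <-> assertion_iv c M T.
  by split; [exact: iii_to_iv|exact: iv_to_iii].
split => // cB hM2' hM3.
have iii_i : assertion_iii c M T -> assertion_i c M T.
  by move: hT; rewrite cB => hTB; exact: iii_to_i.
by split => //; split => // h; [exact/iii_i/ii_iii|exact/i_ii/iii_i].
Qed.
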